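(* Let $U\subset\mathbb{R}^n$ be open, let $E$ be sub area-minimizing in $U$ and $F$ super area-minimizing in $U$, with $E\subset F$ and $\partial E\cap\partial F\subset\subset U$. Suppose moreover that $\overline{E}\cap U=\overline{E^i}\cap U$, where $E^i$ is the topological interior of $E$. Then, relative to $U$, either $\partial E\cap\partial F=\emptyset$, or else $\partial E=\partial F$ in a neighborhood of $\partial E\cap\partial F$.
   Context: All sets are sets of locally finite perimeter, with perimeter $P(E,U)=\|\nabla\chi_E\|(U)$ (total variation of the distributional gradient of the characteristic function). Sets are normalized by the convention that $E$ is replaced by the representative $E\cup E_1\setminus E_0$, where $E_i=\{x:|E\cap B(x,r)|/|B(x,r)|=i \text{ for all small } r>0\}$, $i=0,1$. $X\subset\subset Y$ means $\overline X$ is a compact subset of the interior of $Y$. For $U$ open and bounded: $E$ is area-minimizing in $U$ if $P(E,U)\le P(F,U)$ whenever $E\Delta F\subset\subset U$; $E$ is super area-minimizing in $U$ if $P(E,U)\le P(E\cup F,U)$ whenever $E\Delta F\subset\subset U$; $E$ is sub area-minimizing in $U$ if $P(E,U)\le P(E\cap F,U)$ whenever $E\Delta F\subset\subset U$. $\partial E$ denotes the topological boundary. *)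

(* Defs.v *)
From HB Require Import structures.
From mathcomp Require Import all_boot all_order all_algebra.
From mathcomp Require Import all_classical all_reals all_analysis.
Set Implicit Arguments. Unset Strict Implicit. Unset Printing Implicit Defensive.
Import Order.TTheory GRing.Theory Num.Theory.
Import numFieldNormedType.Exports.
Local Open Scope classical_set_scope.
Local Open Scope ring_scope.

Section Defs.
Variable R : realType.

Definition rcons0 (n : nat) (x : R) (v : 'rV[R]_n) : 'rV[R]_n.+1 :=
  \row_(i < n.+1) (if unlift ord0 i is Some j then v 0 j else x).

(* iterated Lebesgue integral over R^n (Fubini/Tonelli: equals the Lebesgue
   integral on R^n for Borel nonnegative or integrable integrands) *)
Fixpoint iint (n : nat) : ('rV[R]_n -> \bar R) -> \bar R :=
  match n return ('rV[R]_n -> \bar R) -> \bar R with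
  | 0 => fun f => f 0
  | m.+1 => fun f =>
      (\int[@lebesgue_measure R]_(x in [set: R]) iint (fun v => f (rcons0 x v)))%E
  end.

Definition borel (n : nat) (A : set 'rV[R]_n) : Prop := <<s open >> A.

Definition leb (n : nat) (A : set 'rV[R]_n) : \bar R :=
  iint (fun x => ((\1_A x : R)%:E)).

Definition lebmeas (n : nat) (A : set 'rV[R]_n) : Prop :=
  exists B C, [/\ borel B, borel C, B `<=` A, A `<=` C & leb (C `\` B) = 0%E].

Definition lmeas (n : nat) (A : set 'rV[R]_n) : \bar R :=
  ereal_sup [set leb B | B in [set B | borel B /\ B `<=` A]].

Definition enorm (n : nat) (v : 'rV[R]_n) : R :=
  Num.sqrt (\sum_(i < n) (v 0 i) ^+ 2).
Definition eball (n : nat) (x : 'rV[R]_n) (r : R) : set 'rV[R]_n :=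
  [set y | enorm (y - x) < r].

Definition ebounded (n : nat) (A : set 'rV[R]_n) : Prop :=
  exists M : R, forall x, A x -> enorm x <= M.

Definition relcc (n : nat) (X Y : set 'rV[R]_n) : Prop :=
  compact (closure X) /\ closure X `<=` interior Y.

Definition tbd (n : nat) (A : set 'rV[R]_n) : set 'rV[R]_n :=
  closure A `\` interior A.

Definition ev (n : nat) (i : 'I_n) : 'rV[R]_n := delta_mx 0 i.

Definition admissible (n : nat) (U : set 'rV[R]_n) (phi : 'rV[R]_n -> 'rV[R]_n)
  : Prop :=
  [/\ (forall j i x, derivable (fun y => phi y 0 j) x (ev i)),
      (forall j i, continuous (fun x => derive (fun y => phi y 0 j) x (ev i))),
      (exists K, [/\ compact K, K `<=` U & forall x, ~ K x -> phi x = 0]) &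
      (forall x, enorm (phi x) <= 1)].

Definition div (n : nat) (phi : 'rV[R]_n -> 'rV[R]_n) (x : 'rV[R]_n) : R :=
  \sum_(j < n) derive (fun y => phi y 0 j) x (ev j).

(* P(E,U) = sup { int_E div phi : phi admissible }, the integral over the
   Lebesgue measurable E being computed over any Borel kernel B of E *)
Definition perimeter (n : nat) (E U : set 'rV[R]_n) : \bar R :=
  ereal_sup [set I | exists phi B, [/\ admissible U phi, borel B, B `<=` E,
     (exists C, [/\ borel C, E `<=` C & leb (C `\` B) = 0%E]) &
     I = iint (fun x => ((\1_B x * div phi x)%:E))]].

Definition locfinper (n : nat) (E : set 'rV[R]_n) : Prop :=
  lebmeas E /\ forall V, open V -> ebounded V -> (perimeter E V < +oo)%E.

Definition dens1 (n : nat) (E : set 'rV[R]_n) : set 'rV[R]_n :=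
  [set x | exists2 r0 : R, 0 < r0 & forall r, 0 < r < r0 ->
     lmeas (E `&` eball x r) = lmeas (eball x r)].
Definition dens0 (n : nat) (E : set 'rV[R]_n) : set 'rV[R]_n :=
  [set x | exists2 r0 : R, 0 < r0 & forall r, 0 < r < r0 ->
     lmeas (E `&` eball x r) = 0%E].

Definition normalized (n : nat) (E : set 'rV[R]_n) : Prop :=
  E = (E `|` dens1 E) `\` dens0 E.

Definition symdiff (n : nat) (A B : set 'rV[R]_n) : set 'rV[R]_n :=
  (A `\` B) `|` (B `\` A).

Definition sub_amin (n : nat) (E U : set 'rV[R]_n) : Prop :=
  forall F, locfinper F -> relcc (symdiff E F) U ->
    (perimeter E U <= perimeter (E `&` F) U)%E.
Definition super_amin (n : nat) (E U : set 'rV[R]_n) : Prop :=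
  forall F, locfinper F -> relcc (symdiff E F) U ->
    (perimeter E U <= perimeter (E `|` F) U)%E.

End Defs.

(* Main.v *)
(** Let [K] be the contact set and [C], [W] a closed and an open neighbourhood of
    [K] in [U]. For a small vector [v] the set [F_v = F u (C n (E - v))] agrees with
    [F u (E - v)] in [W], so submodularity of the perimeter and the sub-minimality
    of the translate [E - v] give [P(F_v, W) <= P(F, W)]. Averaging the indicators of
    [F_v] against a probability kernel [r] concentrated near [0] gives a function
    [w >= 1_F] whose superlevel sets are competitors for [F]; by a coarea argument
    its variation in [W] is at least [P(F, W)], so nothing is lost in the average.
    Equality lets one test the sets [F_v] simultaneously with the fields
    [z k(v) + r(v) (1 - z) phi], where [|k(v)| <= r(v)]. On an open subset of
    [C \ F], where [w] is the average of the translates of [E], this reads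
    [- div (E * k) <= |grad (E * r)|]. When [r] is the half sum of two translated
    mollifiers the triangle inequality must be an equality, so the
    gradients of all mollifications of [1_E] near a point of [C \ F] have one
    common direction. Hence [E] is a half space near any contact point to which the
    exterior of [F] is close. Passing to complements exchanges the roles: since
    the interior of [E] accumulates at each contact point, [F] is a half space
    there; then the exterior of [F] accumulates as well, and [E] is a half space with
    the same boundary. *)

Require Import Defs.
From HB Require Import structures.
From mathcomp Require Import all_boot all_order all_algebra.
From mathcomp Require Import all_classical all_reals all_analysis.
From mathcomp Require Import measurable_realfun.
From mathcomp Require Import ring lra.
Set Implicit Arguments. Unset Strict Implicit. Unset Printing Implicit Defensive.
Import Order.TTheory GRing.Theory Num.Theory.
Import numFieldNormedType.Exports.
Local Open Scope classical_set_scope.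
Local Open Scope ring_scope.

(** * Lebesgue measure on row vectors *)

(** Compactness of the contact set takes the place of regularity theory. On the compact shell
    between [C] and [W] the closure of [E] lies inside the interior of [F], so [E] may be translated
    by every small vector, in all directions, without leaving [F] there. A single translate yields
    only an inequality between perimeters; the average is a smooth function off [F], and there the
    lack of any loss can be read pointwise from its gradient. The bound |k(v)| <= r(v) is what keeps
    z k(v) + r(v) (1 - z) phi within norm r(v), hence a test of [F_v] with weight r(v). If g1 and g2
    are gradients of mollifications with kernels k1 and k2, the choice k = - (k1 g1/|g1| + k2
    g2/|g2|)/2 gives |g1| + |g2| <= |g1 + g2|. A common gradient direction makes every mollification
    monotone along it. As the scale tends to 0, no part of [E] of positive mass can lie behind a
    part of the complement of positive mass, and at a boundary point this forces a half space. *)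

HB.instance Definition _ (R : realType) (n : nat) :=
  Measurable.copy 'rV[R]_n (g_sigma_algebraType (@open 'rV[R]_n)).

Lemma continuous_sum (R : realType) (T : topologicalType) (I : Type) (r : seq I)
    (f : I -> T -> R) :
  (forall i, continuous (f i)) -> continuous (fun x => \sum_(i <- r) f i x).
Proof.
move=> cf x; apply: cvg_big.
- exact: add_continuous.
- by move=> i _; exact: cf.
Qed.

Section EuclideanNorm.
Variables (R : realType) (n : nat).
Implicit Types u v : 'rV[R]_n.

Lemma enorm_sum_ge0 v : 0 <= \sum_(i < n) v 0 i ^+ 2.
Proof. by apply: sumr_ge0 => i _; exact: sqr_ge0. Qed.

Lemma enorm_ge0 v : 0 <= enorm v.
Proof. exact: sqrtr_ge0. Qed.

Lemma enorm_sqr v : enorm v ^+ 2 = \sum_(i < n) v 0 i ^+ 2.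
Proof. by rewrite sqr_sqrtr// enorm_sum_ge0. Qed.

Lemma enorm0 : enorm (0 : 'rV[R]_n) = 0.
Proof. by rewrite /enorm big1 ?sqrtr0// => i _; rewrite mxE expr0n. Qed.

Lemma enormN v : enorm (- v) = enorm v.
Proof. by congr Num.sqrt; apply: eq_bigr => i _; rewrite mxE sqrrN. Qed.

Lemma enormZ a v : enorm (a *: v) = `|a| * enorm v.
Proof.
rewrite /enorm -sqrtr_sqr -sqrtrM ?sqr_ge0// mulr_sumr.
by congr Num.sqrt; apply: eq_bigr => i _; rewrite mxE exprMn.
Qed.

Lemma coord_le_enorm v i : `|v 0 i| <= enorm v.
Proof.
rewrite -sqrtr_sqr ler_wsqrtr// (bigD1 i)//= lerDl.
by apply: sumr_ge0 => j _; exact: sqr_ge0.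
Qed.

Lemma mxnorm_leP v (r : R) : 0 <= r -> reflect (forall i, `|v 0 i| <= r) (`|v| <= r).
Proof.
move=> r0; rewrite [`|v|]mx_normrE; apply: (iffP idP).
  by move=> /bigmax_leP[_ H] i; exact: (H (0, i)).
by move=> H; apply/bigmax_leP; split => // -[i j] _ /=; rewrite (ord1 i).
Qed.

Lemma coord_le_mxnorm v i : `|v 0 i| <= `|v|.
Proof. exact: (mxnorm_leP v (normr_ge0 v) (lexx _)). Qed.

Lemma mxnorm_ltP v (r : R) : 0 < r -> reflect (forall i, `|v 0 i| < r) (`|v| < r).
Proof.
move=> r0; rewrite [`|v|]mx_normrE; apply: (iffP idP).
  by move=> /bigmax_ltP[_ H] i; exact: (H (0, i)).
by move=> H; apply/bigmax_ltP; split => // -[i j] _ /=; rewrite (ord1 i).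
Qed.

Lemma mxnorm_le_enorm v : `|v| <= enorm v.
Proof. by apply/mxnorm_leP => [|i]; [exact: enorm_ge0|exact: coord_le_enorm]. Qed.

Lemma enorm_eq0 v : enorm v = 0 -> v = 0.
Proof.
move=> v0; apply/rowP => i; rewrite mxE; apply/eqP; rewrite -normr_le0.
by rewrite -v0 coord_le_enorm.
Qed.

Lemma cauchy_schwarz u v :
  \sum_(i < n) u 0 i * v 0 i <= enorm u * enorm v.
Proof.
have [u0|u0] := eqVneq (enorm u) 0.
  by rewrite (enorm_eq0 u0) enorm0 mul0r big1// => i _; rewrite mxE mul0r.
have [v0|v0] := eqVneq (enorm v) 0.
  by rewrite (enorm_eq0 v0) enorm0 mulr0 big1// => i _; rewrite mxE mulr0.
have up : 0 < enorm u by rewrite lt0r u0 enorm_ge0.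
have vp : 0 < enorm v by rewrite lt0r v0 enorm_ge0.
have : 0 <= \sum_(i < n) (u 0 i / enorm u - v 0 i / enorm v) ^+ 2.
  by apply: sumr_ge0 => i _; exact: sqr_ge0.
have -> : \sum_(i < n) (u 0 i / enorm u - v 0 i / enorm v) ^+ 2 =
   (\sum_(i < n) u 0 i ^+ 2) / enorm u ^+ 2 + (\sum_(i < n) v 0 i ^+ 2) / enorm v ^+ 2
   - 2 * ((\sum_(i < n) u 0 i * v 0 i) / (enorm u * enorm v)).
  rewrite !mulr_suml mulr_sumr -big_split/= -sumrB.
  by apply: eq_bigr => i _; field; rewrite u0 v0.
rewrite -!enorm_sqr !divff ?expf_neq0// => H.
have : (\sum_(i < n) u 0 i * v 0 i) / (enorm u * enorm v) <= 1 by lra.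
by rewrite ler_pdivrMr ?mulr_gt0// mul1r.
Qed.

Lemma enormD u v : enorm (u + v) <= enorm u + enorm v.
Proof.
rewrite -(@ler_pXn2r _ 2) ?nnegrE ?addr_ge0 ?enorm_ge0//.
rewrite sqrrD !enorm_sqr.
have -> : \sum_(i < n) (u + v) 0 i ^+ 2 = \sum_(i < n) u 0 i ^+ 2 +
    \sum_(i < n) v 0 i ^+ 2 + 2 * \sum_(i < n) u 0 i * v 0 i.
  by rewrite mulr_sumr -!big_split/=; apply: eq_bigr => i _; rewrite mxE; ring.
have := cauchy_schwarz u v; lra.
Qed.

Lemma enormB u v : enorm (u - v) = enorm (v - u).
Proof. by rewrite -enormN opprB. Qed.

(** Dual description of the unit ball: a bound on a vector field can be checked on scalar functions,
    as in [mollf_admissible]. *)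
Lemma enorm_le1P v :
  (forall u, enorm u <= 1 -> \sum_(i < n) u 0 i * v 0 i <= 1) -> enorm v <= 1.
Proof.
move=> H; have [v0|v0] := eqVneq (enorm v) 0; first by rewrite v0.
have vp : 0 < enorm v by rewrite lt0r v0 enorm_ge0.
have := H ((enorm v)^-1 *: v); rewrite enormZ gtr0_norm ?invr_gt0// mulVf//.
move=> /(_ (lexx _)).
have -> : \sum_(i < n) ((enorm v)^-1 *: v) 0 i * v 0 i = enorm v.
  transitivity ((enorm v)^-1 * enorm v ^+ 2).
    by rewrite enorm_sqr mulr_sumr; apply: eq_bigr => i _; rewrite mxE; ring.
  by field.
by [].
Qed.

Lemma continuous_enorm : continuous (@enorm R n).
Proof.
move=> x; apply: continuous_comp; last exact: sqrt_continuous.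
move: x; apply: continuous_sum => i x.
apply: (@continuous_comp _ _ _ (fun y : 'rV[R]_n => y 0 i) (fun z : R => z ^+ 2)).
  exact: coord_continuous.
exact: exprn_continuous.
Qed.

Lemma continuous_addr (x : 'rV[R]_n) : continuous (fun y : 'rV[R]_n => y + x).
Proof. by move=> y; exact: (@cvgD _ _ _ _ _ _ _ _ _ (@cvg_id _ _) (@cvg_cst _ _ _ _ _)). Qed.

Lemma open_eball x r : open (@eball R n x r).
Proof.
have : continuous (fun y : 'rV[R]_n => enorm (y - x)).
  by move=> y; apply: (@continuous_comp _ _ _ (fun y => y - x)); [exact: continuous_addr|exact: continuous_enorm].
move=> /continuousP/(_ [set z : R | z < r]) H.
by apply: H; exact: open_lt.
Qed.

End EuclideanNorm.

(** * Borel sets and Borel maps on row vectors *)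

Section BorelRV.
Variables (R : realType).

Lemma measurable_open n (A : set 'rV[R]_n) : open A -> measurable A.
Proof. by move=> oA; exact: sub_sigma_algebra. Qed.

Let qbox n (p : 'rV[rat]_n * rat) : set 'rV[R]_n :=
  [set y : 'rV[R]_n | forall i, `|y 0 i - ratr (p.1 0 i)| < ratr p.2].

(** The cubes with rational data are countably many, so measurability into row vectors can be tested
    one coordinate at a time in [measurable_fun_rV]. *)
Lemma open_countable_box n (A : set 'rV[R]_n) : open A ->
  A = \bigcup_(p in [set p | qbox p `<=` A]) qbox p.
Proof.
move=> oA; rewrite predeqE => x; split; last by move=> [p /= pA px]; exact: pA.
move=> Ax; have : nbhs x A by rewrite nbhsE; exists A.
move=> /nbhs_ballP[e /= e0]; rewrite -ball_normE /ball_/= => xeA.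
have [q] := @rat_in_itvoo R 0 (e / 2) (divr_gt0 e0 (ltr0n _ 2)).
rewrite in_itv/= => /andP[q0 qe].
have /choice[c Hc] : forall i, exists r : rat, `|x 0 i - ratr r| < ratr q.
  move=> i; have [r] := @rat_in_itvoo R (x 0 i - ratr q) (x 0 i + ratr q) ltac:(lra).
  by rewrite in_itv/= => /andP[? ?]; exists r; rewrite ltr_norml; apply/andP; split; lra.
exists (\row_i c i, q) => /=; last by move=> i; rewrite mxE; exact: Hc.
move=> y /= Hy; apply: xeA => /=; apply/mxnorm_ltP => // i; rewrite !mxE.
have := Hy i; have := Hc i; rewrite mxE.
move: (x 0 i) (y 0 i) (ratr (c i)) => a b d.
rewrite !ltr_norml => /andP[? ?] /andP[? ?]; apply/andP; split; lra.
Qed.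

Lemma measurable_fun_rV d (T : measurableType d) n (h : T -> 'rV[R]_n) :
  (forall j, measurable_fun setT (fun t => h t 0 j)) -> measurable_fun setT h.
Proof.
move=> mh; apply: (@measurability _ _ _ _ _ _ (@open 'rV[R]_n)) => //.
move=> _ [A oA <-]; rewrite setTI (open_countable_box oA) preimage_bigcup.
rewrite bigcup_mkcond; apply: countable_bigcupT_measurable; first exact: countableP.
move=> p; case: ifPn => // _.
have -> : h @^-1` qbox p = \bigcap_(j in [set: 'I_n])
    ((fun t => h t 0 j) @^-1` [set r | `|r - ratr (p.1 0 j)| < ratr p.2]).
  by rewrite predeqE => t; split=> [H j _|H j]; exact: H.
apply: fin_bigcap_measurable => // j _; rewrite -[X in measurable X]setTI.
apply: mh => //; apply: open_measurable.
have : continuous (fun r : R => `|r - ratr (p.1 0 j)|).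
  move=> r; apply: cvg_norm; exact: (@cvgB _ _ _ _ _ _ _ _ _ (@cvg_id _ _) (@cvg_cst _ _ _ _ _)).
by move=> /continuousP/(_ [set z : R | z < ratr p.2]); apply; exact: open_lt.
Qed.

Lemma continuous_measurable_rV n (f : 'rV[R]_n -> R) :
  continuous f -> measurable_fun setT f.
Proof.
move=> /continuousP cf; apply: (measurability _ (RGenOpens.measurableE R)).
move=> _ [_ [a [b ->] <-]]; rewrite setTI; apply: measurable_open; apply: cf.
exact: interval_open.
Qed.

Lemma measurable_coord n j : measurable_fun setT (fun x : 'rV[R]_n => x 0 j).
Proof. by apply: continuous_measurable_rV; exact: coord_continuous. Qed.

Lemma measurable_eball n (x : 'rV[R]_n) r : measurable (eball x r).
Proof. by apply: measurable_open; exact: open_eball. Qed.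

Lemma measurable_addr n (v : 'rV[R]_n) : measurable_fun setT (fun x : 'rV[R]_n => x + v).
Proof.
apply: measurable_fun_rV => j.
under eq_fun do rewrite mxE.
by apply: measurable_funD => //; exact: measurable_coord.
Qed.

Lemma measurable_add2 n :
  measurable_fun setT (fun p : 'rV[R]_n * 'rV[R]_n => p.1 + p.2).
Proof.
apply: measurable_fun_rV => j; under eq_fun do rewrite mxE.
by apply: measurable_funD; apply: (measurableT_comp (measurable_coord j)).
Qed.

Lemma measurable_sub2 n :
  measurable_fun setT (fun p : 'rV[R]_n * 'rV[R]_n => p.1 - p.2).
Proof.
apply: measurable_fun_rV => j; under eq_fun do rewrite !mxE.
by apply: measurable_funB; apply: (measurableT_comp (measurable_coord j)).
Qed.

Lemma rcons0_ord0 n (x : R) (v : 'rV[R]_n) : rcons0 x v 0 ord0 = x.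
Proof. by rewrite mxE unlift_none. Qed.

Lemma rcons0_lift n (x : R) (v : 'rV[R]_n) j : rcons0 x v 0 (lift ord0 j) = v 0 j.
Proof. by rewrite mxE liftK. Qed.

Definition behead_rV n (v : 'rV[R]_n.+1) : 'rV[R]_n := \row_j v 0 (lift ord0 j).

Lemma rcons0K n (x : R) (v : 'rV[R]_n) : behead_rV (rcons0 x v) = v.
Proof. by apply/rowP => j; rewrite mxE rcons0_lift. Qed.

Lemma rcons0_behead n (v : 'rV[R]_n.+1) : rcons0 (v 0 ord0) (behead_rV v) = v.
Proof.
apply/rowP => j; case: (unliftP ord0 j) => [k|] ->.
  by rewrite rcons0_lift mxE.
by rewrite rcons0_ord0.
Qed.

Lemma measurable_rcons0 n :
  measurable_fun setT (fun p : R * 'rV[R]_n => rcons0 p.1 p.2).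
Proof.
apply: measurable_fun_rV => j; case: (unliftP ord0 j) => [k|] ->.
  by under eq_fun do rewrite rcons0_lift; apply: (measurableT_comp (measurable_coord k)).
by under eq_fun do rewrite rcons0_ord0; exact: measurable_fst.
Qed.

Lemma measurable_behead n :
  measurable_fun setT (fun v : 'rV[R]_n.+1 => (v 0 ord0, behead_rV v)).
Proof.
apply: measurable_fun_pair; first exact: measurable_coord.
by apply: measurable_fun_rV => j; under eq_fun do rewrite mxE; exact: measurable_coord.
Qed.

End BorelRV.
Section RconsMeasure.
Variables (R : realType) (n : nat) (mu : {sigma_finite_measure set 'rV[R]_n -> \bar R}).
Notation leb1 := (@lebesgue_measure R).

(** Pushing the product measure forward along [rcons0] makes Tonelli for the product coincide with
    one unfolding of [iint]. *)
Definition rcons_measure : set 'rV[R]_n.+1 -> \bar R :=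
  pushforward (leb1 \x mu)%E (fun p : R * 'rV[R]_n => rcons0 p.1 p.2).

Let mrc := @measurable_rcons0 R n.

Let rcons_measure0 : rcons_measure set0 = 0%E.
Proof. by rewrite /rcons_measure /pushforward preimage_set0 measure0. Qed.

Let rcons_measure_ge0 A : (0 <= rcons_measure A)%E.
Proof. exact: measure_ge0. Qed.

Let rcons_measure_sigma_additive : semi_sigma_additive rcons_measure.
Proof.
have := @measure_semi_sigma_additive _ _ _
  (measure_function_pushforward__canonical__measure_function_Measure (leb1 \x mu)%E mrc).
exact.
Qed.

HB.instance Definition _ := isMeasure.Build _ _ _ rcons_measure
  rcons_measure0 rcons_measure_ge0 rcons_measure_sigma_additive.

Let rcons_measure_sigma_finite : sigma_finite setT rcons_measure.
Proof.
have /sigma_finiteP[F1 [TF ndF Foo]] := sigma_finiteT leb1.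
have /sigma_finiteP[G [TG ndG Goo]] := sigma_finiteT mu.
pose F k := F1 k `*` G k.
have FT : setT = \bigcup_k F k.
  rewrite -setXTT TF TG predeqE => -[x y]; split.
    move=> [/= [i _ Fix] [k _ Gky]]; exists (maxn i k) => //; split.
    - by move: x Fix; exact/subsetPset/ndF/leq_maxl.
    - by move: y Gky; exact/subsetPset/ndG/leq_maxr.
  by move=> [i _ []/= ? ?]; split; exists i.
have {}Foo k : measurable (F k) /\ ((leb1 \x mu) (F k) < +oo)%E.
  have [? ?] := Foo k; have [? ?] := Goo k.
  split; first exact: measurableX.
  by rewrite product_measure1E// lte_mul_pinfty// ge0_fin_numE.
pose un (v : 'rV[R]_n.+1) := (v 0 ord0, behead_rV v).
have mun : measurable_fun setT un by exact: measurable_behead.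
exists (fun k => un @^-1` F k).
  by rewrite -preimage_bigcup -FT preimage_setT.
move=> k; have [mF Fk] := Foo k; split.
  by rewrite -[X in measurable X]setTI; exact: mun.
rewrite /rcons_measure /pushforward; set H := _ @^-1` _.
suff -> : H = F k by [].
by rewrite predeqE => -[x v]; rewrite /H /= /un /= rcons0_ord0 rcons0K.
Qed.

HB.instance Definition _ := Measure_isSigmaFinite.Build _ _ _ rcons_measure
  rcons_measure_sigma_finite.

Lemma ge0_integral_rcons_measure (f : 'rV[R]_n.+1 -> \bar R) :
  measurable_fun setT f -> (forall x, 0 <= f x)%E ->
  (\int[rcons_measure]_x f x = \int[leb1]_x \int[mu]_v f (rcons0 x v))%E.
Proof.
move=> mf f0; rewrite ge0_integral_pushforward//=.
by rewrite preimage_setT fubini_tonelli1//=; exact: measurableT_comp.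
Qed.

End RconsMeasure.

Section LebesgueMeasureRV.
Variable R : realType.
Notation leb1 := (@lebesgue_measure R).

(** Lebesgue measure on rows, by the same recursion as [iint]; in dimension 0 it is the unit mass at
    the only point. *)
Fixpoint lam n : {sigma_finite_measure set 'rV[R]_n -> \bar R} :=
  match n return {sigma_finite_measure set 'rV[R]_n -> \bar R} with
  | 0 => (\d_ (0 : 'rV[R]_0) : {sigma_finite_measure set 'rV[R]_0 -> \bar R})
  | m.+1 => (rcons_measure (lam m) : {sigma_finite_measure set 'rV[R]_m.+1 -> \bar R})
  end.

Lemma measurable_rcons0_section n (x : R) :
  measurable_fun setT (fun v : 'rV[R]_n => rcons0 x v).
Proof. exact: (measurableT_comp (@measurable_rcons0 R n) (@pair1_measurable _ _ _ _ x)). Qed.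

Lemma ge0_iintE n (f : 'rV[R]_n -> \bar R) : measurable_fun setT f ->
  (forall x, 0 <= f x)%E -> iint f = (\int[lam n]_x f x)%E.
Proof.
elim: n f => [|n IH] f mf f0 /=; first by rewrite integral_dirac//= diracT mul1e.
rewrite ge0_integral_rcons_measure//; apply: eq_integral => x _.
apply: IH => //; exact: (measurableT_comp mf (measurable_rcons0_section x)).
Qed.

(** By uniqueness of Lebesgue measure, it is enough that the pushforward gives half-open intervals
    their length. *)
Lemma lebesgue_measure_shift (a : R) (A : set R) : measurable A ->
  pushforward leb1 (fun x : measurableTypeR R => x + a : measurableTypeR R) A = leb1 A.
Proof.
move=> mA; have ms : measurable_fun setT (fun x : measurableTypeR R => x + a : measurableTypeR R).
  exact: (@measurable_funD _ _ _ setT id (cst a)).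
apply/esym; apply: (lebesgue_measure_unique
  (mu := measure_function_pushforward__canonical__measure_function_Measure leb1 ms)) => //= _ [[x y]] _ <-.
rewrite /pushforward (_ : _ @^-1` _ = `]x - a, y - a]%classic); last first.
  by rewrite predeqE => z /=; rewrite !in_itv/= ltrBlDr lerBrDr.
by rewrite !lebesgue_measure_itv/= !lte_fin ltrD2r; case: ifP => // _; rewrite -!EFinB; congr EFin; ring.
Qed.

Lemma ge0_integral_shift (a : R) (f : R -> \bar R) : measurable_fun setT f ->
  (forall x, 0 <= f x)%E -> (\int[leb1]_x f (x + a)%R = \int[leb1]_x f x)%E.
Proof.
move=> mf f0.
have ms : measurable_fun setT (fun x : measurableTypeR R => x + a : measurableTypeR R).
  exact: (@measurable_funD _ _ _ setT id (cst a)).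
have := @ge0_integral_pushforward _ _ _ _ R _ ms leb1 setT f measurableT mf (fun y _ => f0 y).
rewrite preimage_setT => <-; apply: eq_measure_integral => A mA _.
exact: lebesgue_measure_shift.
Qed.

Lemma rcons0D n (x y : R) (u v : 'rV[R]_n) :
  rcons0 x u + rcons0 y v = rcons0 (x + y) (u + v).
Proof.
by apply/rowP => j; case: (unliftP ord0 j) => [k|] ->; rewrite mxE ?rcons0_lift ?rcons0_ord0 ?mxE.
Qed.

Lemma ge0_integral_translate n (v : 'rV[R]_n) (f : 'rV[R]_n -> \bar R) :
  measurable_fun setT f -> (forall x, 0 <= f x)%E ->
  (\int[lam n]_x f (x + v)%R = \int[lam n]_x f x)%E.
Proof.
elim: n v f => [|n IH] v f mf f0 /=.
  by have -> : v = 0 by [apply/rowP => -[]]; apply: eq_integral => x _; rewrite addr0.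
have mfv : measurable_fun setT (fun x : 'rV[R]_n.+1 => f (x + v)).
  exact: (measurableT_comp mf (measurable_addr v)).
rewrite (ge0_integral_rcons_measure (lam n) mfv (fun x => f0 _)).
rewrite (ge0_integral_rcons_measure (lam n) mf f0).
rewrite -[RHS](@ge0_integral_shift (v 0 ord0)); last 2 first.
- apply: (measurable_fun_fubini_tonelli_F (fun p : R * 'rV[R]_n => f (rcons0 p.1 p.2))) => //.
  exact: (measurableT_comp mf (@measurable_rcons0 R n)).
- by move=> x; apply: integral_ge0.
apply: eq_integral => x _; rewrite -[RHS](IH (behead_rV v)); last 2 first.
- exact: (measurableT_comp mf (measurable_rcons0_section _)).
- by [].
by apply: eq_integral => u _; rewrite -rcons0D rcons0_behead.
Qed.

End LebesgueMeasureRV.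
Lemma cvg_le_cst (R : realType) (u : nat -> R) (l c : R) :
  u k @[k --> \oo] --> l -> (forall k, u k <= c) -> l <= c.
Proof.
move=> ul uc; rewrite -(cvg_lim _ ul)//; apply: limr_le; first by apply/cvg_ex; exists l.
exact: nearW.
Qed.

(** * Bounded functions of bounded support and their integral *)

Section BoundedCompactSupport.
Variable R : realType.

Definition bmeas n (f : 'rV[R]_n -> R) : Prop :=
  measurable_fun setT f /\ exists M : R, forall x, `|f x| <= M.

(** This class is closed under sums, translations and products with [bmeas] functions, and its
    members are integrable, so that [itg] is linear and monotone on it without further side
    conditions. *)
Definition bcsupp n (f : 'rV[R]_n -> R) : Prop :=
  bmeas f /\ exists M : R, forall x, M < `|x| -> f x = 0.

Definition itg n (f : 'rV[R]_n -> R) : R := \int[lam R n]_x f x.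

Lemma rcons0_norm_le n (x : R) (v : 'rV[R]_n) r : 0 <= r ->
  (`|rcons0 x v| <= r) = (`|x| <= r) && (`|v| <= r).
Proof.
move=> r0; apply/(mxnorm_leP _ r0)/andP => [H|[xr /(mxnorm_leP _ r0) vr] j].
  split; first by have := H ord0; rewrite rcons0_ord0.
  by apply/(mxnorm_leP _ r0) => j; have := H (lift ord0 j); rewrite rcons0_lift.
by case: (unliftP ord0 j) => [k|] ->; rewrite ?rcons0_lift ?rcons0_ord0.
Qed.

Definition cbox n (M : R) : set 'rV[R]_n := [set x | `|x| <= M].

Lemma measurable_cbox n (r : R) : measurable (cbox r : set 'rV[R]_n).
Proof.
have -> : cbox r = ~` [set x : 'rV[R]_n | r < `|x|].
  by rewrite predeqE => x /=; split=> [/le_gtF -> //|/negP]; rewrite -leNgt.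
apply: measurableC; apply: measurable_open.
have /continuousP/(_ [set z : R | r < z]) : continuous (fun x : 'rV[R]_n => `|x|).
  exact: norm_continuous.
by apply; exact: open_gt.
Qed.

Lemma lam_cbox_lty n (r : R) : (lam R n [set x | (`|x| <= r)%R] < +oo)%E.
Proof.
have [r0|r0] := ltP r 0.
  rewrite (_ : mkset _ = set0) ?measure0// predeqE => x; split => //= xr.
  by have := le_lt_trans xr r0; rewrite ltNge normr_ge0.
elim: n => [|n IH]; first by rewrite /= diracE ltry.
rewrite /= /rcons_measure /pushforward.
have -> : (fun p : R * 'rV[R]_n => rcons0 p.1 p.2) @^-1` [set x | `|x| <= r] =
    [set x | `|x| <= r] `*` [set x | `|x| <= r].
  by rewrite predeqE => -[x v] /=; rewrite rcons0_norm_le//; split=> [/andP[]|[-> ->]].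
have E : [set x : R | `|x| <= r] = `[- r, r]%classic.
  by rewrite predeqE => x /=; rewrite in_itv/= ler_norml.
have Lr : (@lebesgue_measure R [set x : R | (`|x| <= r)%R] < +oo)%E.
  by rewrite E lebesgue_measure_itv; case: ifP => _; rewrite ltry.
rewrite product_measure1E//; last 2 first.
- by rewrite E; exact: measurable_itv.
- exact: measurable_cbox.
by apply: lte_mul_pinfty => //; rewrite ge0_fin_numE.
Qed.

Lemma lam_cbox_gt0 n (r : R) : 0 < r -> (0 < lam R n [set x | (`|x| <= r)%R])%E.
Proof.
move=> r0; elim: n => [|n IH].
  by rewrite /= diracE mem_set//= normr0; exact: ltW.
rewrite /= /rcons_measure /pushforward.
have -> : (fun p : R * 'rV[R]_n => rcons0 p.1 p.2) @^-1` [set x | `|x| <= r] =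
    [set x | `|x| <= r] `*` [set x | `|x| <= r].
  by rewrite predeqE => -[x v] /=; rewrite rcons0_norm_le ?(ltW r0)//; split=> [/andP[]|[-> ->]].
have E : [set x : R | `|x| <= r] = `[- r, r]%classic.
  by rewrite predeqE => x /=; rewrite in_itv/= ler_norml.
have Lr : (0 < @lebesgue_measure R [set x : R | (`|x| <= r)%R])%E.
  rewrite E lebesgue_measure_itv/= lte_fin (_ : - r < r); last lra.
  by rewrite -EFinB lte_fin; lra.
rewrite product_measure1E//; last 2 first.
- by rewrite E; exact: measurable_itv.
- exact: measurable_cbox.
exact: mule_gt0.
Qed.

Lemma bmeas_cst n (c : R) : bmeas (fun _ : 'rV[R]_n => c).
Proof. by split; [exact: measurable_cst|exists `|c|]. Qed.

Lemma bcsupp_bmeas n (f : 'rV[R]_n -> R) : bcsupp f -> bmeas f.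
Proof. by case. Qed.

Lemma bmeasD n (f g : 'rV[R]_n -> R) : bmeas f -> bmeas g -> bmeas (fun x => f x + g x).
Proof.
move=> [mf [M fM]] [mg [N gN]]; split; first exact: measurable_funD.
by exists (M + N) => x; rewrite (le_trans (ler_normD _ _))// lerD.
Qed.

Lemma bmeasM n (f g : 'rV[R]_n -> R) : bmeas f -> bmeas g -> bmeas (fun x => f x * g x).
Proof.
move=> [mf [M fM]] [mg [N gN]]; split; first exact: measurable_funM.
by exists (M * N) => x; rewrite normrM ler_pM.
Qed.

Lemma bmeasN n (f : 'rV[R]_n -> R) : bmeas f -> bmeas (fun x => - f x).
Proof.
move=> [mf [M fM]]; split; first exact: measurable_funN.
by exists M => x; rewrite normrN.
Qed.

Lemma bmeasB n (f g : 'rV[R]_n -> R) : bmeas f -> bmeas g -> bmeas (fun x => f x - g x).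
Proof. by move=> bf bg; exact: (bmeasD bf (bmeasN bg)). Qed.

Lemma bmeas_norm n (f : 'rV[R]_n -> R) : bmeas f -> bmeas (fun x => `|f x|).
Proof.
move=> [mf [M fM]]; split; first exact: measurableT_comp.
by exists M => x; rewrite normr_id.
Qed.

Lemma bmeas_translate n (f : 'rV[R]_n -> R) v : bmeas f -> bmeas (fun x => f (x + v)).
Proof.
move=> [mf [M fM]]; split; first exact: (measurableT_comp mf (measurable_addr v)).
by exists M.
Qed.

Lemma bmeas_indic n (A : set 'rV[R]_n) : measurable A -> bmeas (\1_A : _ -> R).
Proof.
move=> mA; split; first exact: measurable_indic.
by exists 1 => x; rewrite indicE; case: (_ \in _); rewrite ?normr1 ?normr0.
Qed.

Lemma bmeas_sum n I (r : seq I) (f : I -> 'rV[R]_n -> R) :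
  (forall i, bmeas (f i)) -> bmeas (fun x => \sum_(i <- r) f i x).
Proof.
move=> bf; elim: r => [|i r IH].
  by under eq_fun do rewrite big_nil; exact: bmeas_cst.
by under eq_fun do rewrite big_cons; exact: bmeasD.
Qed.

Lemma bcsuppMr n (f g : 'rV[R]_n -> R) : bcsupp f -> bmeas g -> bcsupp (fun x => f x * g x).
Proof.
move=> [bf [M f0]] bg; split; first exact: bmeasM.
by exists M => x /f0 ->; rewrite mul0r.
Qed.

Lemma bcsuppMl n (f g : 'rV[R]_n -> R) : bcsupp f -> bmeas g -> bcsupp (fun x => g x * f x).
Proof.
by move=> bf bg; under eq_fun do rewrite mulrC; exact: bcsuppMr.
Qed.

Lemma bcsuppD n (f g : 'rV[R]_n -> R) : bcsupp f -> bcsupp g -> bcsupp (fun x => f x + g x).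
Proof.
move=> [bf [M f0]] [bg [N g0]]; split; first exact: bmeasD.
exists (Num.max M N) => x; rewrite gt_max => /andP[/f0 -> /g0 ->].
by rewrite addr0.
Qed.

Lemma bcsuppN n (f : 'rV[R]_n -> R) : bcsupp f -> bcsupp (fun x => - f x).
Proof.
move=> [bf [M f0]]; split; first exact: bmeasN.
by exists M => x /f0 ->; rewrite oppr0.
Qed.

Lemma bcsuppB n (f g : 'rV[R]_n -> R) : bcsupp f -> bcsupp g -> bcsupp (fun x => f x - g x).
Proof. by move=> bf bg; exact: (bcsuppD bf (bcsuppN bg)). Qed.

Lemma bcsuppZ n (f : 'rV[R]_n -> R) c : bcsupp f -> bcsupp (fun x => c * f x).
Proof. by move=> bf; apply: bcsuppMl => //; exact: bmeas_cst. Qed.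

Lemma bcsupp_norm n (f : 'rV[R]_n -> R) : bcsupp f -> bcsupp (fun x => `|f x|).
Proof.
move=> [bf [M f0]]; split; first exact: bmeas_norm.
by exists M => x /f0 ->; rewrite normr0.
Qed.

Lemma bcsupp_cst0 n : bcsupp (fun _ : 'rV[R]_n => 0 : R).
Proof. by split; [exact: bmeas_cst|exists 0]. Qed.

Lemma bcsupp_sum n I (r : seq I) (f : I -> 'rV[R]_n -> R) :
  (forall i, bcsupp (f i)) -> bcsupp (fun x => \sum_(i <- r) f i x).
Proof.
move=> bf; elim: r => [|i r IH].
  by under eq_fun do rewrite big_nil; exact: bcsupp_cst0.
by under eq_fun do rewrite big_cons; exact: bcsuppD.
Qed.

Lemma bcsupp_translate n (f : 'rV[R]_n -> R) v : bcsupp f -> bcsupp (fun x => f (x + v)).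
Proof.
move=> [bf [M f0]]; split; first exact: bmeas_translate.
exists (M + `|v|) => x Mx; apply: f0.
have := ler_normB (x + v) v; rewrite addrK; lra.
Qed.

Lemma bcsupp_le_cbox n (f : 'rV[R]_n -> R) : bcsupp f ->
  exists2 M : R, 0 <= M & forall x, `|f x| <= M * \1_[set x | `|x| <= M] x.
Proof.
move=> [[mf [M fM]] [N f0]]; exists (Num.max (Num.max M N) 0); first by rewrite le_max lexx orbT.
move=> x; rewrite indicE; case: (boolP (_ \in _)) => [_|].
  by rewrite mulr1 (le_trans (fM x))// !le_max lexx.
rewrite notin_setE /= => /negP; rewrite -ltNge !gt_max => /andP[/andP[_ Nx] _].
by rewrite mulr0 f0// normr0.
Qed.

Lemma integrable_cbox n (M : R) :
  (lam R n).-integrable setT (fun x => (M * \1_[set x : 'rV[R]_n | `|x| <= M] x)%:E).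
Proof.
under eq_fun do rewrite EFinM.
apply: integrableZl => //; apply/integrableP; split.
  by apply/measurable_EFinP; apply: measurable_indic; exact: measurable_cbox.
under eq_integral do rewrite gee0_abs ?lee_fin//.
rewrite integral_indic//; last exact: measurable_cbox.
by rewrite setIT lam_cbox_lty.
Qed.

Lemma bcsupp_integrable n (f : 'rV[R]_n -> R) : bcsupp f ->
  (lam R n).-integrable setT (EFin \o f).
Proof.
move=> bf; have [M M0 fM] := bcsupp_le_cbox bf.
apply: (le_integrable measurableT _ _ (integrable_cbox n M)).
  by apply/measurable_EFinP; case: bf => -[].
by move=> x _ /=; rewrite lee_fin (le_trans (fM x))// ler_norm.
Qed.

Lemma itg_EFin n (f : 'rV[R]_n -> R) : bcsupp f ->
  (itg f)%:E = (\int[lam R n]_x (f x)%:E)%E.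
Proof.
by move=> bf; rewrite /itg /Rintegral fineK//; apply: integrable_fin_num => //; exact: bcsupp_integrable.
Qed.

Lemma itgD n (f g : 'rV[R]_n -> R) : bcsupp f -> bcsupp g ->
  itg (fun x => f x + g x) = itg f + itg g.
Proof. by move=> bf bg; apply: RintegralD => //; exact: bcsupp_integrable. Qed.

Lemma itgB n (f g : 'rV[R]_n -> R) : bcsupp f -> bcsupp g ->
  itg (fun x => f x - g x) = itg f - itg g.
Proof. by move=> bf bg; apply: RintegralB => //; exact: bcsupp_integrable. Qed.

Lemma itgZ n (f : 'rV[R]_n -> R) c : bcsupp f -> itg (fun x => c * f x) = c * itg f.
Proof. by move=> bf; apply: RintegralZl => //; exact: bcsupp_integrable. Qed.

Lemma itg0 n : itg (fun _ : 'rV[R]_n => 0 : R) = 0.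
Proof. by rewrite /itg Rintegral_cst// mul0r. Qed.

Lemma itgN n (f : 'rV[R]_n -> R) : bcsupp f -> itg (fun x => - f x) = - itg f.
Proof.
by move=> bf; under [LHS]eq_Rintegral do rewrite -mulN1r; rewrite -/(itg _) itgZ// mulN1r.
Qed.

Lemma itg_sum n I (r : seq I) (f : I -> 'rV[R]_n -> R) :
  (forall i, bcsupp (f i)) -> itg (fun x => \sum_(i <- r) f i x) = \sum_(i <- r) itg (f i).
Proof.
move=> bf; elim: r => [|i r IH].
  by rewrite big_nil -[RHS](itg0 n); congr itg; apply/funext => x; rewrite big_nil.
rewrite big_cons -IH -itgD//; last exact: bcsupp_sum.
by congr itg; apply/funext => x; rewrite big_cons.
Qed.

Lemma le_itg n (f g : 'rV[R]_n -> R) : bcsupp f -> bcsupp g ->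
  (forall x, f x <= g x) -> itg f <= itg g.
Proof. by move=> bf bg fg; apply: le_Rintegral => //; exact: bcsupp_integrable. Qed.

Lemma itg_ge0 n (f : 'rV[R]_n -> R) : (forall x, 0 <= f x) -> 0 <= itg f.
Proof. by move=> f0; apply: Rintegral_ge0. Qed.

Lemma le_norm_itg n (f : 'rV[R]_n -> R) : bcsupp f -> `|itg f| <= itg (fun x => `|f x|).
Proof. by move=> bf; apply: le_normr_Rintegral => //; exact: bcsupp_integrable. Qed.

Lemma itg_translate n (f : 'rV[R]_n -> R) v : bcsupp f ->
  itg (fun x => f (x + v)) = itg f.
Proof.
move=> bf; rewrite /itg /Rintegral; congr fine.
have mf : measurable_fun setT (EFin \o f) by apply/measurable_EFinP; case: bf => -[].
have E : (fun x : 'rV[R]_n => (f (x + v))%:E) = (EFin \o f) \o (fun x => x + v) by [].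
rewrite E [LHS]integralE [RHS]integralE funepos_comp funeneg_comp; congr (_ - _)%E.
  exact: (@ge0_integral_translate R n v _ (measurable_funepos mf)).
exact: (@ge0_integral_translate R n v _ (measurable_funeneg mf)).
Qed.

(** [perimeter] integrates functions of either sign, so Tonelli does not suffice; bounded support
    gives integrability on the product, and Fubini unfolds one coordinate. *)
Lemma iint_bcsupp n (f : 'rV[R]_n -> R) : bcsupp f ->
  iint (fun x => (f x)%:E) = (itg f)%:E.
Proof.
elim: n f => [|n IH] f bf /=.
  by rewrite itg_EFin//= integral_dirac//= ?diracT ?mul1e//; by apply/measurable_EFinP; have [[]] := bf.
have bs x : bcsupp (fun v : 'rV[R]_n => f (rcons0 x v)).
  have [[mf [M fM]] [N f0]] := bf; split; first split.
  - exact: (measurableT_comp mf (measurable_rcons0_section x)).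
  - by exists M.
  exists (Num.max N 0) => v Nv; apply: f0; rewrite ltNge; apply/negP => xN.
  have : `|rcons0 x v| <= Num.max N 0 by rewrite le_max xN.
  rewrite rcons0_norm_le; last by rewrite le_max lexx orbT.
  by move=> /andP[_]; rewrite leNgt Nv.
under eq_integral => x _ do rewrite IH// itg_EFin//.
have mf : measurable_fun setT (EFin \o f) by apply/measurable_EFinP; have [[]] := bf.
rewrite itg_EFin//.
pose g (p : R * 'rV[R]_n) := (f (rcons0 p.1 p.2))%:E.
have mg : measurable_fun setT g by exact: (measurableT_comp mf (@measurable_rcons0 R n)).
have ig : (@lebesgue_measure R \x lam R n)%E.-integrable setT g.
  apply/integrable12ltyP => //.
  have /integrableP[_] := bcsupp_integrable bf.
  rewrite /= ge0_integral_rcons_measure//.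
  by apply/measurable_EFinP; apply: measurableT_comp => //; exact/measurable_EFinP.
transitivity (\int[lebesgue_measure]_x \int[lam R n]_y g (x, y))%E; first by [].
rewrite integral12_prod_meas1//.
rewrite [RHS]integral_pushforward ?preimage_setT//.
exact: measurable_rcons0.
Qed.

Lemma bcsupp_cbox n M : bcsupp (\1_(cbox M) : 'rV[R]_n -> R).
Proof.
split; first by apply: bmeas_indic; exact: measurable_cbox.
exists M => x Mx; rewrite indicE memNset//= => xM.
by have := lt_le_trans Mx xM; rewrite ltxx.
Qed.

(** One constant [M] bounds the values and the support in both variables; applications take a
    maximum of all their bounds. That the partial integrals stay in [bcsupp] also provides their
    measurability. *)
Lemma bcsupp_fubini n (F : 'rV[R]_n * 'rV[R]_n -> R) (M : R) :
  measurable_fun setT F -> (forall p, `|F p| <= M) ->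
  (forall x y, M < `|x| \/ M < `|y| -> F (x, y) = 0) ->
  [/\ bcsupp (fun x => itg (fun y => F (x, y))),
      bcsupp (fun y => itg (fun x => F (x, y))) &
      itg (fun x => itg (fun y => F (x, y))) = itg (fun y => itg (fun x => F (x, y)))].
Proof.
move=> mF FM F0.
have b1 x : bcsupp (fun y => F (x, y)).
  split; [split; [exact: (measurableT_comp mF (@pair1_measurable _ _ _ _ x))|by exists M]|].
  by exists M => y My; apply: F0; right.
have b2 y : bcsupp (fun x => F (x, y)).
  split; [split; [exact: (measurableT_comp mF (@pair2_measurable _ _ _ _ y))|by exists M]|].
  by exists M => x Mx; apply: F0; left.
pose B : set 'rV[R]_n := [set x | `|x| <= M].
have mB : measurable B by exact: measurable_cbox.
have FB x y : `|F (x, y)| <= M * \1_B y.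
  rewrite indicE; case: (boolP (_ \in B)); first by rewrite mulr1.
  by rewrite notin_setE /B /= => /negP; rewrite -ltNge => My; rewrite mulr0 F0 ?normr0//; right.
have FB2 x y : `|F (x, y)| <= M * \1_B x.
  rewrite indicE; case: (boolP (_ \in B)); first by rewrite mulr1.
  by rewrite notin_setE /B /= => /negP; rewrite -ltNge => My; rewrite mulr0 F0 ?normr0//; left.
have bB : bcsupp (fun y : 'rV[R]_n => M * \1_B y).
  by apply: bcsuppZ; exact: bcsupp_cbox.
have mEF : measurable_fun setT (EFin \o F) by apply/measurable_EFinP.
have intF : (lam R n \x lam R n)%E.-integrable setT (EFin \o F).
  apply/integrable12ltyP => //=.
  apply: (@le_lt_trans _ _ (\int[lam R n]_x (itg (fun y => M * \1_B y) * \1_B x)%:E)%E); last first.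
    by rewrite -itg_EFin ?ltry//; apply: bcsuppZ; exact: bcsupp_cbox.
  apply: ge0_le_integral => //.
  - by move=> x _; apply: integral_ge0.
  - apply: (measurable_fun_fubini_tonelli_F (abse \o (EFin \o F))) => // [|p].
    exact: measurableT_comp.
    exact: abse_ge0.
  - by apply/measurable_EFinP; apply: measurable_funM => //; exact: measurable_indic.
  move=> x _.
  rewrite (_ : (\int[_]_y _)%E = (itg (fun y => `|F (x, y)|))%:E); last first.
    by rewrite itg_EFin//; exact: bcsupp_norm.
  rewrite lee_fin indicE; case: (boolP (_ \in B)) => [_|].
    by rewrite mulr1; apply: le_itg => //; exact: bcsupp_norm.
  rewrite notin_setE /B /= => /negP; rewrite -ltNge => Mx; rewrite mulr0.
  rewrite (_ : (fun y => _) = fun=> 0) ?itg0//; apply/funext => y.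
  by rewrite F0 ?normr0//; left.
have E1 x : (itg (fun y => F (x, y)))%:E = (\int[lam R n]_y (EFin \o F) (x, y))%E.
  by rewrite itg_EFin.
have E2 y : (itg (fun x => F (x, y)))%:E = (\int[lam R n]_x (EFin \o F) (x, y))%E.
  by rewrite itg_EFin.
have bc1 : bcsupp (fun x => itg (fun y => F (x, y))).
  split; first split.
  - apply/measurable_EFinP; rewrite (_ : EFin \o _ = fubini_F (lam R n) (EFin \o F)).
      exact: measurable_fubini_F intF.
    by apply/funext => x; rewrite /= E1.
  - exists (itg (fun y => M * \1_B y)) => x; apply: (le_trans (le_norm_itg (b1 x))).
    by apply: le_itg => //; exact: bcsupp_norm.
  - exists M => x Mx; rewrite (_ : (fun y => _) = fun=> 0) ?itg0//; apply/funext => y.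
    by rewrite F0//; left.
have bc2 : bcsupp (fun y => itg (fun x => F (x, y))).
  split; first split.
  - apply/measurable_EFinP; rewrite (_ : EFin \o _ = fubini_G (lam R n) (EFin \o F)).
      exact: measurable_fubini_G intF.
    by apply/funext => x; rewrite /= E2.
  - exists (itg (fun y => M * \1_B y)) => x; apply: (le_trans (le_norm_itg (b2 x))).
    by apply: le_itg => //; exact: bcsupp_norm.
  - exists M => y My; rewrite (_ : (fun y => _) = fun=> 0) ?itg0//; apply/funext => x.
    by rewrite F0//; right.
split; [exact: bc1|exact: bc2|apply: EFin_inj].
rewrite (itg_EFin bc1) (itg_EFin bc2).
under eq_integral do rewrite E1; under [RHS]eq_integral do rewrite E2.
exact: (Fubini intF).
Qed.

Lemma itg_gt0 n (f : 'rV[R]_n -> R) x0 : bcsupp f -> (forall x, 0 <= f x) ->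
  {for x0, continuous f} -> 0 < f x0 -> 0 < itg f.
Proof.
move=> bf f0 cf fx0.
have /nbhs_ballP[r /= r0 Hr] := @cvgr_gt _ _ _ _ f (f x0) cf (f x0 / 2) ltac:(lra).
pose B : set 'rV[R]_n := [set x | `|x| <= r / 2].
have mB : measurable B by exact: measurable_cbox.
have bB : bcsupp (fun x : 'rV[R]_n => f x0 / 2 * \1_B x).
  by apply: bcsuppZ; exact: bcsupp_cbox.
apply: (@lt_le_trans _ _ (itg (fun x => f x0 / 2 * \1_B x))).
  rewrite itgZ; last first.
    have := bcsuppZ (2 / f x0) bB; congr bcsupp; apply/funext => x; field; lra.
  rewrite mulr_gt0 ?divr_gt0// /itg /Rintegral integral_indic// setIT.
  apply: fine_gt0; rewrite lam_cbox_lty andbT lam_cbox_gt0//; lra.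
(* The cube was measured at the origin; translation moves it to [x0], where [f] exceeds
   [f x0 / 2]. *)
rewrite -(@itg_translate n (fun x => f x0 / 2 * \1_B x) (- x0))//.
apply: le_itg => //; first exact: (bcsupp_translate (- x0) bB).
move=> x; rewrite indicE; case: (boolP (_ \in B)); last by rewrite mulr0.
rewrite inE /B /= mulr1 => xx0; apply: ltW; apply: Hr.
by rewrite -ball_normE /= distrC; lra.
Qed.

Lemma itg_dominated n (f_ : nat -> 'rV[R]_n -> R) (f g : 'rV[R]_n -> R) :
  (forall k, measurable_fun setT (f_ k)) -> measurable_fun setT f -> bcsupp g ->
  (forall x, f_ ^~ x @ \oo --> f x) -> (forall k x, `|f_ k x| <= g x) ->
  itg (f_ k) @[k --> \oo] --> itg f.
Proof.
move=> mf_ mf bg f_f f_g.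
have g0 x : 0 <= g x by apply: le_trans (f_g 0%N x).
have bf_ k : bcsupp (f_ k).
  have [[mg [M gM]] [N g0N]] := bg; split; first split => //.
    by exists M => x; rewrite (le_trans (f_g k x))// (le_trans _ (gM x))// ler_norm.
  by exists N => x /g0N gx; apply/eqP; rewrite -normr_le0 -gx.
have bf : bcsupp f.
  have fg x : `|f x| <= g x.
    exact: (cvg_le_cst (cvg_norm (f_f x)) (fun k => f_g k x)).
  have [[mg [M gM]] [N g0N]] := bg; split; first split => //.
    by exists M => x; rewrite (le_trans (fg x))// (le_trans _ (gM x))// ler_norm.
  by exists N => x /g0N gx; apply/eqP; rewrite -normr_le0 -gx.
have [_ _] := @dominated_convergence _ _ R (lam R n) setT measurableT
  (fun k => EFin \o f_ k) (EFin \o f) (EFin \o g)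
  (fun k => (measurable_EFinP _ _).2 (mf_ k)) ((measurable_EFinP _ _).2 mf)
  (aeW _ (fun x _ => (@cvg_EFin _ _ _ _ (fun k => (f_ k x)%:E) _ (nearW _ (fun _ => erefl)) (f_f x)))) (bcsupp_integrable bg)
  (aeW _ (fun x k _ => f_g k x)).
rewrite -itg_EFin// => H.
have : (fine \o (fun k => (itg (f_ k))%:E)) @ \oo --> itg f; last by [].
apply: fine_cvg; apply: cvg_trans H; apply: near_eq_cvg; near=> k.
by rewrite /= itg_EFin.
Unshelve. all: by end_near.
Qed.

End BoundedCompactSupport.
(** * Functions of class C^1 and mollification *)

Lemma continuous_rVP (R : realType) n (f : 'rV[R]_n -> R) (x : 'rV[R]_n) :
  {for x, continuous f} <-> forall e, 0 < e ->
    exists2 d : R, 0 < d & forall y, `|y - x| < d -> `|f y - f x| <= e.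
Proof.
split=> [cf e e0|H].
  have /nbhs_ballP[d /= d0 Hd] := (@cvgrPdist_le _ _ _ _ (nbhs_filter x) f (f x)).1 cf e e0.
  by exists d => // y yx; rewrite distrC; apply: Hd; rewrite -ball_normE /= distrC.
apply/(@cvgrPdist_le _ _ _ _ (nbhs_filter x)) => e /H[d d0 Hd].
apply/nbhs_ballP; exists d => //= y; rewrite -ball_normE /= => yx.
by rewrite distrC; apply: Hd; rewrite distrC.
Qed.

(** A remainder bounded by a multiple of h^2 survives integration against a bounded function, so
    convolutions can be differentiated without a limit theorem. *)
Lemma quadratic_is_derive (R : realType) (V : normedModType R) (g : V -> R) (x v : V) (d C : R) :
  (forall h, `|h| <= 1 -> `|g (x + h *: v) - g x - h * d| <= C * h ^+ 2) ->
  is_derive x v g d.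
Proof.
move=> H; have H' : h^-1 *: (g (h *: v + x) - g x) @[h --> 0^'] --> d.
  apply/cvgrPdist_le => e e0.
  near=> h.
  have h0 : h != 0 by near: h; exact: nbhs_dnbhs_neq.
  have h1 : `|h| <= 1 by near: h; apply: dnbhs0_le; exact: ltr01.
  have := H h h1; rewrite (addrC x).
  have -> : d - h^-1 *: (g (h *: v + x) - g x) = - h^-1 * (g (h *: v + x) - g x - h * d).
    by rewrite /GRing.scale /=; field.
  rewrite normrM normrN normfV ler_pdivrMl ?normr_gt0// => Hh; apply: (le_trans Hh).
  rewrite -[h ^+ 2]real_normK ?num_real// expr2 mulrA [leRHS]mulrC ler_wpM2r//.
  have hC : `|h| <= e / (`|C| + 1) by near: h; apply: dnbhs0_le; rewrite divr_gt0// ltr_wpDl.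
  apply: (@le_trans _ _ ((`|C| + 1) * `|h|)).
    by rewrite ler_wpM2r//; have := ler_norm C; lra.
  by rewrite mulrC -ler_pdivlMr// ltr_wpDl.
have dg : derivable g x v by apply/cvg_ex; exists d.
by apply: DeriveDef => //; apply: cvg_lim.
Unshelve. all: by end_near. Qed.

Section PartialDerivatives.
Variables (R : realType) (n : nat).
Implicit Types (f g : 'rV[R]_n -> R) (x v : 'rV[R]_n).

Definition C1 g : Prop :=
  (forall i x, derivable g x (ev R i)) /\
  (forall i, continuous (fun x => 'D_(ev R i) g x)).

Lemma is_derive_line g x v (t : R) d : is_derive (x + t *: v) v g d ->
  is_derive t 1 (fun s : R => g (x + s *: v)) d.
Proof.
move=> [dg <-]; have E : (fun h : R => h^-1 *: (g (h *: v + (x + t *: v)) - g (x + t *: v))) =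
  (fun h : R => h^-1 *: (g (x + (h *: (1 : R) + t) *: v) - g (x + t *: v))).
  apply/funext => h; congr (_ *: (g _ - _)).
  by rewrite (_ : h *: (1 : R) = h) ?scalerDl 1?addrCA// /GRing.scale /= mulr1.
have D : derivable (fun s : R => g (x + s *: v)) t 1 by rewrite /derivable -E.
by apply: DeriveDef => //; rewrite /derive -E.
Qed.

Lemma mean_value_line g x v (r B : R) : 0 <= r ->
  (forall t, 0 <= t <= r -> derivable g (x + t *: v) v) ->
  (forall t, 0 <= t <= r -> `|'D_v g (x + t *: v)| <= B) ->
  `|g (x + r *: v) - g x| <= B * r.
Proof.
move=> r0 dg dB.
have df t : 0 <= t <= r -> is_derive t 1 (fun s : R => g (x + s *: v)) ('D_v g (x + t *: v)).
  by move=> tr; apply: is_derive_line; exact/derivableP/dg.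
have [||c] := @MVT_segment R (fun s => g (x + s *: v)) (fun t => 'D_v g (x + t *: v)) 0 r r0.
- by move=> t; rewrite in_itv/= => /andP[? ?]; apply: df; rewrite !ltW.
- apply: derivable_within_continuous => t; rewrite in_itv/= => tr.
  by have [] := df t tr.
rewrite in_itv/= scale0r addr0 subr0 => cr ->.
by rewrite normrM (ger0_norm r0) ler_wpM2r// dB.
Qed.

Lemma mean_value_line_abs g x v (r B : R) :
  (forall t, `|t| <= `|r| -> derivable g (x + t *: v) v) ->
  (forall t, `|t| <= `|r| -> `|'D_v g (x + t *: v)| <= B) ->
  `|g (x + r *: v) - g x| <= B * `|r|.
Proof.
move=> dg dB; have [r0|r0] := leP 0 r.
  rewrite (ger0_norm r0) in dg dB *; apply: mean_value_line => // t /andP[t0 tr].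
    by apply: dg; rewrite ger0_norm.
  by apply: dB; rewrite ger0_norm.
rewrite distrC -[g x in leLHS](_ : g ((x + r *: v) + (- r) *: v) = _); last first.
  by rewrite scaleNr addrK.
rewrite ltr0_norm// in dg dB *; apply: mean_value_line; first lra.
  move=> t tr; rewrite -addrA -scalerDl; apply: dg.
  by rewrite ler_norml; apply/andP; split; lra.
move=> t tr; rewrite -addrA -scalerDl; apply: dB.
by rewrite ler_norml; apply/andP; split; lra.
Qed.

Lemma ev_coord i j : (ev R i : 'rV[R]_n) 0 j = (i == j)%:R.
Proof. by rewrite /ev mxE eqxx andTb eq_sym. Qed.

(* Move one coordinate at a time: the k-th partial update of x in direction v. *)
Let upd x v (k : nat) : 'rV[R]_n := \row_j (x 0 j + (if (j < k)%N then v 0 j else 0)).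

Let updS x v (k : 'I_n) : upd x v k.+1 = upd x v k + (v 0 k) *: ev R k.
Proof.
apply/rowP => j; rewrite !mxE eqxx andTb ltnS leq_eqVlt eq_sym.
have [->|jk] := eqVneq j k; first by rewrite eqxx ltnn/= mulr1 addr0.
by rewrite [val k == val j](_ : _ = false)/= ?mulr0 ?addr0//; apply/negbTE; rewrite eq_sym.
Qed.

Let upd_near x v (k : 'I_n) (t : R) : `|t| <= `|v 0 k| ->
  `|upd x v k + t *: ev R k - x| <= `|v|.
Proof.
move=> tv; apply/mxnorm_leP => // j; rewrite !mxE eqxx andTb.
have [->|jk] := eqVneq j k.
  rewrite ltnn addr0 mulr1 addrAC subrr add0r (le_trans tv)//; exact: coord_le_mxnorm.
rewrite mulr0 addr0 addrAC subrr add0r; case: ifP => _; first exact: coord_le_mxnorm.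
by rewrite normr0.
Qed.

(** [C1] asks only for continuous partial derivatives. They are bounded near [x], the mean value
    theorem bounds each coordinate step of [upd], and the steps telescope. *)
Lemma C1_continuous g : C1 g -> continuous g.
Proof.
move=> [dg cg] x; apply/continuous_rVP => e e0.
have /choice[d_ Hd_] : forall i, exists d : R, 0 < d /\
    forall y, `|y - x| < d -> `|'D_(ev R i) g y| <= `|'D_(ev R i) g x| + 1.
  move=> i; have /continuous_rVP/(_ 1 ltr01)[d d0 Hd] := cg i x.
  exists d; split => // y /Hd; have := ler_distD ('D_(ev R i) g x) ('D_(ev R i) g y) 0.
  by rewrite !subr0; lra.
pose B := \sum_(i < n) (`|'D_(ev R i) g x| + 1).
have B0 : 0 <= B by apply: sumr_ge0 => i _; rewrite addr_ge0.
pose d := \big[Num.min/(e / (B + 1))]_(i < n) d_ i.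
have d0 : 0 < d.
  by apply/bigmin_gtP; split=> [|i _]; [rewrite divr_gt0//; lra|have [] := Hd_ i].
exists d => // y /bigmin_gtP[ye yd].
pose v := y - x.
have step (k : 'I_n) : `|g (upd x v k.+1) - g (upd x v k)| <= (`|'D_(ev R k) g x| + 1) * `|v 0 k|.
  rewrite updS; apply: mean_value_line_abs => t tv; first exact: dg.
  have [_] := Hd_ k; apply; rewrite (le_lt_trans _ (yd k isT))//; exact: upd_near.
have -> : g y = g (upd x v n).
  by congr g; apply/rowP => j; rewrite !mxE ltn_ord; ring.
have -> : g x = g (upd x v 0).
  by congr g; apply/rowP => j; rewrite !mxE ltn0 addr0.
rewrite -(telescope_sumr (fun k => g (upd x v k)))// big_mkord.
apply: (le_trans (ler_norm_sum _ _ _)).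
apply: (@le_trans _ _ (\sum_(k < n) (`|'D_(ev R k) g x| + 1) * `|v|)).
  apply: ler_sum => k _; apply: (le_trans (step k)).
  by rewrite ler_wpM2l ?coord_le_mxnorm// addr_ge0.
rewrite -mulr_suml -/B.
apply: (@le_trans _ _ ((B + 1) * `|v|)); first by rewrite ler_wpM2r//; lra.
by rewrite mulrC -ler_pdivlMr; [exact: ltW|lra].
Qed.

Lemma C1_cst (c : R) : C1 (fun _ => c).
Proof.
split=> [i x|i]; first exact: derivable_cst.
by under eq_fun do rewrite derive_cst; exact: cst_continuous.
Qed.

Lemma C1D f g : C1 f -> C1 g -> C1 (fun x => f x + g x).
Proof.
move=> [df cf] [dg cg]; split=> [i x|i]; first exact: derivableD.
under eq_fun do rewrite deriveD//.
by move=> x; exact: (@cvgD _ _ _ _ _ _ _ _ _ (cf i x) (cg i x)).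
Qed.

Lemma C1N f : C1 f -> C1 (fun x => - f x).
Proof.
move=> [df cf]; split=> [i x|i]; first exact: derivableN.
under eq_fun do rewrite deriveN//.
by move=> x; exact: (@cvgN _ _ _ _ _ _ _ (cf i x)).
Qed.

Lemma C1B f g : C1 f -> C1 g -> C1 (fun x => f x - g x).
Proof. by move=> cf cg; exact: (C1D cf (C1N cg)). Qed.

Lemma C1M f g : C1 f -> C1 g -> C1 (fun x => f x * g x).
Proof.
move=> Cf Cg; have cf0 := C1_continuous Cf; have cg0 := C1_continuous Cg.
move: Cf Cg => [df cf] [dg cg]; split=> [i x|i]; first exact: derivableM.
under eq_fun do rewrite deriveM//.
move=> x; apply: (@cvgD _ _ _ _ (nbhs_filter x)).
  exact: (@cvgM _ _ _ (nbhs_filter x) _ _ _ _ (cf0 x) (cg i x)).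
exact: (@cvgM _ _ _ (nbhs_filter x) _ _ _ _ (cg0 x) (cf i x)).
Qed.

(** Only a directional derivative of [g] is given, so the chain rule is taken on the line through
    [x] in direction [v], where both functions have one real variable. *)
Lemma is_derive_comp1 g (b : R -> R) x v d :
  derivable g x v -> is_derive (g x) 1 b d ->
  is_derive x v (fun y => b (g y)) (d * 'D_v g x).
Proof.
move=> dg db.
pose G (s : R) := g (x + s *: v).
have E0 : x + (0 : R) *: v = x by rewrite scale0r addr0.
have dG : is_derive (0 : R) 1 G ('D_v g x).
  by apply: is_derive_line; rewrite E0; exact/derivableP.
have G0 : G 0 = g x by rewrite /G E0.
have db' : is_derive (G 0) 1 b d by rewrite G0.
have [D Ec] := is_derive1_comp db' dG.
have E : (fun h : R => h^-1 *: (b (g (h *: v + x)) - b (g x))) =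
  (fun h : R => h^-1 *: ((b \o G) (h *: (1 : R) + 0) - (b \o G) 0)).
  apply/funext => h; rewrite /= G0 /G; congr (_ *: (b (g _) - _)).
  by rewrite addr0 (_ : h *: (1 : R) = h) 1?addrC// /GRing.scale /= mulr1.
have D' : derivable (fun y => b (g y)) x v by rewrite /derivable E.
by apply: DeriveDef => //; rewrite -Ec /derive E.
Qed.

Lemma C1_comp g (b b' : R -> R) : C1 g -> (forall s : R, is_derive s 1 b (b' s)) ->
  continuous b' -> C1 (fun x => b (g x)).
Proof.
move=> Cg db cb'; have cg0 := C1_continuous Cg; move: Cg => [dg cg].
have H i x := is_derive_comp1 (dg i x) (db (g x)).
split=> [i x|i]; first by have [] := H i x.
have -> : (fun x => 'D_(ev R i) (fun x => b (g x)) x) = (fun x => b' (g x) * 'D_(ev R i) g x).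
  by apply/funext => x; have [_ ->] := H i x.
move=> x; apply: (@cvgM _ _ _ (nbhs_filter x) _ _ _ _ _ (cg i x)).
exact: (cvg_comp _ _ (cg0 x) (cb' (g x))).
Qed.

End PartialDerivatives.
Section CompactSupport.
Variables (R : realType) (n : nat).
Implicit Types (f g : 'rV[R]_n -> R) (x v : 'rV[R]_n).

Definition bsupp g : Prop := exists M : R, forall x, M < `|x| -> g x = 0.

Definition C1c g : Prop := C1 g /\ bsupp g.

Lemma compact_cbox (r : R) : compact [set x : 'rV[R]_n | `|x| <= r].
Proof.
apply: bounded_closed_compact.
  by exists r; split; [exact: num_real|move=> s rs x /= xr; rewrite (le_trans xr)// ltW].
have /continuous_closedP/(_ [set z : R | z <= r]) : continuous (fun x : 'rV[R]_n => `|x|).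
  exact: norm_continuous.
by apply; exact: closed_le.
Qed.

Lemma continuous_bcsupp g : continuous g -> bsupp g -> bcsupp g.
Proof.
move=> cg [M gM]; split; last by exists M.
split; first exact: continuous_measurable_rV.
have /compact_bounded[N [_ HN]] : compact (g @` [set x : 'rV[R]_n | `|x| <= M]).
  by apply: continuous_compact; [exact: continuous_subspaceT|exact: compact_cbox].
exists (Num.max 0 (N + 1)) => x; have [xM|xM] := leP `|x| M; last first.
  by rewrite gM// normr0 le_max lexx.
rewrite le_max; apply/orP; right; apply: (HN (N + 1)); first lra.
by exists x.
Qed.

Lemma C1c_bcsupp g : C1c g -> bcsupp g.
Proof. by move=> [cg sg]; apply: continuous_bcsupp => //; exact: C1_continuous. Qed.

Lemma derive_bsupp g v (M : R) : (forall x, M < `|x| -> g x = 0) ->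
  forall x, M < `|x| -> 'D_v g x = 0.
Proof.
move=> gM x xM; rewrite (@near_eq_derive _ _ _ g (cst 0)) ?derive_cst//.
apply/nbhs_ballP; exists (`|x| - M) => /=; first lra.
move=> y; rewrite -ball_normE /= => xy; apply: gM.
have := lerB_dist x y; lra.
Qed.

Lemma C1c_partial_bcsupp g i : C1c g -> bcsupp (fun x => 'D_(ev R i) g x).
Proof.
move=> [[dg cg] [M gM]]; apply: continuous_bcsupp; first exact: cg.
by exists M; exact: derive_bsupp.
Qed.

Lemma bsuppMl f g : bsupp f -> bsupp (fun x => g x * f x).
Proof. by move=> [M fM]; exists M => x /fM ->; rewrite mulr0. Qed.

Lemma bsuppMr f g : bsupp f -> bsupp (fun x => f x * g x).
Proof. by move=> [M fM]; exists M => x /fM ->; rewrite mul0r. Qed.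

Lemma C1cMl f g : C1c f -> C1 g -> C1c (fun x => g x * f x).
Proof. by move=> [cf sf] cg; split; [exact: C1M|exact: bsuppMl]. Qed.

(** Difference quotients have integral 0 by translation invariance, and they converge dominatedly to
    the partial derivative. *)
Lemma itg_partial g i : C1c g -> itg (fun x => 'D_(ev R i) g x) = 0.
Proof.
move=> Cg; have bg := C1c_bcsupp Cg; have bdg := C1c_partial_bcsupp i Cg.
have [[dg cg] [M gM]] := Cg.
have [[mdg [B dB]] _] := bdg.
pose h k : R := k.+1%:R^-1.
have h0 k : 0 < h k by rewrite invr_gt0.
have h1 k : h k <= 1 by rewrite invf_le1// ler1n.
have ne : `|ev R i : 'rV[R]_n| <= 1.
  by apply/mxnorm_leP => // j; rewrite ev_coord; case: (_ == _); rewrite ?normr1 ?normr0.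
pose f k x := (h k)^-1 * (g (x + h k *: ev R i) - g x).
have bf k : bcsupp (f k).
  by apply: bcsuppZ; apply: bcsuppB => //; exact: bcsupp_translate.
have f0 k : itg (f k) = 0.
  rewrite itgZ; last by apply: bcsuppB => //; exact: bcsupp_translate.
  by rewrite itgB ?itg_translate ?subrr ?mulr0//; exact: bcsupp_translate.
have B0 : 0 <= B by apply: le_trans (dB 0).
(* The steps [h k] are at most 1, so all quotients vanish outside the cube of size [M + 1]; inside,
   the mean value theorem bounds them by [B]. *)
pose D : 'rV[R]_n -> R := fun x => B * \1_[set x : 'rV[R]_n | `|x| <= M + 1] x.
have bD : bcsupp D.
  by apply: bcsuppZ; exact: bcsupp_cbox.
have fD k x : `|f k x| <= D x.
  have [xM|xM] := leP `|x| (M + 1).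
    rewrite /D indicE mem_set// mulr1 normrM gtr0_norm ?invr_gt0//.
    rewrite ler_pdivrMl// mulrC -[leRHS](_ : B * `|h k| = _); last by rewrite gtr0_norm.
    by apply: mean_value_line_abs => t _; [exact: dg|exact: dB].
  rewrite /D indicE memNset/=; last by apply/negP; rewrite -ltNge.
  rewrite mulr0 /f !gM ?subrr ?mulr0 ?normr0//; first lra.
  have : `|h k *: ev R i : 'rV[R]_n| <= 1.
    by rewrite normrZ gtr0_norm//; apply: (le_trans (ler_pM _ _ (h1 k) ne)); rewrite ?mulr1// ltW.
  have := lerB_normD x (h k *: ev R i); lra.
have ff x : f k x @[k --> \oo] --> 'D_(ev R i) g x.
  have /cvg_ex[l Hl] := dg i x.
  have -> : 'D_(ev R i) g x = l by exact: cvg_lim Hl.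
  have hc : h k @[k --> \oo] --> (0 : R)^'.
    move=> A HA; have H := @cvg_harmonic R _ HA.
    have H' : \forall k \near \oo, h k != 0 -> A (h k) by exact: H.
    by apply: filterS H' => k; apply; rewrite gt_eqF.
  have := cvg_comp _ _ hc Hl.
  have -> : (fun k => f k x) = (fun s : R => s^-1 *: ((g \o shift x) (s *: ev R i) - g x)) \o h.
    by apply/funext => k; rewrite /f /= (addrC x).
  exact.
have := itg_dominated (fun k => (bcsupp_bmeas (bf k)).1) mdg bD ff fD.
under eq_fun do rewrite f0.
by move=> H; rewrite -(cvg_lim _ H)// lim_cst.
Qed.

Lemma mxnorm_far (M : R) (z y x : 'rV[R]_n) :
  M + `|x| + 1 < `|z| -> `|y - x| <= 1 -> M < `|z - y|.
Proof. by have := lerB_dist z y; have := lerB_dist y x; lra. Qed.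

(* Dominated convergence along a hypothetical sequence of bad points. *)
Lemma convolution_continuous k w : continuous k -> bsupp k -> bmeas w ->
  continuous (fun x => itg (fun y => k (y - x) * w y)).
Proof.
move=> ck sk bw x; apply/continuous_rVP => e e0; apply: contrapT => Hn.
have bk := continuous_bcsupp ck sk.
have /choice[y_ Hy] : forall j : nat, exists y : 'rV[R]_n, `|y - x| < j.+1%:R^-1 /\
    e < `|itg (fun z => k (z - y) * w z) - itg (fun z => k (z - x) * w z)|.
  move=> j; apply: contrapT => Hj; apply: Hn; exists j.+1%:R^-1; first by rewrite invr_gt0.
  by move=> y yx; rewrite leNgt; apply/negP => ye; apply: Hj; exists y.
have bkt y : bcsupp (fun z => k (z - y) * w z).
  by apply: bcsuppMr => //; exact: (bcsupp_translate (- y) bk).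
have [[mk [B kB]] [M kM]] := bk; have [mw [W wW]] := bw.
have B0 : 0 <= B by apply: le_trans (kB 0).
have W0 : 0 <= W by apply: le_trans (wW 0).
pose M' := M + `|x| + 1.
pose D : 'rV[R]_n -> R := fun z => (B * W) * \1_[set z : 'rV[R]_n | `|z| <= M'] z.
have bD : bcsupp D.
  by apply: bcsuppZ; exact: bcsupp_cbox.
have kD j (z : 'rV[R]_n) : `|k (z - y_ j) * w z| <= D z.
  have [zM|zM] := leP `|z| M'.
    by rewrite /D indicE mem_set// mulr1 normrM ler_pM.
  rewrite /D indicE memNset/=; last by apply/negP; rewrite -ltNge.
  rewrite mulr0 kM ?mul0r ?normr0//.
  have [yj _] := Hy j.
  have j1 : (j.+1%:R^-1 : R) <= 1 by rewrite invf_le1// ler1n.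
  exact: (mxnorm_far zM (le_trans (ltW yj) j1)).
have ylim : y_ j @[j --> \oo] --> x.
  apply/cvgrPdist_lt => d d0; near=> j; have [yj _] := Hy j; rewrite distrC.
  apply: (lt_trans yj); near: j.
  have := @cvgr_lt _ _ _ _ _ _ (@cvg_harmonic R) d d0; exact.
have kf z : k (z - y_ j) * w z @[j --> \oo] --> k (z - x) * w z.
  apply: cvgM; last exact: cvg_cst.
  have H : (fun j => z - y_ j) @ \oo --> z - x by apply: cvgB => //; exact: cvg_cst.
  exact: (cvg_comp _ _ H (ck (z - x))).
have := itg_dominated (fun j => (bcsupp_bmeas (bkt (y_ j))).1) (bcsupp_bmeas (bkt x)).1 bD kf kD.
move=> /cvgrPdist_le/(_ _ e0)[N _ HN].
have := HN N (leqnn N); have [_] := Hy N; rewrite /= distrC; lra.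
Unshelve. all: by end_near. Qed.

End CompactSupport.

(** * A radial mollifier *)

Section Kernel.
Variables (R : realType) (n : nat).
Implicit Types (u x z v : 'rV[R]_n) (w : 'rV[R]_n -> R).

Definition pos (s : R) : R := Num.max s 0.

Lemma pos_ge0 s : 0 <= pos s. Proof. by rewrite /pos le_max lexx orbT. Qed.

(** Source of the derivatives of [rho] and of [smoothpos], both built from the square of [pos]; the
    bound is uniform in [s]. *)
Lemma pos_taylor (s d : R) : `|pos (s + d) ^+ 2 - pos s ^+ 2 - 2 * pos s * d| <= d ^+ 2.
Proof.
rewrite /pos; case: (leP s 0) => s0; case: (leP (s + d) 0) => sd0.
- by rewrite expr0n/= mulr0 mul0r !subr0 normr0 sqr_ge0.
- by rewrite expr0n/= mulr0 mul0r !subr0 ger0_norm ?sqr_ge0//; nra.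
- by rewrite expr0n/= sub0r ler_norml; apply/andP; split; nra.
- by rewrite (_ : _ - _ = d ^+ 2) ?ger0_norm ?sqr_ge0//; ring.
Qed.

(* Squaring the positive part makes this radial kernel C^1, with an explicit
   derivative [drho]; no smoother mollifier is needed. *)
Definition rho (e : R) z : R := pos (e ^+ 2 - \sum_(i < n) z 0 i ^+ 2) ^+ 2.

Definition drho (e : R) u z : R :=
  - (4 * pos (e ^+ 2 - \sum_(i < n) z 0 i ^+ 2) * \sum_(i < n) u 0 i * z 0 i).

Lemma rho_ge0 e z : 0 <= rho e z. Proof. exact: sqr_ge0. Qed.

Let pos0 e z : 0 < e -> e <= enorm z -> pos (e ^+ 2 - \sum_(i < n) z 0 i ^+ 2) = 0.
Proof.
move=> e0 ez; rewrite /pos max_r// subr_le0 -enorm_sqr.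
by rewrite ler_pXn2r ?nnegrE ?enorm_ge0// ltW.
Qed.

Lemma rho_out e z : 0 < e -> e <= enorm z -> rho e z = 0.
Proof. by move=> e0 ez; rewrite /rho pos0// expr0n. Qed.

Lemma drho_out e u z : 0 < e -> e <= enorm z -> drho e u z = 0.
Proof. by move=> e0 ez; rewrite /drho pos0// mulr0 mul0r oppr0. Qed.

Lemma drho_odd e u z : drho e u (- z) = - drho e u z.
Proof.
rewrite /drho.
have -> : \sum_(i < n) (- z) 0 i ^+ 2 = \sum_(i < n) z 0 i ^+ 2.
  by apply: eq_bigr => i _; rewrite mxE sqrrN.
have -> : \sum_(i < n) u 0 i * (- z) 0 i = - \sum_(i < n) u 0 i * z 0 i.
  by rewrite -sumrN; apply: eq_bigr => i _; rewrite mxE mulrN.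
by ring.
Qed.

Lemma drho_coord e u z : drho e u z = \sum_(i < n) u 0 i * drho e (ev R i) z.
Proof.
rewrite /drho -mulNr mulr_sumr; apply: eq_bigr => i _.
have -> : \sum_(j < n) ev R i 0 j * z 0 j = z 0 i.
  rewrite (bigD1 i)//= ev_coord eqxx mul1r big1 ?addr0// => j ji.
  by rewrite ev_coord eq_sym (negbTE ji) mul0r.
by ring.
Qed.

Lemma continuous_pos_sqr e :
  continuous (fun z : 'rV[R]_n => pos (e ^+ 2 - \sum_(i < n) z 0 i ^+ 2)).
Proof.
move=> z; apply: (@continuous_comp _ _ _ (fun z : 'rV[R]_n => e ^+ 2 - \sum_(i < n) z 0 i ^+ 2) pos).
  apply: (@cvgB _ _ _ _ (nbhs_filter z)); first exact: cvg_cst.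
  move: z; apply: continuous_sum => i z.
  apply: (@continuous_comp _ _ _ (fun y : 'rV[R]_n => y 0 i) (fun s : R => s ^+ 2)).
    exact: coord_continuous.
  exact: exprn_continuous.
by apply: continuous_max; [move=> ?; exact: cvg_id|exact: cst_continuous].
Qed.

Lemma continuous_rho e : continuous (rho e).
Proof.
move=> z; apply: (@continuous_comp _ _ _ (fun z : 'rV[R]_n => pos (e ^+ 2 - \sum_(i < n) z 0 i ^+ 2)) (fun s : R => s ^+ 2)).
  exact: continuous_pos_sqr.
exact: exprn_continuous.
Qed.

Lemma continuous_drho e u : continuous (drho e u).
Proof.
move=> z; apply: (@cvgN _ _ _ _ (nbhs_filter z)).
apply: (@cvgM _ _ _ (nbhs_filter z)).
  apply: (@cvgM _ _ _ (nbhs_filter z)); first exact: cvg_cst.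
  exact: continuous_pos_sqr.
move: z; apply: continuous_sum => i z.
apply: (@cvgM _ _ _ (nbhs_filter z)); first exact: cvg_cst.
exact: coord_continuous.
Qed.

Lemma bsupp_rho e : 0 < e -> bsupp (rho e).
Proof.
move=> e0; exists e => z zM; rewrite rho_out//.
by rewrite (le_trans _ (mxnorm_le_enorm z))// ltW.
Qed.

Lemma bsupp_drho e u : 0 < e -> bsupp (drho e u).
Proof.
move=> e0; exists e => z zM; rewrite drho_out//.
by rewrite (le_trans _ (mxnorm_le_enorm z))// ltW.
Qed.

(** The remainder has to be uniform and of bounded support in [z], because [moll_is_derive]
    integrates it. *)
Lemma rho_taylor e u : 0 < e -> exists C M : R, 0 <= C /\ forall z h, `|h| <= 1 ->
  `|rho e (z + h *: u) - rho e z - h * drho e u z| <=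
  C * h ^+ 2 * \1_[set z : 'rV[R]_n | `|z| <= M] z.
Proof.
move=> e0; pose U := enorm u; have U0 : 0 <= U := enorm_ge0 u.
pose B := 2 * (e + U) * U + U ^+ 2.
have B0 : 0 <= B by rewrite addr_ge0 ?sqr_ge0// mulr_ge0// mulr_ge0// addr_ge0// ltW.
have C0 : 0 <= B ^+ 2 + 2 * e ^+ 2 * U ^+ 2.
  by rewrite addr_ge0 ?sqr_ge0// -mulrA -exprMn mulr_ge0 ?sqr_ge0.
exists (B ^+ 2 + 2 * e ^+ 2 * U ^+ 2), (e + U); split => //.
move=> z h h1.
have huU : enorm (h *: u) <= U by rewrite enormZ ler_piMl.
have [zM|zM] := leP (enorm z) (e + U); last first.
  have zhu : e <= enorm (z + h *: u).
    have := enormD (z + h *: u) (- (h *: u)); rewrite addrK enormN; lra.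
  rewrite !rho_out// ?drho_out ?mulr0 ?subrr ?normr0//; try lra.
  by rewrite mulr_ge0// mulr_ge0 ?sqr_ge0.
rewrite indicE mem_set/=; last by rewrite (le_trans (mxnorm_le_enorm z)).
rewrite mulr1 /rho /drho.
set s := e ^+ 2 - \sum_(i < n) z 0 i ^+ 2; set p := \sum_(i < n) u 0 i * z 0 i.
(* [d] is the increment of e^2 - |z|^2 from [z] to [z + h *: u]; its quadratic part is absent from
   [drho] and causes the second summand of the constant. *)
pose d := - (2 * h * p) - h ^+ 2 * U ^+ 2.
have -> : e ^+ 2 - \sum_(i < n) (z + h *: u) 0 i ^+ 2 = s + d.
  have -> : \sum_(i < n) (z + h *: u) 0 i ^+ 2 = \sum_(i < n) z 0 i ^+ 2
      + 2 * h * p + h ^+ 2 * \sum_(i < n) u 0 i ^+ 2.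
    rewrite !mulr_sumr -!big_split/=; apply: eq_bigr => i _; rewrite !mxE; ring.
  by rewrite /s /d /U enorm_sqr; ring.
have pB : `|p| <= (e + U) * U.
  rewrite ler_norml; apply/andP; split.
    have := cauchy_schwarz (- u) z; rewrite enormN.
    have -> : \sum_(i < n) (- u) 0 i * z 0 i = - p.
      by rewrite -sumrN; apply: eq_bigr => i _; rewrite mxE mulNr.
    have : enorm u * enorm z <= U * (e + U) by rewrite ler_wpM2l.
    by rewrite mulrC => ? ?; lra.
  apply: (le_trans (cauchy_schwarz u z)); rewrite mulrC ler_wpM2r//.
have h2 : h ^+ 2 <= `|h|.
  by rewrite -[h ^+ 2]real_normK ?num_real// expr2 ler_piMl.
have dB : `|d| <= `|h| * B.
  rewrite /d (le_trans (ler_normB _ _))// normrN !normrM.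
  rewrite (ger0_norm U0) (@ger0_norm _ 2)//.
  have H1 : 2 * `|h| * `|p| <= 2 * `|h| * ((e + U) * U) by rewrite ler_wpM2l// mulr_ge0.
  have H2 : `|h| * `|h| * (U * U) <= `|h| * (U * U) by rewrite ler_wpM2r ?mulr_ge0// ler_piMl.
  by apply: (le_trans (lerD H1 H2)); rewrite /B le_eqVlt; apply/orP; left; apply/eqP; ring.
have sP : pos s <= e ^+ 2.
  rewrite /pos ge_max sqr_ge0 andbT /s lerBlDr lerDl enorm_sum_ge0//.
have P0 := pos_ge0 s.
have -> : pos (s + d) ^+ 2 - pos s ^+ 2 - h * - (4 * pos s * p) =
    (pos (s + d) ^+ 2 - pos s ^+ 2 - 2 * pos s * d) - 2 * pos s * U ^+ 2 * h ^+ 2.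
  by rewrite /d; ring.
apply: (le_trans (ler_normB _ _)); rewrite [leRHS]mulrDl; apply: lerD.
  apply: (le_trans (pos_taylor s d)).
  rewrite -[d ^+ 2]real_normK ?num_real// -[h ^+ 2]real_normK ?num_real//.
  by rewrite -exprMn ler_pXn2r ?nnegrE ?mulr_ge0// mulrC.
have hh := sqr_ge0 h; have UU := sqr_ge0 U.
rewrite ger0_norm; last by rewrite mulr_ge0// mulr_ge0// mulr_ge0.
by apply: ler_wpM2r => //; apply: ler_wpM2r => //; exact: ler_wpM2l.
Qed.

Definition rhoN (e : R) : R := itg (rho e).

Lemma bcsupp_rho e : 0 < e -> bcsupp (rho e).
Proof. by move=> e0; apply: continuous_bcsupp; [exact: continuous_rho|exact: bsupp_rho]. Qed.

Lemma rhoN_gt0 e : 0 < e -> 0 < rhoN e.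
Proof.
move=> e0; apply: (@itg_gt0 _ _ _ 0); first exact: bcsupp_rho.
- exact: rho_ge0.
- exact: continuous_rho.
rewrite /rho big1 => [|i _]; last by rewrite mxE expr0n.
by rewrite subr0 /pos max_l ?sqr_ge0// exprn_gt0// exprn_gt0.
Qed.

Definition moll (e : R) w x : R := itg (fun y => rho e (y - x) / rhoN e * w y).

(** The kernel is evaluated at [y - x], so the derivative of [moll e w] in direction [u] is minus
    this integral. *)
Definition dmoll (e : R) u w x : R := itg (fun y => drho e u (y - x) / rhoN e * w y).

Section Mollifier.
Variable e : R.
Hypothesis e0 : 0 < e.

Let N0 : rhoN e != 0. Proof. by rewrite gt_eqF// rhoN_gt0. Qed.

Lemma bcsupp_drho u : bcsupp (drho e u).
Proof. by apply: continuous_bcsupp; [exact: continuous_drho|exact: bsupp_drho]. Qed.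

Lemma bcsupp_rhow x w : bmeas w -> bcsupp (fun y => rho e (y - x) / rhoN e * w y).
Proof.
move=> bw; apply: bcsuppMr => //; apply: bcsuppMr; last exact: bmeas_cst.
exact: (bcsupp_translate (- x) (bcsupp_rho e0)).
Qed.

Lemma bcsupp_drhow u x w : bmeas w -> bcsupp (fun y => drho e u (y - x) / rhoN e * w y).
Proof.
move=> bw; apply: bcsuppMr => //; apply: bcsuppMr; last exact: bmeas_cst.
exact: (bcsupp_translate (- x) (bcsupp_drho u)).
Qed.

Lemma itg_rhoN : itg (fun v => rho e v / rhoN e) = 1.
Proof.
under eq_fun do rewrite mulrC.
by rewrite itgZ ?mulVf//; exact: bcsupp_rho.
Qed.

(** In this form a mollification is an average of translates, which later ties it to the translates
    of [E]. *)
Lemma moll_shift w x : bmeas w -> moll e w x = itg (fun v => rho e v / rhoN e * w (x + v)).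
Proof.
move=> bw; rewrite -[RHS](@itg_translate _ _ _ (- x)); last first.
  have := bcsupp_translate x (bcsupp_rhow x bw); congr bcsupp; apply/funext => v.
  by rewrite addrK addrC.
by congr itg; apply/funext => y; rewrite (addrC x) subrK.
Qed.

Lemma moll_cst (c : R) x : moll e (fun=> c) x = c.
Proof.
rewrite moll_shift; last exact: bmeas_cst.
under eq_fun do rewrite mulrC.
rewrite itgZ ?itg_rhoN ?mulr1//; apply: bcsuppMr; [exact: bcsupp_rho|exact: bmeas_cst].
Qed.

Lemma mollZ c f x : bmeas f -> moll e (fun y => c * f y) x = c * moll e f x.
Proof.
move=> bf; rewrite /moll -itgZ; last exact: bcsupp_rhow.
by congr itg; apply/funext => y; rewrite mulrCA.
Qed.

Lemma moll_sum (I : Type) (r : seq I) (f : I -> 'rV[R]_n -> R) x :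
  (forall i, bmeas (f i)) ->
  moll e (fun y => \sum_(i <- r) f i y) x = \sum_(i <- r) moll e (f i) x.
Proof.
move=> bf; rewrite /moll -itg_sum; last by move=> i; exact: bcsupp_rhow.
by congr itg; apply/funext => y; rewrite mulr_sumr.
Qed.

Lemma le_moll f g x : bmeas f -> bmeas g -> (forall y, f y <= g y) -> moll e f x <= moll e g x.
Proof.
move=> bf bg fg; apply: le_itg; try exact: bcsupp_rhow.
by move=> y; rewrite ler_wpM2l// divr_ge0 ?rho_ge0// ltW// rhoN_gt0.
Qed.

Lemma moll_local f g x : (forall y, enorm (y - x) < e -> f y = g y) -> moll e f x = moll e g x.
Proof.
move=> fg; congr itg; apply/funext => y; have [ye|ye] := leP e (enorm (y - x)).
  by rewrite rho_out// !mul0r.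
by rewrite fg.
Qed.

Lemma moll_is_derive u w x : bmeas w -> is_derive x u (moll e w) (- dmoll e u w x).
Proof.
move=> bw; have [C [M [C0 HC]]] := rho_taylor u e0.
have [mw [W wW]] := bw; have W0 : 0 <= W by apply: le_trans (wW 0).
pose B : 'rV[R]_n -> R := \1_[set z : 'rV[R]_n | `|z| <= M].
have bB : bcsupp B by exact: bcsupp_cbox.
have Np : 0 < rhoN e by exact: rhoN_gt0.
apply: (@quadratic_is_derive _ _ _ _ _ _ (C / rhoN e * W * itg B)) => h h1.
(* Moving [x] by [h *: u] moves the argument of the kernel by the opposite vector, hence the step
   [- h]. *)
have -> : moll e w (x + h *: u) - moll e w x - h * - dmoll e u w x =
  itg (fun y => (rho e ((y - x) + (- h) *: u) - rho e (y - x) - (- h) * drho e u (y - x))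
       / rhoN e * w y).
  rewrite mulrN opprK /moll /dmoll -itgZ; last exact: bcsupp_drhow.
  rewrite -itgB; try exact: bcsupp_rhow.
  rewrite -itgD; last 2 first.
  - by apply: bcsuppB; exact: bcsupp_rhow.
  - by apply: bcsuppZ; exact: bcsupp_drhow.
  congr itg; apply/funext => y.
  by rewrite opprD addrA scaleNr; field.
have bI : bcsupp (fun y => (rho e ((y - x) + (- h) *: u) - rho e (y - x) - (- h) * drho e u (y - x))
       / rhoN e * w y).
  apply: bcsuppMr => //; apply: bcsuppMr; last exact: bmeas_cst.
  apply: bcsuppB; [apply: bcsuppB|apply: bcsuppZ].
  - under eq_fun do rewrite -addrA.
    exact: (bcsupp_translate (- x + (- h) *: u) (bcsupp_rho e0)).
  - exact: (bcsupp_translate (- x) (bcsupp_rho e0)).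
  - exact: (bcsupp_translate (- x) (bcsupp_drho u)).
apply: (le_trans (le_norm_itg bI)).
rewrite -(@itg_translate _ _ B (- x))// mulrAC.
rewrite -itgZ; last exact: (bcsupp_translate (- x) bB).
apply: le_itg; first exact: bcsupp_norm.
  by apply: bcsuppZ; exact: (bcsupp_translate (- x) bB).
move=> y; rewrite 2!normrM normfV (gtr0_norm Np).
have := HC (y - x) (- h); rewrite normrN sqrrN => /(_ h1) Hy.
rewrite (_ : C / rhoN e * W * h ^+ 2 * B (y - x) = (C * h ^+ 2 * B (y - x)) / rhoN e * W); last by field.
apply: ler_pM => //; first by rewrite divr_ge0// ltW.
by apply: ler_wpM2r => //; rewrite invr_ge0 ltW.
Qed.

Lemma continuous_dmoll u w : bmeas w -> continuous (dmoll e u w).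
Proof.
move=> bw; apply: (@convolution_continuous _ _ (fun z => drho e u z / rhoN e)) => //.
  by move=> z; apply: (@cvgM _ _ _ (nbhs_filter z)); [exact: continuous_drho|exact: cvg_cst].
by apply: bsuppMr; exact: bsupp_drho.
Qed.

Lemma derive_moll u w : bmeas w -> 'D_u (moll e w) = (fun x => - dmoll e u w x).
Proof. by move=> bw; apply/funext => x; have [_ ->] := moll_is_derive u x bw. Qed.

Lemma derive_mollE u w x : bmeas w -> 'D_u (moll e w) x = - dmoll e u w x.
Proof. by move=> bw; have [_ ->] := moll_is_derive u x bw. Qed.

Lemma moll_C1 w : bmeas w -> C1 (moll e w).
Proof.
move=> bw; split=> [i x|i]; first by have [] := moll_is_derive (ev R i) x bw.
rewrite derive_moll// => x; apply: (@cvgN _ _ _ _ (nbhs_filter x)).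
exact: continuous_dmoll.
Qed.

Lemma dmoll_coord u w x : bmeas w ->
  dmoll e u w x = \sum_(i < n) u 0 i * dmoll e (ev R i) w x.
Proof.
move=> bw; rewrite /dmoll.
transitivity (\sum_(i < n) itg (fun y => u 0 i * (drho e (ev R i) (y - x) / rhoN e * w y))); last first.
  by apply: eq_bigr => i _; rewrite itgZ//; exact: bcsupp_drhow.
rewrite -itg_sum; last by move=> i; apply: bcsuppZ; exact: bcsupp_drhow.
congr itg; apply/funext => y; rewrite drho_coord !mulr_suml.
by apply: eq_bigr => i _; rewrite !mulrA.
Qed.

(* drho is odd, so the derivative passes to the other factor with a minus sign. *)
Lemma dmoll_dual u w t : bmeas w -> bcsupp t ->
  itg (fun x => dmoll e u w x * t x) = - itg (fun y => w y * dmoll e u t y).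
Proof.
move=> bw bt.
have [[mt [T tT]] [M tM]] := bt; have [mw [W wW]] := bw.
have [[md [D dD]] _] := bcsupp_drho u.
have D0 : 0 <= D by apply: le_trans (dD 0).
have W0 : 0 <= W by apply: le_trans (wW 0).
have T0 : 0 <= T by apply: le_trans (tT 0).
have Np : 0 < rhoN e by exact: rhoN_gt0.
pose F (p : 'rV[R]_n * 'rV[R]_n) := drho e u (p.2 - p.1) / rhoN e * w p.2 * t p.1.
have mF : measurable_fun setT F.
  apply: measurable_funM; last exact: (measurableT_comp mt).
  apply: measurable_funM; last exact: (measurableT_comp mw).
  apply: measurable_funM => //.
  apply: (measurableT_comp md).
  have -> : (fun p : 'rV[R]_n * 'rV[R]_n => p.2 - p.1) = (fun p => p.1 - p.2) \o (fun p => (p.2, p.1)) by [].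
  apply: (measurableT_comp (@measurable_sub2 R n)).
  by apply: measurable_fun_pair; [exact: measurable_snd|exact: measurable_fst].
pose K := Num.max (D / rhoN e * W * T) (M + `|e|).
have FK p : `|F p| <= K.
  rewrite /K le_max; apply/orP; left; rewrite /F !normrM normfV (gtr0_norm Np).
  have Ni : 0 <= (rhoN e)^-1 by rewrite invr_ge0 ltW.
  by do 2 (apply: ler_pM => //; rewrite ?mulr_ge0//); rewrite ler_wpM2r.
have F0 x y : K < `|x| \/ K < `|y| -> F (x, y) = 0.
  rewrite /K !gt_max /F /=; have [xM|xM] := leP `|x| M; last by rewrite tM// mulr0.
  case=> /andP[_ Hx]; first by have := normr_ge0 e; lra.
  rewrite drho_out ?mul0r//; rewrite (gtr0_norm e0) in Hx.
  apply: le_trans (mxnorm_le_enorm _).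
  by have := lerB_dist y x; lra.
have [_ _ E] := bcsupp_fubini mF FK F0.
transitivity (itg (fun x => itg (fun y => F (x, y)))).
  congr itg; apply/funext => x; rewrite mulrC -itgZ; last exact: bcsupp_drhow.
  by congr itg; apply/funext => y; rewrite /F /= mulrC.
rewrite E -mulN1r -itgZ; last first.
  apply: (fun H => bcsuppMl H bw); apply: continuous_bcsupp.
    exact: continuous_dmoll (bcsupp_bmeas bt).
  exists (M + e) => y yM; rewrite /dmoll (_ : (fun _ => _) = (fun=> 0)) ?itg0//.
  apply/funext => z; have [zM|zM] := leP `|z| M; last by rewrite tM ?mulr0.
  rewrite drho_out ?mul0r//; apply: le_trans (mxnorm_le_enorm _).
  by rewrite distrC; have := lerB_dist y z; lra.
congr itg; apply/funext => y; rewrite mulN1r /dmoll -mulrN -itgN; last first.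
  exact: bcsupp_drhow (bcsupp_bmeas bt).
rewrite -itgZ; last by apply: bcsuppN; exact: bcsupp_drhow (bcsupp_bmeas bt).
congr itg; apply/funext => x; rewrite /F /= -(opprB x y) drho_odd; ring.
Qed.

Lemma moll_bsupp w (M : R) : (forall x, M < `|x| -> w x = 0) ->
  forall x, M + e < `|x| -> moll e w x = 0.
Proof.
move=> wM x xM; rewrite (@moll_local _ (fun=> 0)) ?moll_cst// => y ye; apply: wM.
by have := lerB_dist x y; rewrite distrC; have := mxnorm_le_enorm (y - x); lra.
Qed.

Lemma moll_C1c w : bcsupp w -> C1c (moll e w).
Proof.
move=> [bw [M wM]]; split; first exact: moll_C1.
by exists (M + e); exact: moll_bsupp.
Qed.

End Mollifier.

End Kernel.

Import HBNNSimple.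

(** * Continuity of translations in L^1 *)

Section TranslationContinuity.
Variables (R : realType) (n : nat).
Implicit Types (w f g : 'rV[R]_n -> R) (x v : 'rV[R]_n).

Definition osc w v (M : R) : R := itg (fun x => `|w (x + v) - w x| * \1_(cbox M) x).

(** Continuity of translations in L^1 on cubes, stated along sequences so that dominated convergence
    applies. *)
Definition tcont w : Prop := forall (v_ : nat -> 'rV[R]_n) (M : R),
  `|v_ k| @[k --> \oo] --> (0 : R) -> osc w (v_ k) M @[k --> \oo] --> (0 : R).

Lemma bcsupp_osc w v M : bmeas w ->
  bcsupp (fun x => `|w (x + v) - w x| * \1_(cbox M) x).
Proof.
move=> bw; apply: (fun H => bcsuppMl (bcsupp_cbox n M) H); apply: bmeas_norm.
by apply: bmeasB => //; exact: bmeas_translate.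
Qed.

Lemma osc_ge0 w v M : 0 <= osc w v M.
Proof. by apply: itg_ge0 => x; rewrite mulr_ge0. Qed.

Lemma squeeze0 (a b : nat -> R) : (forall k, 0 <= a k <= b k) ->
  b k @[k --> \oo] --> (0 : R) -> a k @[k --> \oo] --> (0 : R).
Proof.
move=> ab b0; apply: (@squeeze_cvgr _ _ _ _ (fun=> 0) b) => //; last exact: cvg_cst.
exact: nearW.
Qed.

Lemma tcont_continuous w : bmeas w -> continuous w -> tcont w.
Proof.
move=> bw cw v_ M v0; have [_ [B wB]] := bw.
have B0 : 0 <= B by apply: le_trans (wB 0).
rewrite -(itg0 R n); apply: (@itg_dominated _ _ _ _ (fun x => (2 * B) * \1_(cbox M) x)).
- by move=> k; have [[]] := bcsupp_osc (v_ k) M bw.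
- exact: measurable_cst.
- by apply: bcsuppZ; exact: bcsupp_cbox.
- move=> x; rewrite -(mul0r (\1_(cbox M) x)); apply: cvgM; last exact: cvg_cst.
  have H : (fun k => x + v_ k) @ \oo --> x.
    apply/cvgrPdist_lt => e e0; have /cvgrPdist_lt/(_ e e0) := v0.
    apply: filterS => k; rewrite sub0r normrN normr_id => vk.
    by rewrite opprD addrA subrr sub0r normrN.
  have := cvg_comp _ _ H (cw x) => /cvgrPdist_lt Hw.
  apply/cvgrPdist_lt => e /Hw; apply: filterS => k /=.
  by rewrite sub0r normrN normr_id distrC.
- move=> k x; rewrite normrM normr_id (ger0_norm (_ : 0 <= \1_(cbox M) x))// ler_wpM2r//.
  by rewrite (le_trans (ler_normB _ _))// mulr_natl mulr2n lerD.
Qed.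

Lemma osc_triangle w f v M : bmeas w -> bmeas f -> `|v| <= 1 ->
  osc w v M <= osc f v M + 2 * itg (fun x => `|w x - f x| * \1_(cbox (M + 1)) x).
Proof.
move=> bw bf v1; have bwf := bmeasB bw bf.
have b1 : bcsupp (fun x => `|w x - f x| * \1_(cbox (M + 1)) x).
  by apply: (fun H => bcsuppMl (bcsupp_cbox n _) H); exact: bmeas_norm.
have b2 := bcsupp_translate v b1.
rewrite mulr_natl mulr2n -{1}(itg_translate v b1) addrA /osc.
rewrite -itgD//; last exact: bcsupp_osc.
rewrite -itgD//; last by apply: bcsuppD => //; exact: bcsupp_osc.
apply: le_itg; first exact: bcsupp_osc.
  by apply: bcsuppD => //; apply: bcsuppD => //; exact: bcsupp_osc.
move=> x; have [xM|xM] := boolP (x \in cbox M); last first.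
  by rewrite [\1_(cbox M) x]indicE (negbTE xM) !mulr0 add0r addr_ge0// mulr_ge0.
rewrite [\1_(cbox M) x]indicE xM [\1_(cbox (M + 1)) x]indicE [\1_(cbox (M + 1)) (x + v)]indicE.
rewrite inE /cbox /= in xM.
rewrite !mem_set /cbox/= ?mulr1; last 2 first.
- lra.
- by rewrite (le_trans (ler_normD _ _))// lerD.
have -> : w (x + v) - w x = (f (x + v) - f x) + (w (x + v) - f (x + v)) - (w x - f x) by ring.
by rewrite (le_trans (ler_normB _ _))// lerD// ler_normD.
Qed.

(** A bounded pointwise limit is a limit in L^1 on cubes, and [osc_triangle] transfers small
    oscillation from a single [w_ j] to [w]. *)
Lemma tcont_lim (w_ : nat -> 'rV[R]_n -> R) w (B : R) :
  (forall j, bmeas (w_ j)) -> bmeas w -> (forall j x, `|w_ j x| <= B) ->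
  (forall x, w_ j x @[j --> \oo] --> w x) -> (forall j, tcont (w_ j)) -> tcont w.
Proof.
move=> bw_ bw wB ww tw v_ M v0.
have [_ [B' wB']] := bw.
have B0 : 0 <= B by apply: le_trans (wB 0%N 0).
have B'0 : 0 <= B' by apply: le_trans (wB' 0).
pose E j := itg (fun x => `|w x - w_ j x| * \1_(cbox (M + 1)) x).
have E0 : E j @[j --> \oo] --> (0 : R).
  rewrite -(itg0 R n); apply: (@itg_dominated _ _ _ _ (fun x => (B' + B) * \1_(cbox (M + 1)) x)).
  - move=> j; apply: measurable_funM; last by have [[]] := bcsupp_cbox n (M + 1).
    by have [] := bmeas_norm (bmeasB bw (bw_ j)).
  - exact: measurable_cst.
  - by apply: bcsuppZ; exact: bcsupp_cbox.
  - move=> x; rewrite -(mul0r (\1_(cbox (M + 1)) x)); apply: cvgM; last exact: cvg_cst.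
    have /cvgrPdist_lt H := ww x; apply/cvgrPdist_lt => e /H; apply: filterS => k /=.
    by rewrite sub0r normrN normr_id.
  - move=> k x; rewrite normrM normr_id (ger0_norm (_ : 0 <= \1_(cbox (M + 1)) x))// ler_wpM2r//.
    by rewrite (le_trans (ler_normB _ _))// lerD.
apply/cvgrPdist_lt => e e0.
have [j Hj] : exists j, E j < e / 4.
  have /cvgrPdist_lt/(_ (e / 4) ltac:(lra))[j _ /(_ j (leqnn j))] := E0.
  by rewrite /= sub0r normrN => H; exists j; apply: le_lt_trans H; exact: ler_norm.
have /cvgrPdist_lt/(_ 1 ltr01) H1 := v0.
have /cvgrPdist_lt/(_ (e / 4) ltac:(lra)) H2 := tw j v_ M v0.
near=> k; rewrite sub0r normrN ger0_norm; last exact: osc_ge0.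
have vk : `|v_ k| <= 1.
  have : `|0 - `|v_ k| | < 1 by near: k.
  by rewrite sub0r normrN normr_id => /ltW.
have ok : osc (w_ j) (v_ k) M < e / 4.
  have : `|0 - osc (w_ j) (v_ k) M| < e / 4 by near: k.
  by rewrite sub0r normrN ger0_norm// osc_ge0.
have := osc_triangle M bw (bw_ j) vk; rewrite -/(E j); lra.
Unshelve. all: by end_near. Qed.

Lemma tcontD f g : bmeas f -> bmeas g -> tcont f -> tcont g -> tcont (fun x => f x + g x).
Proof.
move=> bf bg tf tg v_ M v0.
apply: (@squeeze0 _ (fun k => osc f (v_ k) M + osc g (v_ k) M)).
  move=> k; rewrite osc_ge0/= /osc -itgD; try exact: bcsupp_osc.
  apply: le_itg; first by apply: bcsupp_osc; exact: bmeasD.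
    by apply: bcsuppD; exact: bcsupp_osc.
  move=> x; rewrite -mulrDl ler_wpM2r//.
  by rewrite opprD addrACA ler_normD.
by rewrite -[X in _ --> X]addr0; apply: cvgD; [exact: tf|exact: tg].
Qed.

Lemma tcontZ c f : bmeas f -> tcont f -> tcont (fun x => c * f x).
Proof.
move=> bf tf v_ M v0.
apply: (@squeeze0 _ (fun k => `|c| * osc f (v_ k) M)).
  move=> k; rewrite osc_ge0/= /osc -itgZ; last exact: bcsupp_osc.
  apply: le_itg; first by apply: bcsupp_osc; apply: bmeasM => //; exact: bmeas_cst.
    by apply: bcsuppZ; exact: bcsupp_osc.
  by move=> x; rewrite -mulrBr normrM mulrA.
by rewrite -(mulr0 `|c|); apply: cvgM; [exact: cvg_cst|exact: tf].
Qed.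

Lemma tcont_cst c : tcont (fun _ => c).
Proof.
by apply: tcont_continuous; [exact: bmeas_cst|exact: cst_continuous].
Qed.

Lemma tcont_sum I (r : seq I) (f : I -> 'rV[R]_n -> R) :
  (forall i, bmeas (f i)) -> (forall i, tcont (f i)) -> tcont (fun x => \sum_(i <- r) f i x).
Proof.
move=> bf tf; elim: r => [|i r IH].
  by under eq_fun do rewrite big_nil; exact: tcont_cst.
under eq_fun do rewrite big_cons.
by apply: tcontD => //; exact: bmeas_sum.
Qed.

(** Distance to the complement of [O] in the sup norm, capped at 1 so that the supremum exists even
    when [O] is the whole space. *)
Definition indist (O : set 'rV[R]_n) x : R :=
  sup [set r : R | 0 <= r <= 1 /\ forall y, `|y - x| < r -> O y].

Lemma indist_has_sup O x :
  has_sup [set r : R | 0 <= r <= 1 /\ forall y, `|y - x| < r -> O y].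
Proof.
split; last by exists 1 => r [/andP[]].
by exists 0; split=> [|y]; [rewrite lexx ler01|rewrite ltNge normr_ge0].
Qed.

Lemma indist_lip O x y : indist O x <= indist O y + `|x - y|.
Proof.
apply: ge_sup; first by have [] := indist_has_sup O x.
move=> r [/andP[r0 r1] Hr]; have [rxy|rxy] := leP r `|x - y|.
  rewrite -[r]add0r lerD//; apply: sup_upper_bound; first exact: indist_has_sup.
  by split=> [|z]; [rewrite lexx ler01|rewrite ltNge normr_ge0].
rewrite -lerBlDr; apply: sup_upper_bound; first exact: indist_has_sup.
split=> [|z zy].
  by have Hn := normr_ge0 (x - y); apply/andP; split; lra.
apply: Hr; have := ler_distD y z x; rewrite (distrC y x); lra.
Qed.

Lemma indist_continuous O : continuous (indist O).
Proof.
move=> x; apply/continuous_rVP => e e0; exists e => // y yx.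
have := indist_lip O x y; have := indist_lip O y x; rewrite distrC => H1 H2.
rewrite ler_norml; move: yx; rewrite distrC => yx; apply/andP; split; lra.
Qed.

Lemma indist_ge0 O x : 0 <= indist O x.
Proof.
apply: sup_upper_bound; first exact: indist_has_sup.
by split=> [|z]; [rewrite lexx ler01|rewrite ltNge normr_ge0].
Qed.

Lemma indist_gt0 O x : open O -> O x -> 0 < indist O x.
Proof.
move=> oO Ox; have /nbhs_ballP[d /= d0 Hd] : nbhs x O by rewrite nbhsE; exists O.
apply: (@lt_le_trans _ _ (Num.min d 1)); first by rewrite lt_min d0 ltr01.
apply: sup_upper_bound; first exact: indist_has_sup.
split; first by rewrite le_min (ltW d0) ler01 ge_min lexx orbT.
move=> y; rewrite lt_min => /andP[yd _]; apply: Hd.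
by rewrite -ball_normE /= distrC.
Qed.

Lemma indist_out O x : ~ O x -> indist O x = 0.
Proof.
move=> Ox; apply/eqP; rewrite eq_le indist_ge0 andbT.
apply: ge_sup; first by have [] := indist_has_sup O x.
move=> r [/andP[r0 _] Hr]; rewrite leNgt; apply/negP => rp; apply: Ox.
by apply: Hr; rewrite subrr normr0.
Qed.

Lemma tcont_open O : open O -> tcont (\1_O : 'rV[R]_n -> R).
Proof.
move=> oO.
(* Continuous functions increasing to the indicator of [O]. *)
pose f (j : nat) x : R := Num.min (j%:R * indist O x) 1.
have cf j : continuous (f j).
  move=> x; apply: (@continuous_comp _ _ _ (fun x => j%:R * indist O x) (fun s => Num.min s 1)).
    by apply: (@cvgM _ _ _ (nbhs_filter x)); [exact: cvg_cst|exact: indist_continuous].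
  by apply: continuous_min; [move=> ?; exact: cvg_id|exact: cst_continuous].
have f0 j x : 0 <= f j x <= 1.
  by rewrite /f le_min ler01 mulr_ge0 ?indist_ge0//= ge_min lexx orbT.
have fB j x : `|f j x| <= 1 by have /andP[? ?] := f0 j x; rewrite ger0_norm.
have bf j : bmeas (f j) by split; [exact: continuous_measurable_rV|exists 1].
apply: (@tcont_lim f _ 1) => //.
- by apply: bmeas_indic; exact: measurable_open.
- move=> x; have [Ox|Ox] := pselect (O x); last first.
    rewrite indicE memNset// /f indist_out//; under eq_fun do rewrite mulr0.
    by rewrite min_l//; exact: cvg_cst.
  rewrite indicE mem_set//; have d0 := indist_gt0 oO Ox.
  apply: cvg_near_cst; near=> j; rewrite /f min_r//.
  rewrite -ler_pdivrMr// mul1r.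
  near: j; exact: nbhs_infty_ger.
- by move=> j; exact: tcont_continuous.
Unshelve. all: by end_near. Qed.

(** Open sets are stable under intersection and generate the Borel sets, and the property passes to
    complements and to countable disjoint unions. *)
Lemma tcont_indic (A : set 'rV[R]_n) : measurable A -> tcont (\1_A : 'rV[R]_n -> R).
Proof.
move: A; apply: (@dynkin_induction _ _ (@open 'rV[R]_n)) => //.
- exact: openI.
- by apply: tcont_open; exact: openT.
- by move=> A oA; exact: tcont_open.
- move=> S mS tS.
  have -> : \1_(~` S) = (fun x => 1 + (-1) * \1_S x) :> ('rV[R]_n -> R).
    apply/funext => x; rewrite !indicE in_setC; case: (_ \in _) => /=; ring.
  have bS : bmeas (\1_S : 'rV[R]_n -> R) by exact: bmeas_indic.
  apply: tcontD; [exact: bmeas_cst| |exact: tcont_cst|exact: tcontZ].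
  by apply: bmeasM => //; exact: bmeas_cst.
move=> F mF tF tcF.
have sumE j x k : F k x -> \sum_(i < j) \1_(F i) x = (k < j)%N%:R :> R.
  move=> Fk; have out (i : 'I_j) : k != i -> \1_(F i) x = 0 :> R.
    move=> ki; rewrite indicE memNset// => Fi; move/eqP: ki; apply.
    by apply: (tF k i) => //; exists x.
  case: (ltnP k j) => kj; last first.
    by rewrite big1// => i _; apply: out; rewrite neq_ltn (leq_trans (ltn_ord i) kj) orbT.
  rewrite (bigD1 (Ordinal kj))//= indicE mem_set// big1 ?addr0// => i ik.
  by apply: out; rewrite eq_sym.
have sum0 j x : ~ (\bigcup_k F k) x -> \sum_(i < j) \1_(F i) x = 0 :> R.
  by move=> nF; rewrite big1// => i _; rewrite indicE memNset// => Fi; apply: nF; exists i.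
have bF j : bmeas (\1_(F j) : 'rV[R]_n -> R) by exact: bmeas_indic.
apply: (@tcont_lim (fun j x => \sum_(i < j) \1_(F i) x) _ 1).
- by move=> j; exact: bmeas_sum.
- by apply: bmeas_indic; exact: bigcup_measurable.
- move=> j x; have [[k _ Fk]|nF] := pselect ((\bigcup_k F k) x).
    by rewrite (sumE _ _ k)//; case: (_ < _)%N; rewrite ?normr1 ?normr0.
  by rewrite sum0// normr0.
- move=> x; have [[k _ Fk]|nF] := pselect ((\bigcup_k F k) x); last first.
    by rewrite indicE memNset//; under eq_fun do rewrite sum0//; exact: cvg_cst.
  rewrite indicE mem_set; last by exists k.
  apply: cvg_near_cst; near=> j; rewrite (sumE _ _ k)// (_ : (k < j)%N)//.
  by near: j; exact: nbhs_infty_gt.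
- by move=> j; apply: tcont_sum.
Unshelve. all: by end_near. Qed.

(** Adding the bound [B] makes the function nonnegative, hence an increasing limit of simple
    functions, which are finite combinations of indicators. *)
Lemma tcont_bmeas w : bmeas w -> tcont w.
Proof.
move=> bw; have [mw [B wB]] := bw.
have B0 : 0 <= B by apply: le_trans (wB 0).
pose w' x := w x + B.
have w'0 x : (0 <= (w' x)%:E)%E.
  by rewrite lee_fin /w'; have := wB x; rewrite ler_norml => /andP[]; lra.
have mw' : measurable_fun setT w' by apply: measurable_funD.
have bw' : bmeas w' by apply: bmeasD => //; exact: bmeas_cst.
have -> : w = (fun x => w' x + (- B)) by apply/funext => x; rewrite /w' addrK.
apply: tcontD; [exact: bw'|exact: bmeas_cst| |exact: tcont_cst].
have mEw' : measurable_fun setT (EFin \o w') by exact/measurable_EFinP.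
pose f := nnsfun_approx measurableT mEw'.
have fw x : EFin (f j x) @[j --> \oo] --> (w' x)%:E.
  exact: (@cvg_nnsfun_approx _ _ _ _ measurableT _ mEw' (fun x _ => w'0 x) x I).
have fw1 x : f j x @[j --> \oo] --> w' x.
  have : (fine \o (fun j => (f j x)%:E)) @ \oo --> w' x; last by [].
  by apply: fine_cvg; exact: fw.
have fB j x : `|f j x| <= 2 * B.
  rewrite ger0_norm//; apply: (@le_trans _ _ (w' x)).
    rewrite -(cvg_lim _ (fw1 x))//.
    apply: (@nondecreasing_cvgn_le _ (fun j => f j x)); last by apply/cvg_ex; exists (w' x).
    by move=> i k /(nd_nnsfun_approx measurableT mEw')/lefP.
  by rewrite /w'; have := wB x; rewrite ler_norml => /andP[]; lra.
have bf j : bmeas (f j) by split; [exact: measurable_funP|exists (2 * B)].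
apply: (@tcont_lim f w' (2 * B)) => //.
move=> j; rewrite (funext (fimfunEord (f j))).
apply: tcont_sum => i.
  by apply: bmeasM; [exact: bmeas_cst|exact: bmeas_indic].
by apply: tcontZ; [exact: bmeas_indic|exact: tcont_indic].
Qed.

End TranslationContinuity.

(** * Neighbourhoods of compact sets and cutoff functions *)

Section Cutoff.
Variables (R : realType) (n : nat).
Implicit Types (K V : set 'rV[R]_n) (x y : 'rV[R]_n).

Definition thick K (r : R) : set 'rV[R]_n := [set x | exists2 y, K y & `|x - y| <= r].

Lemma compact_thick K r : compact K -> compact (thick K r).
Proof.
move=> cK; have -> : thick K r = (fun p => p.1 + p.2) @` (K `*` cbox r).
  rewrite predeqE => x; split=> [[y Ky xy]|[[y z] /= [Ky zr] <-]].
    by exists (y, x - y) => //=; rewrite addrC subrK.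
  by exists y => //; rewrite addrAC subrr add0r.
apply: continuous_compact; last by apply: compact_setX => //; exact: compact_cbox.
by apply: continuous_subspaceT => p; exact: add_continuous.
Qed.

Lemma thick_le K r s : r <= s -> thick K r `<=` thick K s.
Proof. by move=> rs x [y Ky xy]; exists y => //; exact: le_trans rs. Qed.

Lemma thick_add K r s x y : thick K r x -> `|y - x| <= s -> thick K (r + s) y.
Proof.
move=> [z Kz xz] yx; exists z => //; have := ler_distD x y z; lra.
Qed.

(** [indist V] is continuous and positive on [K]; half of its minimum is a radius that works at
    every point. *)
Lemma compact_thick_sub K V : compact K -> open V -> K `<=` V ->
  exists2 r : R, 0 < r & thick K r `<=` V.
Proof.
move=> cK oV KV; have [[x0 Kx0]|K0] := pselect (K !=set0); last first.
  by exists 1 => // x [y Ky _]; exfalso; apply: K0; exists y.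
have [||c Kc Hc] := @EVT_min_rV R n (indist V) K _ cK.
- by exists x0.
- by apply: continuous_subspaceT; exact: indist_continuous.
rewrite inE in Kc; have c0 : 0 < indist V c by apply: indist_gt0 => //; exact: KV.
exists (indist V c / 2); first lra.
move=> x [y Ky xy]; have cy : indist V c <= indist V y by apply: Hc; rewrite inE.
have [|r [_ Hr] rlt] := @sup_adherent R _ (indist V c / 2) _ (indist_has_sup V y); first lra.
apply: Hr; apply: (le_lt_trans xy); apply: le_lt_trans rlt; rewrite -/(indist V y); lra.
Qed.

Lemma compact_measurable_rV K : compact K -> measurable K.
Proof.
move=> /(compact_closed (@norm_hausdorff _ _)) cK.
by rewrite -[K]setCK; apply: measurableC; apply: measurable_open; exact: closed_openC.
Qed.

Lemma cutoff_exists K V : compact K -> open V -> K `<=` V ->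
  exists (z : 'rV[R]_n -> R) K', [/\ C1 z, forall x, 0 <= z x <= 1,
    (exists2 r : R, 0 < r & forall x, thick K r x -> z x = 1), compact K' /\ K' `<=` V
    & forall x, ~ K' x -> z x = 0].
Proof.
move=> cK oV KV; have [r r0 rV] := compact_thick_sub cK oV KV.
have r3 : 0 < r / 3 by lra.
(* The indicator of the 2r/3-neighbourhood, mollified at scale r/3, is 1 within r/3 of [K] and 0
   beyond distance [r]. *)
pose A := thick K (2 * (r / 3)).
have mA : measurable A by apply: compact_measurable_rV; exact: compact_thick.
have bA : bmeas (\1_A : _ -> R) by exact: bmeas_indic.
have i01 x : 0 <= (\1_A x : R) <= 1.
  by rewrite indicE; case: (_ \in _); rewrite lexx ler01.
exists (moll (r / 3) \1_A), (thick K r); split => //.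
- exact: moll_C1.
- move=> x.
  have H0 := @le_moll _ _ _ r3 _ _ x (bmeas_cst n 0) bA (fun y => proj1 (andP (i01 y))).
  have H1 := @le_moll _ _ _ r3 _ _ x bA (bmeas_cst n 1) (fun y => proj2 (andP (i01 y))).
  by rewrite !moll_cst// in H0 H1; apply/andP.
- exists (r / 3) => // x Kx; rewrite (@moll_local _ _ _ r3 _ (fun=> 1)) ?moll_cst// => y yx.
  rewrite indicE mem_set// /A (_ : 2 * (r / 3) = r / 3 + r / 3); last by lra.
  by apply: thick_add Kx _; rewrite (le_trans (mxnorm_le_enorm _))// ltW.
- by split; [exact: compact_thick|].
- move=> x nK; rewrite (@moll_local _ _ _ r3 _ (fun=> 0)) ?moll_cst// => y yx.
  rewrite indicE memNset// => Ky; apply: nK.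
  rewrite (_ : r = 2 * (r / 3) + r / 3); last by lra.
  apply: thick_add Ky _; rewrite distrC (le_trans (mxnorm_le_enorm _))// ltW//.
Qed.

End Cutoff.

(** * Test fields and the total variation *)

Section Fields.
Variables (R : realType) (n : nat).
Implicit Types (K V : set 'rV[R]_n) (x y : 'rV[R]_n) (w : 'rV[R]_n -> R)
  (phi psi : 'rV[R]_n -> 'rV[R]_n).

Definition C1field V phi : Prop :=
  (forall j, C1 (fun y => phi y 0 j)) /\
  exists K, [/\ compact K, K `<=` V & forall x, ~ K x -> phi x = 0].

Definition divint w phi : R := itg (fun x => w x * div phi x).

(** An upper bound for the total variation of [w] in [V]. Infinite variation is the absence of such
    a bound, so the variation estimates stay among real numbers until [perimeter_leP]. *)
Definition tvle w V (p : R) : Prop := forall phi, admissible V phi -> divint w phi <= p.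

Lemma admissibleP V phi :
  admissible V phi <-> C1field V phi /\ forall x, enorm (phi x) <= 1.
Proof.
split=> [[dp cp sp np]|[[cp sp] np]].
  by [].
by split => // j; have [? ?] := cp j.
Qed.

Lemma compact_far K : compact K -> exists M : R, forall x, M < `|x| -> ~ K x.
Proof.
move=> /compact_bounded[N [_ HN]]; exists (N + 1) => x xN Kx.
by have /= := HN (N + 1) ltac:(lra) x Kx; rewrite leNgt xN.
Qed.

Lemma compact_bsupp K (T : zmodType) (f : 'rV[R]_n -> T) : compact K ->
  (forall x, ~ K x -> f x = 0) -> exists M : R, forall x, M < `|x| -> f x = 0.
Proof. by move=> /compact_far[M KM] f0; exists M => x /KM /f0. Qed.

Lemma C1field_C1c V phi j : C1field V phi -> C1c (fun y => phi y 0 j).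
Proof.
move=> [cp [K [cK KV p0]]]; split; first exact: cp.
apply: (compact_bsupp cK) => x /p0 ->; exact: mxE.
Qed.

Lemma derive_supp K (g : 'rV[R]_n -> R) v x : compact K -> (forall x, ~ K x -> g x = 0) ->
  ~ K x -> 'D_v g x = 0.
Proof.
move=> /(compact_closed (@norm_hausdorff _ _)) cK g0 nKx.
rewrite (@near_eq_derive _ _ _ g (cst 0)) ?derive_cst//.
have : nbhs x (~` K) by rewrite nbhsE; exists (~` K) => //; split => //; exact: closed_openC.
by apply: filterS => y /g0.
Qed.

Lemma div_supp K phi x : compact K -> (forall x, ~ K x -> phi x = 0) ->
  ~ K x -> div phi x = 0.
Proof.
move=> cK p0 nKx; rewrite /div big1// => j _.
by apply: (derive_supp (ev R j) cK) => // y /p0 ->; rewrite mxE.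
Qed.

Lemma bcsupp_div V phi : C1field V phi -> bcsupp (div phi).
Proof.
move=> fp; apply: bcsupp_sum => j; exact: (C1c_partial_bcsupp j (C1field_C1c j fp)).
Qed.

Lemma bcsupp_mul_div V phi w : bmeas w -> C1field V phi -> bcsupp (fun x => w x * div phi x).
Proof. by move=> bw fp; apply: bcsuppMl => //; exact: bcsupp_div fp. Qed.

Lemma divint_coord V phi w : bmeas w -> C1field V phi ->
  divint w phi = \sum_(j < n) itg (fun x => w x * 'D_(ev R j) (fun y => phi y 0 j) x).
Proof.
move=> bw fp; rewrite /divint -itg_sum.
  by congr itg; apply/funext => x; rewrite /div mulr_sumr.
move=> j; apply: bcsuppMl => //; exact: (C1c_partial_bcsupp j (C1field_C1c j fp)).
Qed.

Lemma divint_eq V phi a b : C1field V phi -> (forall x, V x -> a x = b x) ->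
  divint a phi = divint b phi.
Proof.
move=> [_ [K [cK KV p0]]] ab; congr itg; apply/funext => x.
have [Kx|nKx] := pselect (K x); first by rewrite ab//; exact: KV.
by rewrite (div_supp cK)// !mulr0.
Qed.

Lemma C1field_sub V V' phi : V `<=` V' -> C1field V phi -> C1field V' phi.
Proof.
by move=> VV [cp [K [cK KV p0]]]; split => //; exists K; split => // x /KV /VV.
Qed.

Lemma admissible_sub V V' phi : V `<=` V' -> admissible V phi -> admissible V' phi.
Proof.
by move=> VV /admissibleP[fp np]; apply/admissibleP; split => //; exact: C1field_sub fp.
Qed.

Lemma C1fieldD V phi psi : C1field V phi -> C1field V psi ->
  C1field V (fun x => phi x + psi x).
Proof.
move=> [cp [K [cK KV p0]]] [cq [L [cL LV q0]]]; split=> [j|].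
  by under eq_fun do rewrite mxE; exact: C1D.
exists (K `|` L); split; first exact: compactU.
  by move=> x [/KV|/LV].
move=> x nKL; rewrite p0 ?q0 ?addr0//; first by move=> ?; apply: nKL; right.
by move=> ?; apply: nKL; left.
Qed.

Lemma C1fieldM V phi (z : 'rV[R]_n -> R) : C1 z -> C1field V phi ->
  C1field V (fun x => z x *: phi x).
Proof.
move=> Cz [cp [K [cK KV p0]]]; split=> [j|].
  by under eq_fun do rewrite mxE; exact: C1M.
by exists K; split => // x /p0 ->; rewrite scaler0.
Qed.

Lemma C1field_cutoff V V' phi (z : 'rV[R]_n -> R) K : C1 z -> C1field V phi ->
  compact K -> K `<=` V' -> (forall x, ~ K x -> z x = 0) ->
  C1field V' (fun x => z x *: phi x).
Proof.
move=> Cz [cp _] cK KV z0; split=> [j|].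
  by under eq_fun do rewrite mxE; exact: C1M.
by exists K; split => // x /z0 ->; rewrite scale0r.
Qed.

Lemma divintD V phi psi w : bmeas w -> C1field V phi -> C1field V psi ->
  divint w (fun x => phi x + psi x) = divint w phi + divint w psi.
Proof.
move=> bw fp fq; rewrite /divint -itgD; [|exact: (bcsupp_mul_div bw fp)|exact: (bcsupp_mul_div bw fq)].
congr itg; apply/funext => x; rewrite -mulrDr /div -big_split; congr (_ * _).
apply: eq_bigr => j _ /=; under eq_fun do rewrite mxE.
by rewrite deriveD//; [have [[] ] := C1field_C1c j fp|have [[] ] := C1field_C1c j fq].
Qed.

Lemma divint_cutoff V phi z w : bmeas w -> C1 z -> C1field V phi ->
  divint w phi = divint w (fun x => z x *: phi x) + divint w (fun x => (1 - z x) *: phi x).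
Proof.
move=> bw Cz fp.
have f1 : C1field V (fun x => z x *: phi x) by exact: C1fieldM.
have f2 : C1field V (fun x => (1 - z x) *: phi x).
  exact: (C1fieldM (C1B (C1_cst n 1) Cz) fp).
rewrite -(divintD bw f1 f2); congr (divint w); apply/funext => x.
by rewrite -scalerDl addrC subrK scale1r.
Qed.

Lemma divintDl V phi a b : bmeas a -> bmeas b -> C1field V phi ->
  divint (fun x => a x + b x) phi = divint a phi + divint b phi.
Proof.
move=> ba bb fp; rewrite /divint -itgD; [|exact: (bcsupp_mul_div ba fp)|exact: (bcsupp_mul_div bb fp)].
by congr itg; apply/funext => x; rewrite mulrDl.
Qed.

Lemma divintZl V phi a c : bmeas a -> C1field V phi ->
  divint (fun x => c * a x) phi = c * divint a phi.
Proof.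
move=> ba fp; rewrite /divint -itgZ; last exact: (bcsupp_mul_div ba fp).
by congr itg; apply/funext => x; rewrite mulrA.
Qed.

Lemma itg_div V phi : C1field V phi -> itg (div phi) = 0.
Proof.
move=> fp; rewrite itg_sum => [|j].
  rewrite big1// => j _; exact: itg_partial (C1field_C1c j fp).
exact: (C1c_partial_bcsupp j (C1field_C1c j fp)).
Qed.

Lemma divint_cst V phi c : C1field V phi -> divint (fun=> c) phi = 0.
Proof.
by move=> fp; rewrite /divint itgZ ?(itg_div fp) ?mulr0//; exact: bcsupp_div fp.
Qed.

Lemma C1fieldZ V phi c : C1field V phi -> C1field V (fun x => c *: phi x).
Proof. by apply: C1fieldM; exact: C1_cst. Qed.

Lemma divintZ V phi w c : bmeas w -> C1field V phi ->
  divint w (fun x => c *: phi x) = c * divint w phi.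
Proof.
move=> bw fp; rewrite /divint -itgZ; last exact: (bcsupp_mul_div bw fp).
congr itg; apply/funext => x; rewrite mulrCA; congr (_ * _).
rewrite /div mulr_sumr; apply: eq_bigr => j _; under eq_fun do rewrite mxE.
by rewrite deriveMl//; have [[]] := C1field_C1c j fp.
Qed.

Lemma divint_norm_le V phi w p c : bmeas w -> tvle w V p -> C1field V phi ->
  (forall x, enorm (phi x) <= c) -> divint w phi <= c * p.
Proof.
move=> bw wp fp pc; have c0 : 0 <= c by apply: le_trans (pc 0); exact: enorm_ge0.
have [c00|cn0] := eqVneq c 0.
  rewrite c00 mul0r (_ : phi = fun x => 0 *: phi x) ?(divintZ _ _ fp)// ?mul0r//.
  apply/funext => x; rewrite scale0r; apply: enorm_eq0; apply/eqP.
  by rewrite eq_le enorm_ge0 andbT -c00 pc.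
have cp : 0 < c by rewrite lt0r cn0.
have : divint w (fun x => c^-1 *: phi x) <= p.
  apply: wp; apply/admissibleP; split; first exact: C1fieldZ.
  by move=> x; rewrite enormZ gtr0_norm ?invr_gt0// ler_pdivrMl// mulr1.
by rewrite (divintZ _ bw fp) ler_pdivrMl.
Qed.

End Fields.

Opaque moll dmoll rho drho itg.

(** * Mollification in L^1 and mollified fields *)

Section MollificationL1.
Variables (R : realType) (n : nat).
Implicit Types (w : 'rV[R]_n -> R) (x v : 'rV[R]_n).

Lemma osc_small w (M eta : R) : bmeas w -> 0 < eta ->
  exists2 d : R, 0 < d & forall v, `|v| < d -> osc w v M <= eta.
Proof.
move=> bw eta0; apply: contrapT => Hn.
have /choice[v_ Hv] : forall k : nat, exists v, `|v| < k.+1%:R^-1 /\ eta < osc w v M.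
  move=> k; apply: contrapT => Hk; apply: Hn; exists k.+1%:R^-1; first by rewrite invr_gt0.
  by move=> v vk; rewrite leNgt; apply/negP => ?; apply: Hk; exists v.
have v0 : `|v_ k| @[k --> \oo] --> (0 : R).
  apply: (@squeeze0 _ _ (fun k => k.+1%:R^-1)); last exact: cvg_harmonic.
  by move=> k; have [/ltW vk _] := Hv k; rewrite normr_ge0.
have /cvgrPdist_lt/(_ eta eta0)[N _ HN] := tcont_bmeas bw M v0.
have := HN N (leqnn N); rewrite /= sub0r normrN ger0_norm ?osc_ge0//.
by have [_ /lt_trans H /H] := Hv N; rewrite ltxx.
Qed.

Lemma measurable_addr2 w : measurable_fun setT w ->
  measurable_fun setT (fun p : 'rV[R]_n * 'rV[R]_n => w (p.1 + p.2)).
Proof. by move=> mw; exact: (measurableT_comp mw (@measurable_add2 R n)). Qed.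

Lemma bmeas_translatel w x : bmeas w -> bmeas (fun v => w (x + v)).
Proof. by move=> bw; under eq_fun do rewrite addrC; exact: bmeas_translate. Qed.

Lemma moll_norm_le w e (B : R) x : 0 < e -> bmeas w -> (forall y, `|w y| <= B) ->
  `|moll e w x| <= B.
Proof.
move=> e0 bw wB.
have wB1 y : - B <= w y by have := wB y; rewrite ler_norml => /andP[].
have wB2 y : w y <= B by have := wB y; rewrite ler_norml => /andP[].
have H0 := @le_moll _ _ _ e0 _ _ x (bmeas_cst n (- B)) bw wB1.
have H1 := @le_moll _ _ _ e0 _ _ x bw (bmeas_cst n B) wB2.
by rewrite !moll_cst// in H0 H1; rewrite ler_norml; apply/andP.
Qed.

Lemma bmeas_moll w e : 0 < e -> bmeas w -> bmeas (moll e w).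
Proof.
move=> e0 bw; have [_ [B wB]] := bw; split; last by exists B => x; exact: moll_norm_le.
by apply: continuous_measurable_rV; apply: C1_continuous; exact: moll_C1.
Qed.

Lemma itg_kernelB (k : 'rV[R]_n -> R) w (c : R) : bcsupp k -> itg k = 1 -> bmeas w ->
  itg (fun v => k v * w v) - c = itg (fun v => k v * (w v - c)).
Proof.
move=> bk k1 bw; have bc := bcsuppZ c bk.
transitivity (itg (fun v => k v * w v) - itg (fun v => c * k v)).
  by rewrite (itgZ c bk) k1 mulr1.
by rewrite -(itgB (bcsuppMr bk bw) bc); congr itg; apply/funext => v; ring.
Qed.

Lemma moll_sub w x e : 0 < e -> bmeas w ->
  moll e w x - w x = itg (fun v => rho e v / rhoN n e * (w (x + v) - w x)).
Proof.
move=> e0 bw; rewrite (moll_shift e0 x bw).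
apply: (itg_kernelB (w x) _ (itg_rhoN _ e0) (bmeas_translatel x bw)).
by apply: bcsuppMr; [exact: bcsupp_rho|exact: bmeas_cst].
Qed.

(** [moll e w - w] is an average of the differences [w (x + v) - w x] over the support of the
    kernel; Fubini bounds its L^1 norm by an average of oscillations. *)
Lemma moll_L1_le w (M e eta : R) : 0 < e -> bmeas w ->
  (forall v, `|v| < e -> osc w v M <= eta) ->
  itg (fun x => `|moll e w x - w x| * \1_(cbox M) x) <= eta.
Proof.
move=> e0 bw He; have [mw [B wB]] := bw; have B0 : 0 <= B by apply: le_trans (wB 0).
have bN : bcsupp (fun v : 'rV[R]_n => rho e v / rhoN n e).
  by apply: bcsuppMr; [exact: bcsupp_rho|exact: bmeas_cst].
have [[mN [D ND]] [L NL]] := bN; have D0 : 0 <= D by apply: le_trans (ND 0).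
have N0 v : 0 <= rho e v / rhoN n e by rewrite divr_ge0 ?rho_ge0// ltW// rhoN_gt0.
pose F (p : 'rV[R]_n * 'rV[R]_n) :=
  rho e p.2 / rhoN n e * (`|w (p.1 + p.2) - w p.1| * \1_(cbox M) p.1).
have mF : measurable_fun setT F.
  apply: measurable_funM; first exact: (measurableT_comp mN).
  apply: measurable_funM.
    apply: measurableT_comp => //; apply: measurable_funB; first exact: measurable_addr2.
    exact: (measurableT_comp mw).
  have [[m1 _] _] : bcsupp (\1_(cbox M) : 'rV[R]_n -> R) by exact: bcsupp_cbox.
  exact: (measurableT_comp m1).
have i1 x : 0 <= (\1_(cbox M) x : R) <= 1.
  by rewrite indicE; case: (_ \in _); rewrite lexx ler01.
pose Q := Num.max (D * (B + B)) (Num.max M L).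
have FQ p : `|F p| <= Q.
  rewrite le_max; apply/orP; left; rewrite /F normrM ler_pM//.
  rewrite normrM normr_id (ger0_norm (proj1 (andP (i1 _)))).
  have [_ i1p] := andP (i1 p.1); apply: (le_trans (ler_piMr (normr_ge0 _) i1p)).
  by rewrite (le_trans (ler_normB _ _))// lerD.
have F0 x v : Q < `|x| \/ Q < `|v| -> F (x, v) = 0.
  rewrite /Q !gt_max => -[/andP[_ /andP[xM _]]|/andP[_ /andP[_ vL]]]; rewrite /F /=.
    rewrite indicE memNset ?mulr0//= => xM'.
    by have := lt_le_trans xM xM'; rewrite ltxx.
  by rewrite NL// mul0r.
have [b1 b2 E] := bcsupp_fubini mF FQ F0.
apply: (@le_trans _ _ (itg (fun x => itg (fun v => F (x, v))))).
  have bA : bcsupp (fun x => `|moll e w x - w x| * \1_(cbox M) x).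
    apply: (fun H => bcsuppMl (bcsupp_cbox n M) H); apply: bmeas_norm.
    exact: (bmeasB (bmeas_moll e0 bw) bw).
  apply: (le_itg bA b1).
  move=> x.
  have bFx : bcsupp (fun v => rho e v / rhoN n e * (w (x + v) - w x)).
    exact: (bcsuppMr bN (bmeasB (bmeas_translatel x bw) (bmeas_cst n (w x)))).
  rewrite (moll_sub x e0 bw).
  rewrite mulrC; apply: (le_trans (ler_wpM2l _ (le_norm_itg bFx))).
    by case/andP: (i1 x).
  rewrite -itgZ; last exact: bcsupp_norm.
  rewrite le_eqVlt; apply/orP; left; apply/eqP; congr itg; apply/funext => v.
  by rewrite /F /= normrM (ger0_norm (N0 v)); ring.
rewrite E (_ : eta = itg (fun v : 'rV[R]_n => eta * (rho e v / rhoN n e))); last first.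
  by rewrite (itgZ eta bN) (itg_rhoN n e0) mulr1.
have bEta : bcsupp (fun v => eta * (rho e v / rhoN n e)) by exact: bcsuppZ.
apply: (le_itg b2 bEta) => v; rewrite /F /= (itgZ _ (bcsupp_osc v M bw)).
rewrite -/(osc w v M) [leRHS]mulrC.
have [ve|ve] := ltP `|v| e; first exact: (ler_wpM2l (N0 v) (He v ve)).
have -> : rho e v / rhoN n e = 0.
  by rewrite (rho_out e0 (le_trans ve (mxnorm_le_enorm v))) mul0r.
by rewrite !mul0r.
Qed.

Lemma moll_L1 w (M eta : R) : bmeas w -> 0 < eta ->
  exists2 d : R, 0 < d & forall e, 0 < e <= d ->
    itg (fun x => `|moll e w x - w x| * \1_(cbox M) x) <= eta.
Proof.
move=> bw eta0; have [d d0 Hd] := osc_small M bw eta0; exists d => // e /andP[e0 ed].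
by apply: moll_L1_le => // v ve; apply: Hd; exact: lt_le_trans ed.
Qed.

End MollificationL1.

Section MollifiedFields.
Variables (R : realType) (n : nat).
Implicit Types (K V : set 'rV[R]_n) (x y : 'rV[R]_n) (w : 'rV[R]_n -> R)
  (phi psi : 'rV[R]_n -> 'rV[R]_n).

Lemma bcsuppM_cont (f g : 'rV[R]_n -> R) : continuous f -> bcsupp g ->
  bcsupp (fun x => f x * g x).
Proof.
move=> cf [[mg [B gB]] [M gM]].
have /compact_bounded[N [_ HN]] : compact (f @` cbox M).
  by apply: continuous_compact; [exact: continuous_subspaceT|exact: compact_cbox].
split; last by exists M => x /gM ->; rewrite mulr0.
split; first by apply: measurable_funM => //; exact: continuous_measurable_rV.
exists (Num.max 0 ((N + 1) * B)) => x; have [xM|xM] := leP `|x| M; last first.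
  by rewrite gM// mulr0 normr0 le_max lexx.
rewrite le_max normrM; apply/orP; right; apply: ler_pM => //.
by apply: (HN (N + 1)); [lra|exists x].
Qed.

Definition mollf e phi x : 'rV[R]_n := \row_j moll e (fun y => phi y 0 j) x.

(** The norm bound goes by duality: the product of a vector [u] of norm at most 1 with the mollified
    field is the mollification of a function that is at most 1. *)
Lemma mollf_admissible e phi K V : 0 < e -> (forall j, bmeas (fun y => phi y 0 j)) ->
  compact K -> (forall x, ~ K x -> phi x = 0) -> thick K e `<=` V ->
  (forall x, enorm (phi x) <= 1) -> admissible V (mollf e phi).
Proof.
move=> e0 bp cK p0 KV p1; apply/admissibleP; split; first split.
- move=> j; rewrite (_ : (fun y => _) = moll e (fun y => phi y 0 j)).
    exact: (moll_C1 e0 (bp j)).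
  by apply/funext => y; rewrite mxE.
- exists (thick K e); split => //; first exact: compact_thick.
  move=> x nK; apply/rowP => j; rewrite !mxE -[RHS](moll_cst e0 0 x).
  apply: (moll_local e0) => y yx; rewrite p0 ?mxE// => Ky; apply: nK; exists y => //.
  by rewrite distrC (le_trans (mxnorm_le_enorm _))// ltW.
move=> x; apply: enorm_le1P => u u1.
have -> : \sum_(i < n) u 0 i * mollf e phi x 0 i =
    moll e (fun y => \sum_(i < n) u 0 i * phi y 0 i) x.
  rewrite (moll_sum e0) => [|i]; last exact: (bmeasM (bmeas_cst n (u 0 i)) (bp i)).
  by apply: eq_bigr => i _; rewrite mxE (mollZ e0)//.
rewrite -[leRHS](moll_cst e0 1 x); apply: (le_moll e0).
- by apply: bmeas_sum => i; exact: (bmeasM (bmeas_cst n (u 0 i)) (bp i)).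
- exact: bmeas_cst.
move=> y; apply: (le_trans (cauchy_schwarz _ _)).
by rewrite -[leRHS]mulr1; apply: ler_pM => //; exact: enorm_ge0.
Qed.

(* Only the mollified field has to be C^1, so this applies to the merely
   continuous combination of two fields in [truncation_smooth]. *)
Lemma divint_mollf w e phi V : 0 < e -> bmeas w -> (forall j, bcsupp (fun y => phi y 0 j)) ->
  C1field V (mollf e phi) ->
  divint w (mollf e phi) = - \sum_(j < n) itg (fun x => 'D_(ev R j) (moll e w) x * phi x 0 j).
Proof.
move=> e0 bw bp fp; rewrite (divint_coord bw fp) -sumrN; apply: eq_bigr => j _.
have bpj := bcsupp_bmeas (bp j).
have E1 : (fun y => mollf e phi y 0 j) = moll e (fun y => phi y 0 j).
  by apply/funext => y; rewrite mxE.
have D1 x : 'D_(ev R j) (fun y => mollf e phi y 0 j) x = - dmoll e (ev R j) (fun y => phi y 0 j) x.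
  by rewrite E1 (derive_mollE e0 _ _ bpj).
have D2 x : 'D_(ev R j) (moll e w) x = - dmoll e (ev R j) w x.
  exact: (derive_mollE e0 _ _ bw).
have b1 : bcsupp (fun x => dmoll e (ev R j) w x * phi x 0 j).
  apply: (@bcsuppM_cont (dmoll e (ev R j) w) (fun y => phi y 0 j)); last exact: bp.
  exact: (continuous_dmoll e0 bw).
have b2 : bcsupp (fun x => w x * dmoll e (ev R j) (fun y => phi y 0 j) x).
  apply: (fun H => bcsuppMl H bw).
  have := bcsuppN (C1c_partial_bcsupp j (moll_C1c e0 (bp j))).
  by congr bcsupp; apply/funext => x; rewrite -E1 D1 opprK.
transitivity (- itg (fun x => w x * dmoll e (ev R j) (fun y => phi y 0 j) x)).
  by rewrite -(itgN b2); congr itg; apply/funext => x; rewrite D1 mulrN.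
rewrite -(dmoll_dual e0 (ev R j) bw (bp j)) -(opprK (itg _)) -(itgN b1); congr (- itg _).
by apply/funext => x; rewrite D2 mulNr.
Qed.

End MollifiedFields.

(** * Variation of truncated functions *)

Section SmoothTruncation.
Variables (R : realType) (n : nat).
Implicit Types (K V : set 'rV[R]_n) (x y : 'rV[R]_n) (w : 'rV[R]_n -> R)
  (phi psi : 'rV[R]_n -> 'rV[R]_n).

Lemma is_derive_pos_sqr (s : R) : is_derive s 1 (fun s => pos s ^+ 2) (2 * pos s).
Proof.
apply: (@quadratic_is_derive _ _ _ _ _ _ 1) => h _; rewrite mul1r.
have -> : h *: (1 : R) = h by rewrite /GRing.scale /= mulr1.
by rewrite (mulrC h); exact: pos_taylor.
Qed.

(** The mean of [pos] over [s - k, s]: it is C^1, and its slope [dsmoothpos] rises linearly from 0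
    to 1 on [0, k]. *)
Definition smoothpos (k s : R) : R := (pos s ^+ 2 - pos (s - k) ^+ 2) / (2 * k).

Definition dsmoothpos (k s : R) : R := (pos s - pos (s - k)) / k.

Lemma continuous_pos : continuous (@pos R).
Proof. by move=> s; apply: continuous_max; [move=> ?; exact: cvg_id|exact: cst_continuous]. Qed.

Lemma continuous_dsmoothpos k : continuous (dsmoothpos k).
Proof.
move=> s; apply: (@cvgM _ _ _ (nbhs_filter s)); last exact: cvg_cst.
apply: (@cvgB _ _ _ _ (nbhs_filter s)); first exact: continuous_pos.
apply: (@continuous_comp _ _ _ (fun s => s - k) (@pos R)); last exact: continuous_pos.
by apply: (@cvgB _ _ _ _ (nbhs_filter s)); [exact: cvg_id|exact: cvg_cst].
Qed.

Lemma is_derive_smoothpos k (s : R) : 0 < k -> is_derive s 1 (smoothpos k) (dsmoothpos k s).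
Proof.
move=> k0; have D1 := is_derive_pos_sqr s.
have D2 : is_derive s 1 (fun s => pos (s - k) ^+ 2) (2 * pos (s - k)).
  have DB : is_derive s 1 (fun s : R => s - k) 1 by rewrite -[X in is_derive _ _ _ X]subr0; exact: is_deriveB.
  have DC := is_derive_pos_sqr (s - k).
  have := @is_derive1_comp _ (fun s => pos s ^+ 2) (fun s => s - k) _ _ _ DC DB.
  by rewrite mulr1.
have D3 := is_deriveZ ((2 * k)^-1) (is_deriveB D1 D2).
have E : (2 * k)^-1 *: (2 * pos s - 2 * pos (s - k)) = dsmoothpos k s.
  by rewrite /dsmoothpos /GRing.scale /=; field; lra.
rewrite -E (_ : smoothpos k = (2 * k)^-1 \*: ((fun s => pos s ^+ 2) - (fun s => pos (s - k) ^+ 2)))//.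
by apply/funext => t; rewrite /smoothpos mulrC.
Qed.

Lemma dsmoothpos01 k s : 0 < k -> 0 <= dsmoothpos k s <= 1.
Proof.
move=> k0; rewrite /dsmoothpos; have : 0 <= pos s - pos (s - k) <= k.
  rewrite /pos; case: (leP s 0) => s0; case: (leP (s - k) 0) => sk; apply/andP; split; lra.
move=> /andP[H1 H2]; apply/andP; split; first by rewrite divr_ge0// ltW.
by rewrite ler_pdivrMr// mul1r.
Qed.

Lemma smoothpos_approx k s : 0 < k -> `|smoothpos k s - pos s| <= k.
Proof.
move=> k0; have k2 : 0 < 2 * k by lra.
have -> : smoothpos k s - pos s = (pos s ^+ 2 - pos (s - k) ^+ 2 - pos s * (2 * k)) / (2 * k).
  by rewrite /smoothpos; field; lra.
rewrite normrM normfV (gtr0_norm k2) ler_pdivrMr//.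
by rewrite /pos; case: (leP s 0) => s0; case: (leP (s - k) 0) => sk;
  rewrite ler_norml; apply/andP; split; nra.
Qed.

Lemma itg_parts (g t : 'rV[R]_n -> R) i : C1 g -> C1c t ->
  itg (fun x => g x * 'D_(ev R i) t x) = - itg (fun x => 'D_(ev R i) g x * t x).
Proof.
move=> Cg Ct; have cg := C1_continuous Cg.
have b1 : bcsupp (fun x => g x * 'D_(ev R i) t x).
  exact: (bcsuppM_cont cg (C1c_partial_bcsupp i Ct)).
have b2 : bcsupp (fun x => 'D_(ev R i) g x * t x).
  by apply: bcsuppM_cont; [have [_ ] := Cg; exact|exact: C1c_bcsupp].
apply/eqP; rewrite -addr_eq0 -(itgD b1 b2) -(itg_partial i (C1cMl Ct Cg)); apply/eqP.
congr itg; apply/funext => x; have [dg _] := Cg; have [[dt _] _] := Ct.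
by rewrite deriveM// /GRing.scale /= (mulrC (t x)).
Qed.

End SmoothTruncation.

Section Truncation.
Variables (R : realType) (n : nat).
Implicit Types (K V : set 'rV[R]_n) (x y : 'rV[R]_n) (w : 'rV[R]_n -> R)
  (phi psi : 'rV[R]_n -> 'rV[R]_n).

Lemma pos_norm_le (s : R) : `|pos s| <= `|s|.
Proof.
rewrite /pos; case: (leP s 0) => s0; first by rewrite normr0.
by [].
Qed.

Lemma bmeas_pos (f : 'rV[R]_n -> R) : bmeas f -> bmeas (fun x => pos (f x)).
Proof.
move=> [mf [B fB]]; split; last by exists B => x; exact: le_trans (pos_norm_le _) (fB x).
rewrite (_ : (fun x => _) = f \max cst 0).
  by apply: measurable_maxr => //; exact: measurable_cst.
by apply/funext => x; rewrite /pos.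
Qed.

Lemma bmeas_smoothpos (k : R) (f : 'rV[R]_n -> R) : bmeas f -> bmeas (fun x => smoothpos k (f x)).
Proof.
move=> bf; rewrite /smoothpos; have b1 := bmeas_pos bf.
have b2 := bmeas_pos (bmeasB bf (bmeas_cst n k)).
exact: (bmeasM (bmeasB (bmeasM b1 b1) (bmeasM b2 b2)) (bmeas_cst n _)).
Qed.

(* By the chain rule, testing [a - b] with [phi] and [b] with [psi] amounts to testing
   [a] with [(1 - c) phi + c psi], where [c] is the derivative of [smoothpos] at [a - m]. *)
Lemma truncation_smooth w V p e k m K phi psi : 0 < e -> 0 < k -> bmeas w -> tvle w V p ->
  admissible V phi -> admissible V psi -> compact K ->
  (forall x, ~ K x -> phi x = 0) -> (forall x, ~ K x -> psi x = 0) -> thick K e `<=` V ->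
  divint (fun x => moll e w x - smoothpos k (moll e w x - m)) phi +
  divint (fun x => smoothpos k (moll e w x - m)) psi <= p.
Proof.
move=> e0 k0 bw wp /admissibleP[fp np] /admissibleP[fq nq] cK p0 q0 KV.
pose a := moll e w; pose c x := dsmoothpos k (a x - m); pose b x := smoothpos k (a x - m).
have Ca : C1 a by exact: (moll_C1 e0 bw).
have Cam : C1 (fun x => a x - m) by exact: (C1B Ca (C1_cst n m)).
have Db s := is_derive_smoothpos s k0.
have Cb : C1 b by exact: (C1_comp Cam Db (@continuous_dsmoothpos R k)).
have Dbj j x : 'D_(ev R j) b x = c x * 'D_(ev R j) a x.
  have [dam _] := Cam; have [_ ->] := is_derive_comp1 (dam j x) (Db (a x - m)).
  by have [da _] := Ca; rewrite deriveB ?derive_cst ?subr0.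
have cc : continuous c.
  move=> x; apply: (@continuous_comp _ _ _ (fun x => a x - m) (dsmoothpos k)).
    exact: (C1_continuous Cam).
  exact: continuous_dsmoothpos.
have c01 x : 0 <= c x <= 1 by exact: dsmoothpos01.
have bc : bmeas c.
  split; first exact: continuous_measurable_rV.
  by exists 1 => x; have /andP[? ?] := c01 x; rewrite ger0_norm.
have ba : bmeas a by exact: bmeas_moll.
have bb : bmeas b by exact: (bmeas_smoothpos k (bmeasB ba (bmeas_cst n m))).
have Cp j := C1field_C1c j fp; have Cq j := C1field_C1c j fq.
pose th x : 'rV[R]_n := (1 - c x) *: phi x + c x *: psi x.
have bpj j := C1c_bcsupp (Cp j); have bqj j := C1c_bcsupp (Cq j).
have b1c : bmeas (fun x => 1 - c x) by exact: (bmeasB (bmeas_cst n 1) bc).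
have bth j : bcsupp (fun x => th x 0 j).
  rewrite (_ : (fun x => _) = (fun x => (1 - c x) * phi x 0 j + c x * psi x 0 j)).
    exact: (bcsuppD (bcsuppMl (bpj j) b1c) (bcsuppMl (bqj j) bc)).
  by apply/funext => x; rewrite !mxE.
have th0 x : ~ K x -> th x = 0.
  by move=> nK; rewrite /th p0// q0// !scaler0 addr0.
have nth x : enorm (th x) <= 1.
  have /andP[c0 c1] := c01 x; apply: (le_trans (enormD _ _)); rewrite !enormZ.
  rewrite (ger0_norm c0) ger0_norm ?subr_ge0//.
  have H1 : (1 - c x) * enorm (phi x) <= 1 - c x by rewrite ler_piMr ?subr_ge0.
  have H2 : c x * enorm (psi x) <= c x by rewrite ler_piMr.
  lra.
have bthj j := bcsupp_bmeas (bth j).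
have ath := mollf_admissible e0 bthj cK th0 KV nth.
have := wp _ ath; have /admissibleP[fth _] := ath.
rewrite (divint_mollf e0 bw bth fth); apply: le_trans.
rewrite (divint_coord (bmeasB ba bb) fp) (divint_coord bb fq) -big_split/= -sumrN.
rewrite le_eqVlt; apply/orP; left; apply/eqP; apply: eq_bigr => j _.
rewrite (itg_parts j (C1B Ca Cb) (Cp j)) (itg_parts j Cb (Cq j)) -opprD; congr (- _).
have cda : continuous ('D_(ev R j) a) by have [_ ] := Ca; exact.
have [_ cdab] := C1B Ca Cb; have [_ cdb] := Cb.
rewrite -(itgD (bcsuppM_cont (cdab j) (bpj j)) (bcsuppM_cont (cdb j) (bqj j))).
congr itg; apply/funext => x; have [da _] := Ca; have [db _] := Cb.
rewrite deriveB// Dbj !mxE; ring.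
Qed.

Lemma divint_dist V phi f g D M : bmeas f -> bmeas g -> C1field V phi ->
  (forall x, `|div phi x| <= D) -> (forall x, M < `|x| -> div phi x = 0) ->
  `|divint f phi - divint g phi| <= D * itg (fun x => `|f x - g x| * \1_(cbox M) x).
Proof.
move=> bf bg fp dD dM; have D0 : 0 <= D by apply: le_trans (dD 0).
have b1 := bcsupp_mul_div bf fp; have b2 := bcsupp_mul_div bg fp.
have b3 : bcsupp (fun x => `|f x - g x| * \1_(cbox M) x).
  exact: (bcsuppMl (bcsupp_cbox n M) (bmeas_norm (bmeasB bf bg))).
rewrite /divint -(itgB b1 b2) -(itgZ D b3).
apply: (le_trans (le_norm_itg (bcsuppB b1 b2))).
apply: (le_itg (bcsupp_norm (bcsuppB b1 b2)) (bcsuppZ D b3)) => x.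
rewrite -mulrBl normrM; have [xM|xM] := leP `|x| M.
  by rewrite indicE mem_set// mulr1 mulrC; apply: ler_wpM2r.
by rewrite dM// normr0 mulr0 mulr_ge0// mulr_ge0.
Qed.

Lemma pos_lip (s t : R) : `|pos s - pos t| <= `|s - t|.
Proof.
rewrite /pos; case: (leP s 0) => s0; case: (leP t 0) => t0; rewrite ?subrr ?normr0//.
- rewrite sub0r normrN gtr0_norm// ler0_norm; lra.
- rewrite subr0 gtr0_norm// ger0_norm; lra.
Qed.

Lemma truncation_error (D L A eta : R) : 0 <= D -> 0 <= L -> 0 < eta ->
  A <= eta / (8 * (D + 1)) ->
  D * (2 * A + eta / (4 * (D + 1) * (L + 1)) * L) +
  D * (1 * A + eta / (4 * (D + 1) * (L + 1)) * L) <= eta.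
Proof.
move=> D0 L0 eta0 Ae; set k := eta / (4 * (D + 1) * (L + 1)).
have k0 : 0 <= k by rewrite divr_ge0 ?(ltW eta0)// mulr_ge0 ?mulr_ge0//; lra.
have H1 : (D + 1) * A <= eta / 8.
  rewrite (_ : eta / 8 = (D + 1) * (eta / (8 * (D + 1)))); last by field; lra.
  by apply: ler_wpM2l Ae; lra.
have H2 : k * ((D + 1) * (L + 1)) = eta / 4 by rewrite /k; field; lra.
have [A0|A0] := leP 0 A.
  have : 0 <= k * D by exact: mulr_ge0.
  have : 0 <= k * L by exact: mulr_ge0.
  nra.
have : D * A <= 0 by rewrite mulr_ge0_le0// ltW.
have : 0 <= k * D by exact: mulr_ge0.
have : 0 <= k * L by exact: mulr_ge0.
nra.
Qed.

Lemma sum_close (X Y S T a b p eta : R) : `|X - S| <= a -> `|Y - T| <= b ->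
  a + b <= eta -> X + Y <= p -> S + T <= p + eta.
Proof. by rewrite !ler_norml => /andP[? _] /andP[? _] ? ?; lra. Qed.

(** The limit of [truncation_smooth] for vanishing mollification scale and smoothing parameter. That
    the two pieces may be tested by unrelated fields yields submodularity of the perimeter, with [w]
    a sum of two indicators, and the superadditivity behind the coarea argument, with [w] a clamped
    function. *)
Lemma tvle_truncation w V p m phi psi : open V -> bmeas w -> tvle w V p ->
  admissible V phi -> admissible V psi ->
  divint (fun x => w x - pos (w x - m)) phi + divint (fun x => pos (w x - m)) psi <= p.
Proof.
move=> oV bw wp ap aq; have /admissibleP[fp np] := ap; have /admissibleP[fq nq] := aq.
have [_ [K1 [cK1 KV1 p0]]] := fp; have [_ [K2 [cK2 KV2 q0]]] := fq.
pose K := K1 `|` K2; have cK : compact K by exact: compactU.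
have KV : K `<=` V by move=> x [/KV1|/KV2].
have pK x : ~ K x -> phi x = 0 by move=> nK; apply: p0 => ?; apply: nK; left.
have qK x : ~ K x -> psi x = 0 by move=> nK; apply: q0 => ?; apply: nK; right.
have [r r0 rV] := compact_thick_sub cK oV KV.
have [[_ [D1 pD]] _] := bcsupp_div fp; have [[_ [D2 qD]] _] := bcsupp_div fq.
have [M dM] := compact_far cK.
pose D := Num.max D1 D2.
have pD' x : `|div phi x| <= D by rewrite le_max pD.
have qD' x : `|div psi x| <= D by rewrite le_max qD orbT.
have D0 : 0 <= D by apply: le_trans (pD' 0).
have pM x : M < `|x| -> div phi x = 0 by move=> /dM; exact: (div_supp cK pK).
have qM x : M < `|x| -> div psi x = 0 by move=> /dM; exact: (div_supp cK qK).
apply/ler_addgt0Pr => eta eta0.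
pose L := itg (\1_(cbox M) : 'rV[R]_n -> R).
have L0 : 0 <= L by apply: itg_ge0.
(* [D] bounds both divergences and [L] is the volume of a cube containing the supports; [k] and
   [eta'] are chosen so that all errors add up to at most [eta] in [truncation_error]. *)
pose k := eta / (4 * (D + 1) * (L + 1)).
have k0 : 0 < k by rewrite divr_gt0// mulr_gt0// ?mulr_gt0//; lra.
pose eta' := eta / (8 * (D + 1)).
have eta'0 : 0 < eta' by rewrite divr_gt0// mulr_gt0//; lra.
have [d d0 Hd] := moll_L1 M bw eta'0.
pose e := Num.min d r.
have e0 : 0 < e by rewrite lt_min d0.
have Ae := Hd e; rewrite e0 ge_min lexx/= in Ae; move/(_ isT) in Ae.
set A := itg _ in Ae.
have eV : thick K e `<=` V.
  by apply: subset_trans rV; apply: thick_le; rewrite ge_min lexx orbT.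
have := truncation_smooth m e0 k0 bw wp ap aq cK pK qK eV.
set a := moll e w; pose b x := smoothpos k (a x - m).
have ba : bmeas a by exact: bmeas_moll.
have bpw : bmeas (fun x => pos (w x - m)) by exact: (bmeas_pos (bmeasB bw (bmeas_cst n m))).
have bb : bmeas b by exact: (bmeas_smoothpos k (bmeasB ba (bmeas_cst n m))).
have bA : bcsupp (fun x => `|a x - w x| * \1_(cbox M) x).
  exact: (bcsuppMl (bcsupp_cbox n M) (bmeas_norm (bmeasB ba bw))).
have bL := bcsupp_cbox n M : bcsupp (\1_(cbox M) : 'rV[R]_n -> R).
have est (f g : 'rV[R]_n -> R) c : bmeas f -> bmeas g ->
    (forall x, `|f x - g x| <= c * `|a x - w x| + k) ->
    itg (fun x => `|f x - g x| * \1_(cbox M) x) <= c * A + k * L.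
  move=> bf bg fg; rewrite /A /L -(itgZ c bA) -(itgZ k bL) -(itgD (bcsuppZ c bA) (bcsuppZ k bL)).
  apply: le_itg.
  - exact: (bcsuppMl bL (bmeas_norm (bmeasB bf bg))).
  - exact: (bcsuppD (bcsuppZ c bA) (bcsuppZ k bL)).
  by move=> x; rewrite mulrA -mulrDl; apply: ler_wpM2r.
have dist x : `|b x - pos (w x - m)| <= 1 * `|a x - w x| + k.
  have := smoothpos_approx (a x - m) k0; have := pos_lip (a x - m) (w x - m).
  rewrite (_ : a x - m - (w x - m) = a x - w x); last by ring.
  have := ler_distD (pos (a x - m)) (b x) (pos (w x - m)); rewrite -/(b x); lra.
have dist2 x : `|(a x - b x) - (w x - pos (w x - m))| <= 2 * `|a x - w x| + k.
  rewrite (_ : _ - _ = (a x - w x) - (b x - pos (w x - m))); last by ring.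
  have := ler_normB (a x - w x) (b x - pos (w x - m)); have := dist x; lra.
have E1 := est _ _ _ bb bpw dist.
have E2 := est _ _ _ (bmeasB ba bb) (bmeasB bw bpw) dist2.
have F1 := divint_dist bb bpw fq qD' qM.
have F2 := divint_dist (bmeasB ba bb) (bmeasB bw bpw) fp pD' pM.
have G1 := ler_wpM2l D0 E1; have G2 := ler_wpM2l D0 E2.
move: (divint _ phi) (divint _ psi) F1 F2.
move=> X Y F1 F2 XY.
exact: (sum_close (le_trans F2 G2) (le_trans F1 G1) (truncation_error D0 L0 eta0 Ae) XY).
Qed.

End Truncation.

(** * Bounds for the variation: comparison, gluing, submodularity *)

Section Variation.
Variables (R : realType) (n : nat).
Implicit Types (A B C K U V : set 'rV[R]_n) (x y v : 'rV[R]_n) (a b w : 'rV[R]_n -> R)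
  (phi psi : 'rV[R]_n -> 'rV[R]_n) (p q : R).

(* [tvge w V p] says that the variation of [w] in [V], possibly infinite, is at least [p]. *)
Definition tvge w V p : Prop :=
  forall eta : R, 0 < eta -> exists2 phi, admissible V phi & p - eta <= divint w phi.

Lemma tvge_tvle w V p q : tvge w V p -> tvle w V q -> p <= q.
Proof.
move=> wp wq; apply/ler_addgt0Pr => eta /wp[phi ap]; rewrite lerBlDr => H.
by apply: (le_trans H); rewrite lerD2r; exact: wq.
Qed.

(** Converse of [tvge_tvle]: a lower bound may be tested against arbitrary upper bounds, the form in
    which minimality is available. *)
Lemma tvge_of_tvle w V p : (forall q, tvle w V q -> p <= q) -> tvge w V p.
Proof.
move=> H eta eta0; apply: contrapT => Hn.
have /H : tvle w V (p - eta).
  move=> phi ap; rewrite leNgt; apply/negP => /ltW ?; apply: Hn.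
  by exists phi.
by rewrite leNgt => /negP; apply; rewrite ltrBlDr ltrDl.
Qed.

Lemma tvle_sub w V V' p : V' `<=` V -> tvle w V p -> tvle w V' p.
Proof. by move=> VV wp phi /(admissible_sub VV)/wp. Qed.

Lemma tvle_eq a b V p : (forall x, V x -> a x = b x) -> tvle a V p -> tvle b V p.
Proof.
move=> ab ap phi /[dup] /ap H /admissibleP[fp _].
by rewrite (@divint_eq _ _ V phi b a)// => x /ab.
Qed.

Lemma tvge_eq a b V p : (forall x, V x -> a x = b x) -> tvge a V p -> tvge b V p.
Proof.
move=> ab H; apply: tvge_of_tvle => q bq; apply: (tvge_tvle H).
by apply: tvle_eq bq => x /ab.
Qed.

Lemma admissible0 V : admissible V (fun=> 0 : 'rV[R]_n).
Proof.
apply/admissibleP; split; last by move=> x; rewrite enorm0.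
split=> [j|]; first by under eq_fun do rewrite mxE; exact: C1_cst.
by exists set0; split => //; exact: compact0.
Qed.

Lemma divint0 w : divint w (fun=> 0 : 'rV[R]_n) = 0.
Proof.
rewrite /divint -(itg0 R n); congr itg; apply/funext => x.
rewrite /div big1 ?mulr0// => j _.
by rewrite (_ : (fun y => _) = cst 0) ?derive_cst//; apply/funext => y; rewrite mxE.
Qed.

Lemma enorm_convex (c : R) x y : 0 <= c <= 1 -> enorm x <= 1 -> enorm y <= 1 ->
  enorm (c *: x + (1 - c) *: y) <= 1.
Proof.
move=> /andP[c0 c1] x1 y1; apply: (le_trans (enormD _ _)); rewrite !enormZ.
rewrite (ger0_norm c0) ger0_norm ?subr_ge0//.
have H1 : (1 - c) * enorm y <= 1 - c by rewrite ler_piMr ?subr_ge0.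
have H2 : c * enorm x <= c by rewrite ler_piMr.
lra.
Qed.

Lemma cutoff_field_exists C V : compact C -> open V -> C `<=` V ->
  exists z : 'rV[R]_n -> R, [/\ C1 z, forall x, 0 <= z x <= 1,
    forall U phi, C1field U phi -> C1field (U `&` V) (fun x => z x *: phi x) &
    forall U phi, C1field U phi -> C1field (U `\` C) (fun x => (1 - z x) *: phi x)].
Proof.
move=> cC oV CV; have [z [K' [Cz z01 [r r0 zr] [cK' KV'] z0]]] := cutoff_exists cC oV CV.
have C1z : C1 (fun x => 1 - z x) by exact: (C1B (C1_cst n 1) Cz).
exists z; split => // U phi [cp [K [cK KU p0]]].
- have [cq _] := @C1fieldM _ _ setT phi z Cz (conj cp (ex_intro _ K (And3 cK (@subsetT _ _) p0))).
  split => //; exists (K `&` K'); split.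
  + by apply: compact_closedI => //; exact: (compact_closed (@norm_hausdorff _ _)).
  + by move=> x [/KU ? /KV' ?].
  + move=> x /not_andP[/p0 ->|/z0 ->]; [exact: scaler0|exact: scale0r].
have [cq _] := @C1fieldM _ _ setT phi _ C1z (conj cp (ex_intro _ K (And3 cK (@subsetT _ _) p0))).
(* [z] equals 1 on [thick C r], so [1 - z] vanishes on a neighbourhood of [C], and the new support
   is a compact set disjoint from [C]. *)
split => //; exists (K `&` ~` interior (thick C r)); split.
- by apply: compact_closedI => //; apply: open_closedC; exact: open_interior.
- move=> x [Kx nI]; split; first exact: KU.
  move=> Cx; apply: nI; apply/nbhs_ballP; exists r => //= y.
  by rewrite -ball_normE /= distrC => /ltW ?; exists x.
- move=> x /not_andP[/p0 ->|/contrapT/interior_subset/zr ->]; first exact: scaler0.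
  by rewrite subrr scale0r.
Qed.

(* Given [phi] in [V] and an almost optimal [psi] for [b] in [U], glue them with a cutoff [z]
   both ways: [z phi + (1 - z) psi] tests [a] in [U] and [z psi + (1 - z) phi] tests [b] in [V]. *)
Lemma tvle_local a b C U V p q : bmeas a -> bmeas b -> compact C -> open V -> C `<=` V ->
  V `<=` U -> (forall x, ~ C x -> a x = b x) -> tvle a U p -> tvge b U p ->
  tvle b V q -> tvle a V q.
Proof.
move=> ba bb cC oV CV VU ab ap bp bq phi aphi; apply/ler_addgt0Pr => eta /bp[psi apsi Hpsi].
have [z [Cz z01 zV zC]] := cutoff_field_exists cC oV CV.
have /admissibleP[fphi nphi] := aphi; have /admissibleP[fpsi npsi] := apsi.
have f1 := zV _ _ fphi; have f2 := zC _ _ fphi; have f3 := zV _ _ fpsi; have f4 := zC _ _ fpsi.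
have sub1 : V `&` V `<=` V by move=> x [].
have sub2 : V `\` C `<=` V by move=> x [].
have sub3 : U `&` V `<=` V by move=> x [].
have sub4 : U `\` C `<=` U by move=> x [].
have H1 : divint a (fun x => z x *: phi x + (1 - z x) *: psi x) <= p.
  apply: ap; apply/admissibleP; split; last by move=> x; exact: enorm_convex.
  apply: C1fieldD; last exact: (C1field_sub sub4 f4).
  by apply: (C1field_sub VU); exact: (C1field_sub sub1 f1).
rewrite (divintD ba (C1field_sub VU (C1field_sub sub1 f1)) (C1field_sub sub4 f4)) in H1.
have H2 : divint b (fun x => z x *: psi x + (1 - z x) *: phi x) <= q.
  apply: bq; apply/admissibleP; split; last by move=> x; exact: enorm_convex.
  by apply: C1fieldD; [exact: (C1field_sub sub3 f3)|exact: (C1field_sub sub2 f2)].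
rewrite (divintD bb (C1field_sub sub3 f3) (C1field_sub sub2 f2)) in H2.
have E1 : divint a (fun x => (1 - z x) *: psi x) = divint b (fun x => (1 - z x) *: psi x).
  by apply: (divint_eq f4) => x [_ /ab].
have E2 : divint a (fun x => (1 - z x) *: phi x) = divint b (fun x => (1 - z x) *: phi x).
  by apply: (divint_eq f2) => x [_ /ab].
have S1 := divint_cutoff ba Cz fphi; have S2 := divint_cutoff bb Cz fpsi.
rewrite E1 in H1; rewrite E2 in S1; rewrite S2 in Hpsi; rewrite S1.
move: H1 H2 Hpsi; clear.
move: (divint a _) (divint b _) (divint b _) (divint b _) => ? ? ? ? ? ? ?; lra.
Qed.

(** A crude bound from a single cutoff; its purpose is that modified sets keep locally finite
    perimeter. *)
Lemma tvle_patch a b g C V V1 p q : bmeas a -> bmeas b -> bmeas g -> compact C -> open V1 ->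
  C `<=` V1 -> (forall x, ~ C x -> g x = a x) -> (forall x, V1 x -> g x = b x) ->
  tvle a V p -> tvle b V1 q -> tvle g V (p + q).
Proof.
move=> ba bb bg cC oV1 CV1 ga gb ap bq phi /admissibleP[fp np].
have [z [Cz z01 zV zC]] := cutoff_field_exists cC oV1 CV1.
have f1 := zV _ _ fp; have f2 := zC _ _ fp.
rewrite (divint_cutoff bg Cz fp) addrC; apply: lerD.
  rewrite (@divint_eq _ _ _ _ g a f2); last by move=> x [_ /ga].
  apply: ap; apply/admissibleP; split; first by apply: C1field_sub f2 => x [].
  move=> x; have /andP[? ?] := z01 x; rewrite enormZ ger0_norm ?subr_ge0//.
  by apply: mulr_ile1 => //; rewrite ?subr_ge0 ?enorm_ge0// lerBlDr lerDl.
rewrite (@divint_eq _ _ _ _ g b f1); last by move=> x [_ /gb].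
apply: bq; apply/admissibleP; split; first by apply: C1field_sub f1 => x [].
move=> x; have /andP[? ?] := z01 x; rewrite enormZ ger0_norm//.
by apply: mulr_ile1 => //; exact: enorm_ge0.
Qed.

(** Cutting [\1_A + \1_B] at level 1 leaves the indicator of the union below and that of the
    intersection above. *)
Lemma tvle_setUI A B V p q phi psi : open V -> measurable A -> measurable B ->
  tvle (\1_A) V p -> tvle (\1_B) V q -> admissible V phi -> admissible V psi ->
  divint (\1_(A `|` B)) phi + divint (\1_(A `&` B)) psi <= p + q.
Proof.
move=> oV mA mB Ap Bq aphi apsi.
have bA : bmeas (\1_A : 'rV[R]_n -> R) by exact: bmeas_indic.
have bB : bmeas (\1_B : 'rV[R]_n -> R) by exact: bmeas_indic.
have wpq : tvle (fun x => \1_A x + \1_B x) V (p + q).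
  move=> th ath; have /admissibleP[fth _] := ath.
  by rewrite (divintDl bA bB fth); apply: lerD; [exact: Ap|exact: Bq].
have := tvle_truncation 1 oV (bmeasD bA bB) wpq aphi apsi; apply: le_trans.
rewrite le_eqVlt; apply/orP; left; apply/eqP; congr (divint _ phi + divint _ psi);
  apply/funext => x; rewrite /pos !indicE ?in_setU ?in_setI;
  by case: (x \in A); case: (x \in B) => /=; case: leP => H; lra.
Qed.

End Variation.

(** * Translates, clamped functions and a coarea inequality *)

Section TranslationCoarea.
Variables (R : realType) (n : nat).
Implicit Types (A B C K U V : set 'rV[R]_n) (x y v u : 'rV[R]_n) (a b w : 'rV[R]_n -> R)
  (phi psi : 'rV[R]_n -> 'rV[R]_n) (p q : R).

Lemma derivable_translate (g : 'rV[R]_n -> R) u v x :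
  derivable g (x + v) u -> derivable (fun y => g (y + v)) x u.
Proof.
rewrite /derivable => H.
rewrite (_ : (fun h => _) = (fun h : R => h^-1 *: (g (h *: u + (x + v)) - g (x + v))))//.
by apply/funext => h; rewrite /= addrA.
Qed.

Lemma derive_translate (g : 'rV[R]_n -> R) u v x :
  'D_u (fun y => g (y + v)) x = 'D_u g (x + v).
Proof.
rewrite /derive.
rewrite (_ : (fun h => _) = (fun h : R => h^-1 *: (g (h *: u + (x + v)) - g (x + v))))//.
by apply/funext => h; rewrite /= addrA.
Qed.

Lemma C1_translate (g : 'rV[R]_n -> R) v : C1 g -> C1 (fun y => g (y + v)).
Proof.
move=> [dg cg]; split=> [i x|i]; first exact: derivable_translate.
under eq_fun do rewrite derive_translate.
by move=> x; apply: (@continuous_comp _ _ _ (fun x => x + v) ('D_(ev R i) g)); [exact: continuous_addr|exact: cg].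
Qed.

Lemma C1field_translate V phi v : C1field V phi ->
  C1field [set x | V (x + v)] (fun x => phi (x + v)).
Proof.
move=> [cp [K [cK KV p0]]]; split=> [j|]; first exact: (C1_translate v (cp j)).
exists ((fun x => x - v) @` K); split.
- apply: continuous_compact => //; apply: continuous_subspaceT; exact: continuous_addr.
- by move=> _ [y Ky <-] /=; rewrite subrK; exact: KV.
- by move=> x nK; apply: p0 => ?; apply: nK; exists (x + v) => //; rewrite addrK.
Qed.

Lemma divint_translate w V phi v : bmeas w -> C1field V phi ->
  divint (fun x => w (x + v)) phi = divint w (fun x => phi (x - v)).
Proof.
move=> bw fp; have fq := C1field_translate (- v) fp.
rewrite /divint -(itg_translate v (bcsupp_mul_div bw fq)); congr itg; apply/funext => x.
congr (_ * _); rewrite /div; apply: eq_bigr => j _.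
by rewrite (derive_translate (fun y => phi y 0 j)) addrK.
Qed.

Lemma tvle_translate w V p v : bmeas w -> tvle w V p ->
  tvle (fun x => w (x + v)) [set x | V (x + v)] p.
Proof.
move=> bw wp phi /admissibleP[fp np]; rewrite (divint_translate v bw fp).
apply: wp; apply/admissibleP; split; last by move=> x; exact: np.
by apply: C1field_sub (C1field_translate (- v) fp) => x /=; rewrite subrK.
Qed.

Lemma pos_ger (r : R) : 0 <= r -> pos r = r.
Proof. by move=> r0; apply: max_l. Qed.

Lemma pos_ler (r : R) : r <= 0 -> pos r = 0.
Proof. by move=> r0; apply: max_r. Qed.

Lemma pos_clamp (r s m t : R) : s <= m -> m <= t ->
  pos (pos (r - s) - pos (r - t) - (m - s)) = pos (r - m) - pos (r - t).
Proof.
move=> sm mt; have [rs|rs] := leP r s.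
  by rewrite (@pos_ler (r - s)) ?(@pos_ler (r - t)) ?(@pos_ler (r - m)) ?pos_ler; lra.
rewrite (@pos_ger (r - s)); last by lra.
have [rm|rm] := leP r m.
  by rewrite (@pos_ler (r - t)) ?(@pos_ler (r - m)) ?pos_ler; lra.
rewrite (@pos_ger (r - m)); last by lra.
have [rt|rt] := leP r t.
  by rewrite (@pos_ler (r - t)) ?pos_ger; lra.
by rewrite (@pos_ger (r - t)) ?pos_ger; lra.
Qed.

Lemma clamp01 (r s t : R) : s <= t -> 0 <= pos (r - s) - pos (r - t) <= t - s.
Proof.
move=> st; have [rs|rs] := leP r s.
  by rewrite (@pos_ler (r - s)) ?(@pos_ler (r - t)); lra.
rewrite (@pos_ger (r - s)); last by lra.
have [rt|rt] := leP r t; first by rewrite (@pos_ler (r - t)); lra.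
by rewrite (@pos_ger (r - t)); lra.
Qed.

(** [w] truncated to values in [s, t] and lowered by [s]; it carries the part of the variation of
    [w] between these levels. *)
Definition clamp w (s t : R) x : R := pos (w x - s) - pos (w x - t).

Lemma bmeas_clamp w s t : bmeas w -> bmeas (clamp w s t).
Proof.
by move=> bw; exact: (bmeasB (bmeas_pos (bmeasB bw (bmeas_cst n s))) (bmeas_pos (bmeasB bw (bmeas_cst n t)))).
Qed.

Lemma tvge_clamp w V (s m t : R) p q : open V -> bmeas w -> s <= m -> m <= t ->
  tvge (clamp w s m) V p -> tvge (clamp w m t) V q -> tvge (clamp w s t) V (p + q).
Proof.
move=> oV bw sm mt Hp Hq; apply: tvge_of_tvle => l wl.
apply/ler_addgt0Pr => eta eta0.
have [phi aphi Hphi] := Hp _ (divr_gt0 eta0 (ltr0n _ 2)).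
have [psi apsi Hpsi] := Hq _ (divr_gt0 eta0 (ltr0n _ 2)).
have := tvle_truncation (m - s) oV (bmeas_clamp s t bw) wl aphi apsi.
have -> : (fun x => clamp w s t x - pos (clamp w s t x - (m - s))) = clamp w s m.
  apply/funext => x; rewrite /clamp (pos_clamp _ sm mt); ring.
have -> : (fun x => pos (clamp w s t x - (m - s))) = clamp w m t.
  by apply/funext => x; rewrite /clamp (pos_clamp _ sm mt).
by move: Hphi Hpsi; move: (divint _ phi) (divint _ psi) => X Y ? ? ?; lra.
Qed.

(** The rescaled clamps take values in [0, 1], so pointwise convergence to an indicator lets an
    upper bound pass to the limit; the two one-sided estimates use this by contradiction. *)
Lemma clamp_limit w (P : set 'rV[R]_n) V phi (s_ t_ : nat -> R) (l : R) : bmeas w ->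
  measurable P -> C1field V phi -> (forall k, s_ k < t_ k) ->
  (forall x, \forall k \near \oo, (t_ k - s_ k)^-1 * clamp w (s_ k) (t_ k) x = \1_P x) ->
  (forall k, divint (clamp w (s_ k) (t_ k)) phi <= (t_ k - s_ k) * l) ->
  divint (\1_P : _ -> R) phi <= l.
Proof.
move=> bw mP fphi st Plim Hl.
have bf k : bmeas (fun x => (t_ k - s_ k)^-1 * clamp w (s_ k) (t_ k) x).
  exact: (bmeasM (bmeas_cst n _) (bmeas_clamp (s_ k) (t_ k) bw)).
have bP : bmeas (\1_P : 'rV[R]_n -> R) by exact: bmeas_indic.
have bd := bcsupp_div fphi.
have tk k : 0 < t_ k - s_ k by rewrite subr_gt0.
have bound k x : `|(t_ k - s_ k)^-1 * clamp w (s_ k) (t_ k) x * div phi x| <= `|div phi x|.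
  have /andP[c0 c1] := clamp01 (w x) (ltW (st k)).
  rewrite normrM; apply: ler_piMl => //.
  by rewrite normrM gtr0_norm ?invr_gt0// ler_pdivrMl// mulr1 ger0_norm.
have cv x : ((t_ k - s_ k)^-1 * clamp w (s_ k) (t_ k) x * div phi x) @[k --> \oo]
    --> (\1_P x * div phi x).
  by apply: cvgM; [apply: cvg_near_cst; exact: Plim|exact: cvg_cst].
have H := itg_dominated (fun k => (bcsupp_bmeas (bcsuppMl bd (bf k))).1)
  (bcsupp_bmeas (bcsuppMl bd bP)).1 (bcsupp_norm bd) cv bound.
apply: (cvg_le_cst H) => k.
rewrite -/(divint (fun x => (t_ k - s_ k)^-1 * clamp w (s_ k) (t_ k) x) phi).
by rewrite (divintZl _ (bmeas_clamp (s_ k) (t_ k) bw) fphi) ler_pdivrMl.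
Qed.

(** As [t] decreases to [s] the rescaled clamp tends to the indicator of the strict superlevel set,
    so one almost optimal field for that set serves all nearby [t]. *)
Lemma clamp_cvg_right w V p (s : R) (P : set 'rV[R]_n) : bmeas w -> measurable P ->
  (forall x, P x <-> s < w x) -> tvge (\1_P) V p -> forall eta : R, 0 < eta ->
  exists2 d : R, 0 < d & forall t, s < t < s + d ->
    tvge (clamp w s t) V ((t - s) * (p - eta)).
Proof.
move=> bw mP Pw Hp eta eta0; have [phi aphi Hphi] := Hp _ (divr_gt0 eta0 (ltr0n _ 2)).
have /admissibleP[fphi _] := aphi.
suff [d d0 Hd] : exists2 d : R, 0 < d & forall t, s < t < s + d ->
    (t - s) * (p - eta) <= divint (clamp w s t) phi.
  exists d => // t st e e0; exists phi => //; have := Hd t st; lra.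
apply: contrapT => Hn.
have /choice[t_ Ht] : forall k : nat, exists t, s < t < s + k.+1%:R^-1 /\
    divint (clamp w s t) phi < (t - s) * (p - eta).
  move=> k; apply: contrapT => Hk; apply: Hn; exists k.+1%:R^-1; first by rewrite invr_gt0.
  by move=> t st; rewrite leNgt; apply/negP => ?; apply: Hk; exists t.
have st k : s < t_ k by have [/andP[]] := Ht k.
suff : divint (\1_P : _ -> R) phi <= p - eta by move=> /(le_trans Hphi); lra.
apply: (clamp_limit bw mP fphi st) => [x|k]; last by have [_ /ltW] := Ht k.
have [Px|nPx] := pselect (P x); last first.
  have ws : w x <= s by rewrite leNgt; apply/negP => /Pw.
  rewrite indicE memNset//; apply: nearW => k; have := st k => ?.
  by rewrite /clamp !pos_ler ?subrr ?mulr0//; lra.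
have ws : s < w x by exact/Pw.
rewrite indicE mem_set//; near=> k; have := st k => ?.
have tw : t_ k < w x.
  have [/andP[_ H] _] := Ht k; apply: (lt_trans H); rewrite -ltrBrDl.
  near: k.
  have := @cvgr_lt _ _ _ _ _ _ (@cvg_harmonic R) (w x - s); apply; lra.
rewrite /clamp (@pos_ger (w x - s)); last by lra.
rewrite (@pos_ger (w x - t_ k)); last by lra.
by rewrite (_ : w x - s - (w x - t_ k) = t_ k - s) ?mulVf ?subr_eq0 ?gt_eqF//; ring.
Unshelve. all: by end_near. Qed.

(** From the left the limit is the indicator of the set where [t <= w x], which is why
    [tvge_superlevels] speaks of both kinds of superlevel sets. *)
Lemma clamp_cvg_left w V p (t : R) (P : set 'rV[R]_n) : bmeas w -> measurable P ->
  (forall x, P x <-> t <= w x) -> tvge (\1_P) V p -> forall eta : R, 0 < eta ->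
  exists2 d : R, 0 < d & forall s, t - d < s < t ->
    tvge (clamp w s t) V ((t - s) * (p - eta)).
Proof.
move=> bw mP Pw Hp eta eta0; have [phi aphi Hphi] := Hp _ (divr_gt0 eta0 (ltr0n _ 2)).
have /admissibleP[fphi _] := aphi.
suff [d d0 Hd] : exists2 d : R, 0 < d & forall s, t - d < s < t ->
    (t - s) * (p - eta) <= divint (clamp w s t) phi.
  exists d => // s st e e0; exists phi => //; have := Hd s st; lra.
apply: contrapT => Hn.
have /choice[s_ Hs] : forall k : nat, exists s, t - k.+1%:R^-1 < s < t /\
    divint (clamp w s t) phi < (t - s) * (p - eta).
  move=> k; apply: contrapT => Hk; apply: Hn; exists k.+1%:R^-1; first by rewrite invr_gt0.
  by move=> s st; rewrite leNgt; apply/negP => ?; apply: Hk; exists s.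
have st k : s_ k < t by have [/andP[]] := Hs k.
suff : divint (\1_P : _ -> R) phi <= p - eta by move=> /(le_trans Hphi); lra.
apply: (clamp_limit bw mP fphi st) => [x|k]; last by have [_ /ltW] := Hs k.
have [Px|nPx] := pselect (P x).
  have ws : t <= w x by exact/Pw.
  rewrite indicE mem_set//; apply: nearW => k; have := st k => ?.
  rewrite /clamp (@pos_ger (w x - s_ k)); last by lra.
  rewrite (@pos_ger (w x - t)); last by lra.
  by rewrite (_ : w x - s_ k - (w x - t) = t - s_ k) ?mulVf ?subr_eq0 ?gt_eqF//; ring.
have ws : w x < t by rewrite ltNge; apply/negP => /Pw.
rewrite indicE memNset//; near=> k.
have tw : w x < s_ k.
  have [/andP[H _] _] := Hs k; apply: lt_trans H; rewrite ltrBrDl -ltrBrDr.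
  near: k.
  have := @cvgr_lt _ _ _ _ _ _ (@cvg_harmonic R) (t - w x); apply; lra.
by have := st k => ?; rewrite /clamp !pos_ler ?subrr ?mulr0//; lra.
Unshelve. all: by end_near. Qed.

Lemma measurable_gt w s : measurable_fun setT w -> measurable [set x | s < w x].
Proof.
move=> mw; have := mw measurableT `]s, +oo[%classic (measurable_itv _); rewrite setTI.
by congr measurable; rewrite predeqE => x /=; rewrite in_itv/= andbT.
Qed.

Lemma measurable_ge w s : measurable_fun setT w -> measurable [set x | s <= w x].
Proof.
move=> mw; have := mw measurableT `[s, +oo[%classic (measurable_itv _); rewrite setTI.
by congr measurable; rewrite predeqE => x /=; rewrite in_itv/= andbT.
Qed.

(* Real induction: [sup S = 1], because the variation of [clamp w s t] is at least
   [(t - s) (p - eta)] as soon as [s] and [t] are close, and is superadditive in [s, t]. *)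
Lemma tvge_superlevels w V p : open V -> bmeas w -> (forall x, 0 <= w x <= 1) ->
  (forall s, 0 <= s < 1 -> tvge (\1_[set x | s < w x]) V p) ->
  (forall t, 0 < t <= 1 -> tvge (\1_[set x | t <= w x]) V p) ->
  tvge w V p.
Proof.
move=> oV bw w01 Hs Ht.
have [mw _] := bw.
have slack eta : 0 < eta -> tvge w V (p - eta).
  move=> eta0.
  pose S := [set t : R | 0 <= t <= 1 /\ tvge (clamp w 0 t) V (t * (p - eta))].
  have S0 : S 0.
    split; first by rewrite lexx ler01.
    rewrite mul0r => e e0; exists (fun=> 0); first exact: admissible0.
    by rewrite divint0 sub0r oppr_le0 ltW.
  have hS : has_sup S by split; [exists 0|exists 1 => t [/andP[]]].
  have T0 : 0 <= sup S by exact: sup_upper_bound.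
  have T1 : sup S <= 1 by apply: ge_sup => [|t [/andP[]]//]; exists 0.
  (* The supremum is attained: a level of [S] close below it is joined to it by the estimate from
     the left. *)
  have ST : S (sup S).
    have [T00|T0'] := eqVneq (sup S) 0; first by rewrite T00.
    have Tp : 0 < sup S by rewrite lt0r T0'.
    have Tp1 : 0 < sup S <= 1 by rewrite Tp.
    have [d d0 Hd] := clamp_cvg_left bw (measurable_ge (sup S) mw) (fun x => iff_refl _) (Ht _ Tp1) eta0.
    have [s [/andP[s0 s1] Ss] sT] := sup_adherent d0 hS.
    have : s <= sup S by apply: sup_upper_bound => //; split => //; apply/andP.
    rewrite le_eqVlt => /orP[/eqP <-|sT']; first by split => //; apply/andP.
    split; first by apply/andP.
    have Hc := Hd s; rewrite sT sT' in Hc; move/(_ isT) in Hc.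
    have := tvge_clamp oV bw s0 (ltW sT') Ss Hc.
    by rewrite -mulrDl addrC subrK.
  have TE1 : sup S = 1.
    apply/eqP; rewrite eq_le T1/= leNgt; apply/negP => Tlt.
    have T01 : 0 <= sup S < 1 by rewrite T0.
    have [d d0 Hd] := clamp_cvg_right bw (measurable_gt (sup S) mw) (fun x => iff_refl _) (Hs _ T01) eta0.
    (* A level beyond the supremum, within reach of the estimate from the right and still at most
       1. *)
    pose t := Num.min 1 (sup S + d / 2).
    have tT : sup S < t by rewrite lt_min Tlt ltrDl divr_gt0.
    have td : t < sup S + d by rewrite gt_min; apply/orP; right; lra.
    have Hc := Hd t; rewrite tT td in Hc; move/(_ isT) in Hc.
    have [_ HT] := ST; have := tvge_clamp oV bw T0 (ltW tT) HT Hc.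
    rewrite -mulrDl addrC subrK => St.
    have : S t by split => //; rewrite ge_min lexx andbT (le_trans T0)// ltW.
    by move=> /(sup_upper_bound hS); rewrite leNgt tT.
  have [_] := ST; rewrite TE1 mul1r; apply: tvge_eq => x _.
  have /andP[w0 w1] := w01 x.
  by rewrite /clamp pos_ger ?pos_ler ?subr0//; lra.
move=> eta eta0; have [phi aphi H] := slack _ (divr_gt0 eta0 (ltr0n _ 2)) _ (divr_gt0 eta0 (ltr0n _ 2)).
exists phi => //; apply: le_trans H; lra.
Qed.

End TranslationCoarea.

(** * Translates of E as competitors for F *)

Section LocalMinimality.
Variables (R : realType) (n : nat).
Implicit Types (A B C E F G K U V W : set 'rV[R]_n) (x y v u : 'rV[R]_n) (p q : R).

Lemma indist_ball V x y : `|y - x| < indist V x -> V y.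
Proof.
move=> yx; have [|r [_ Hr] rlt] := @sup_adherent R _ (indist V x - `|y - x|) _ (indist_has_sup V x).
  by rewrite subr_gt0.
by apply: Hr; apply: le_lt_trans rlt; rewrite -/(indist V x); lra.
Qed.

Definition lfp A : Prop := forall V, open V -> ebounded V -> exists p, tvle (\1_A : _ -> R) V p.

(** Minimality against one-sided Borel competitors that agree outside a compact set. That every
    upper bound for [G] is one for [E] expresses the inequality of perimeters without naming their
    values. *)
Definition sub_minimal E U : Prop := forall C G, compact C -> C `<=` U -> measurable G ->
  G `<=` E -> (forall x, ~ C x -> E x -> G x) -> lfp G ->
  forall q, tvle (\1_G : _ -> R) U q -> tvle (\1_E : _ -> R) U q.

Definition super_minimal F U : Prop := forall C G, compact C -> C `<=` U -> measurable G ->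
  F `<=` G -> (forall x, ~ C x -> G x -> F x) -> lfp G ->
  forall q, tvle (\1_G : _ -> R) U q -> tvle (\1_F : _ -> R) U q.

Lemma tv_exists (w : 'rV[R]_n -> R) V q : tvle w V q -> exists p, tvle w V p /\ tvge w V p.
Proof.
move=> wq; pose S := [set t : R | exists2 phi, admissible V phi & t = divint w phi].
have hS : has_sup S.
  split; first by exists (divint w (fun=> 0)); exists (fun=> 0) => //; exact: admissible0.
  by exists q => _ [phi /wq ? ->].
exists (sup S); split=> [phi ap|].
  by apply: sup_upper_bound => //; exists phi.
apply: tvge_of_tvle => p wp; apply: ge_sup; first by case: hS.
by move=> _ [phi /wp ? ->].
Qed.

Lemma indic_eq A B x y : (A x <-> B y) -> \1_A x = \1_B y :> R.
Proof.
move=> AB; rewrite !indicE; congr (_%:R); congr nat_of_bool.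
by apply/idP/idP; rewrite !inE => /AB.
Qed.

(** Minimality in [U] localizes to [V]: the sets agree outside [C], so the variation away from [C]
    cancels by [tvle_local]. The premise [lfp G] of the minimality comes from [tvle_patch]. *)
Lemma minimal_local A G C U V q : measurable A -> measurable G -> open U -> ebounded U ->
  lfp A -> compact C -> open V -> C `<=` V -> V `<=` U -> (forall x, ~ C x -> (A x <-> G x)) ->
  (lfp G -> forall q', tvle (\1_G : _ -> R) U q' -> tvle (\1_A : _ -> R) U q') ->
  tvle (\1_G : _ -> R) V q -> tvle (\1_A : _ -> R) V q.
Proof.
move=> mA mG oU bU fA cC oV CV VU AG minA Gq.
have bA : bmeas (\1_A : 'rV[R]_n -> R) by exact: bmeas_indic.
have bG : bmeas (\1_G : 'rV[R]_n -> R) by exact: bmeas_indic.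
have AG1 x : ~ C x -> \1_A x = \1_G x :> R by move=> /AG ?; exact: indic_eq.
have fG : lfp G.
  move=> V' oV' bV'; have [p Ap] := fA V' oV' bV'.
  exists (p + q); apply: (tvle_patch bA bG bG cC oV CV) Ap Gq => // x /AG1 -> //.
have [p' Ap'] := fA U oU bU; have [p [Ap pA]] := tv_exists Ap'.
apply: (tvle_local bA bG cC oV CV VU AG1 Ap) Gq.
apply: tvge_of_tvle => q' Gq'; exact: (tvge_tvle pA (minA fG _ Gq')).
Qed.

Lemma translate_minimal E F U W C v q : measurable E -> measurable F -> open U -> ebounded U ->
  lfp E -> sub_minimal E U -> compact C -> open W -> C `<=` W ->
  (forall x, W x -> U (x + v)) -> (forall x, W x -> ~ C x -> E (x + v) -> F x) ->
  tvle (\1_(F `&` [set x | E (x + v)]) : _ -> R) W q ->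
  tvle (\1_[set x | E (x + v)] : _ -> R) W q.
Proof.
move=> mE mF oU bU fE sE cC oW CW WU WCEF Hq.
have mtr A u : measurable A -> measurable [set x | A (x + u)].
  by move=> mA; have := @measurable_addr R n u measurableT A mA; rewrite setTI.
pose Fm := [set x | F (x - v)]; pose Wm := [set x | W (x - v)].
pose Cm : set 'rV[R]_n := [set x | C (x - v)].
have cCm : compact Cm.
  have -> : Cm = (fun x => x + v) @` C.
    rewrite predeqE => x; split=> [Cx|[y Cy <-]]; last by rewrite /Cm /= addrK.
    by exists (x - v) => //; rewrite subrK.
  by apply: continuous_compact => //; apply: continuous_subspaceT; exact: continuous_addr.
have mFm : measurable Fm by exact: mtr.
have mCm : measurable Cm by exact: compact_measurable_rV.
(* The competitor, moved by [v]: from [E] the points of [Cm] outside [F + v] are removed. It equals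
   [E] off [Cm], and moved back it agrees in [W] with the intersection of [F] and [E - v]. *)
pose G := E `&` (Fm `|` ~` Cm).
have mG : measurable G.
  by apply: measurableI => //; apply: measurableU => //; exact: measurableC.
have oWm : open Wm.
  have /continuousP/(_ _ oW) := @continuous_addr R n (- v); exact.
have CWm : Cm `<=` Wm by move=> x /CW.
have WmU : Wm `<=` U by move=> x /WU; rewrite subrK.
have bI : bmeas (\1_(F `&` [set x | E (x + v)]) : 'rV[R]_n -> R).
  by apply: bmeas_indic; apply: measurableI => //; exact: mtr.
have Gq : tvle (\1_G : _ -> R) Wm q.
  have H1 := @tvle_translate _ _ _ _ _ (- v) bI Hq.
  apply: (@tvle_eq _ _ _ _ _ _ _ H1) => x Wx.
  apply: indic_eq; rewrite /G /= subrK; split=> [[Fx Ex]|[Ex [Fx|nCx]]] //; first by split => //; left.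
  by split => //; apply: (WCEF (x - v)) => //; rewrite subrK.
have EG x : ~ Cm x -> (E x <-> G x).
  by move=> nC; split=> [Ex|[]//]; split => //; right.
have Eq : tvle (\1_E : _ -> R) Wm q.
  apply: (minimal_local mE mG oU bU fE cCm oWm CWm WmU EG) Gq.
  move=> fG q'; apply: (sE Cm G) => //.
  - by move=> x /CWm /WmU.
  - by move=> x [].
  - by move=> x /EG [].
have bE : bmeas (\1_E : 'rV[R]_n -> R) by exact: bmeas_indic.
have := @tvle_translate _ _ _ _ _ v bE Eq; rewrite /Wm /=.
rewrite (_ : [set x | W (x + v - v)] = W); last by rewrite predeqE => x /=; rewrite addrK.
by move=> H; apply: (@tvle_eq _ _ _ _ _ _ _ H) => x _; exact: indic_eq.
Qed.

Lemma union_translate_tvle E F U W C v p : measurable E -> measurable F -> open U -> ebounded U ->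
  lfp E -> sub_minimal E U -> compact C -> open W -> C `<=` W -> 
  (forall x, W x -> U (x + v)) -> (forall x, W x -> ~ C x -> E (x + v) -> F x) ->
  tvle (\1_F : _ -> R) W p ->
  tvle (\1_(F `|` (C `&` [set x | E (x + v)])) : _ -> R) W p.
Proof.
move=> mE mF oU bU fE sE cC oW CW WU WCEF Fp.
have mEv : measurable [set x | E (x + v)].
  by have := @measurable_addr R n v measurableT E mE; rewrite setTI.
have bE : bmeas (\1_E : 'rV[R]_n -> R) by exact: bmeas_indic.
have [pE Ep] := fE U oU bU.
have Evp : tvle (\1_[set x | E (x + v)] : _ -> R) W pE.
  apply: tvle_sub (@tvle_translate _ _ _ _ _ v bE Ep) => x; exact: WU.
have [pv [Evpv pvEv]] := tv_exists Evp.
move=> phi aphi; have /admissibleP[fphi _] := aphi.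
rewrite (@divint_eq _ _ _ _ _ (\1_(F `|` [set x | E (x + v)])) fphi); last first.
  move=> x Wx; apply: indic_eq; split=> [[Fx|[_ Ex]]|[Fx|Ex]]; [by left|by right|by left|].
  by have [Cx|nCx] := pselect (C x); [right|left; exact: WCEF].
(* For fixed [phi], submodularity bounds the variation of the intersection; minimality makes this a
   bound for the translate, whose variation is exactly [pv], and [pv] cancels. *)
have H : tvle (\1_(F `&` [set x | E (x + v)]) : _ -> R) W
    (p + pv - divint (\1_(F `|` [set x | E (x + v)])) phi).
  by move=> psi apsi; rewrite lerBrDl; exact: (tvle_setUI oW mF mEv Fp Evpv aphi apsi).
have := tvge_tvle pvEv (translate_minimal mE mF oU bU fE sE cC oW CW WU WCEF H).
lra.
Qed.

Lemma superset_tvge F U W C P p : measurable F -> measurable P -> open U -> ebounded U ->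
  lfp F -> super_minimal F U -> compact C -> open W -> C `<=` W -> W `<=` U ->
  F `<=` P -> (forall x, ~ C x -> P x -> F x) -> tvge (\1_F : _ -> R) W p ->
  tvge (\1_P : _ -> R) W p.
Proof.
move=> mF mP oU bU fF sF cC oW CW WU FP PF pF.
apply: tvge_of_tvle => q Pq; apply: (tvge_tvle pF).
apply: (minimal_local mF mP oU bU fF cC oW CW WU) Pq.
  by move=> x nC; split=> [/FP //|]; exact: PF.
move=> fP q'; apply: (sF C P) => //.
by move=> x /CW /WU.
Qed.

End LocalMinimality.

(** [s] is the value of the new field near the point, [a] and [b] are the near and far parts of the
    almost optimal field, and [i] bounds [a]: what replaces the near part cannot gain more than
    it. *)
Lemma defect_arith (R : realType) (s b p a i eta : R) :
  s + b <= p -> a <= i -> p - eta <= a + b -> s <= i + eta.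
Proof. by move=> ? ? ?; lra. Qed.

Lemma continuous_enorm_row (R : realType) n m (g : 'I_m -> 'rV[R]_n -> R) :
  (forall j, continuous (g j)) -> continuous (fun x => enorm (\row_j g j x)).
Proof.
move=> cg x; rewrite /enorm.
under eq_fun do under eq_bigr do rewrite mxE.
apply: (@continuous_comp _ _ _ (fun x => \sum_(i < m) g i x ^+ 2) (@Num.sqrt R)).
  move: x; apply: continuous_sum => i x.
  apply: (@continuous_comp _ _ _ (g i) (fun z : R => z ^+ 2)); first exact: cg.
  exact: exprn_continuous.
exact: sqrt_continuous.
Qed.

(** * The averaged competitor and its gradient inequality *)

Section KernelAverage.
Variables (R : realType) (n : nat) (E F C W : set 'rV[R]_n) (p d : R).
Hypotheses (mE : measurable E) (mF : measurable F) (cC : compact C) (oW : open W).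
Hypothesis CW : C `<=` W.
Hypothesis unionp : forall v : 'rV[R]_n, `|v| < d ->
  tvle (\1_(F `|` (C `&` [set x | E (x + v)])) : _ -> R) W p.
Hypothesis superp : forall P, measurable P -> F `<=` P -> (forall x, ~ C x -> P x -> F x) ->
  tvge (\1_P : _ -> R) W p.
Implicit Types (x y v u : 'rV[R]_n) (k : 'rV[R]_n -> R) (phi : 'rV[R]_n -> 'rV[R]_n).

Let fv v x : R := \1_(F `|` (C `&` [set x | E (x + v)])) x.

Let mC : measurable C. Proof. exact: compact_measurable_rV. Qed.

Let fvE v x : fv v x = \1_F x + (1 - \1_F x) * \1_C x * \1_E (x + v).
Proof.
rewrite /fv (@indic_eq _ _ E [set x | E (x + v)] (x + v) x)//.
by rewrite !indicE in_setU in_setI; case: (x \in F); case: (x \in C);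
  case: (x \in [set x | E (x + v)]) => /=; ring.
Qed.

Let indic01 (A : set 'rV[R]_n) x : 0 <= (\1_A x : R) <= 1.
Proof. by rewrite indicE; case: (_ \in _); rewrite lexx ler01. Qed.

Let bfv v : bmeas (fv v).
Proof.
apply: bmeas_indic; apply: measurableU => //; apply: measurableI => //.
by have := @measurable_addr R n v measurableT E mE; rewrite setTI.
Qed.

Let mfv2 : measurable_fun setT (fun z : 'rV[R]_n * 'rV[R]_n => fv z.2 z.1).
Proof.
rewrite (_ : (fun z => _) = (fun z => \1_F z.1 + (1 - \1_F z.1) * \1_C z.1 * \1_E (z.1 + z.2))).
  have m1 A : measurable A -> measurable_fun setT (fun z : 'rV[R]_n * 'rV[R]_n => \1_A z.1 : R).
    by move=> mA; have [mA' _] : bmeas (\1_A : _ -> R) := bmeas_indic mA; exact: (measurableT_comp mA').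
  apply: measurable_funD; first exact: m1.
  apply: measurable_funM; last first.
    have [mE' _] : bmeas (\1_E : _ -> R) := bmeas_indic mE.
    exact: (measurableT_comp mE' (@measurable_add2 R n)).
  apply: measurable_funM; last exact: m1.
  by apply: measurable_funB => //; exact: m1.
by apply/funext => z; rewrite fvE.
Qed.

Let bfvr x : bmeas (fv^~ x).
Proof.
split; first exact: (measurableT_comp mfv2 (@pair1_measurable _ _ _ _ x)).
by exists 1 => v; have /andP[? ?] := indic01 (F `|` (C `&` [set x | E (x + v)])) x; rewrite ger0_norm.
Qed.

Let mix k x : R := itg (fun v => k v * fv v x).

Let mix_fubini_bc k (D : 'rV[R]_n -> R) : bcsupp k -> bcsupp D ->
  [/\ bcsupp (fun x => mix k x * D x), bcsupp (fun v => k v * itg (fun x => fv v x * D x)) &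
  itg (fun x => mix k x * D x) = itg (fun v => k v * itg (fun x => fv v x * D x))].
Proof.
move=> bk bD; have [[mk [B kB]] [M kM]] := bk; have [[mD [B' DB]] [M' DM]] := bD.
have B0 : 0 <= B by apply: le_trans (kB 0).
have B'0 : 0 <= B' by apply: le_trans (DB 0).
pose H (z : 'rV[R]_n * 'rV[R]_n) := k z.2 * fv z.2 z.1 * D z.1.
have mH : measurable_fun setT H.
  apply: measurable_funM; last exact: (measurableT_comp mD).
  by apply: measurable_funM => //; exact: (measurableT_comp mk).
pose Q := Num.max (B * 1 * B') (Num.max M M').
have HQ z : `|H z| <= Q.
  have fv1 : `|fv z.2 z.1| <= 1.
    have /andP[? ?] := indic01 (F `|` (C `&` [set x | E (x + z.2)])) z.1.
    by rewrite ger0_norm.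
  rewrite le_max; apply/orP; left; rewrite /H !normrM.
  have H1 := ler_pM (normr_ge0 _) (normr_ge0 _) (kB z.2) fv1.
  by apply: (ler_pM _ _ H1 (DB z.1)) => //; rewrite mulr_ge0.
have H0 x v : Q < `|x| \/ Q < `|v| -> H (x, v) = 0.
  rewrite /Q !gt_max => -[/andP[_ /andP[_ xM]]|/andP[_ /andP[vM _]]]; rewrite /H /=.
    by rewrite DM// mulr0.
  by rewrite kM// !mul0r.
have [b1 b2 EE] := bcsupp_fubini mH HQ H0.
have E1 : (fun x => mix k x * D x) = (fun x => itg (fun v => H (x, v))).
  apply/funext => x; rewrite /mix mulrC -(itgZ _ (bcsuppMr bk (bfvr x))); congr itg.
  by apply/funext => v; rewrite mulrC.
have E2 : (fun v => k v * itg (fun x => fv v x * D x)) = (fun v => itg (fun x => H (x, v))).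
  apply/funext => v; rewrite -(itgZ _ (bcsuppMl bD (bfv v))); congr itg.
  by apply/funext => x; rewrite mulrA.
by rewrite E1 E2.
Qed.

Let mix_out k x : ~ C x -> bcsupp k -> mix k x = itg k * \1_F x.
Proof.
move=> nC bk; rewrite /mix mulrC -(itgZ _ bk); congr itg; apply/funext => v.
by rewrite fvE [\1_C x]indicE memNset// mulr0 mul0r addr0 mulrC.
Qed.

Let bmeas_mix k : bcsupp k -> bmeas (mix k).
Proof.
move=> bk; have [M CM] := compact_far cC.
have [b1 _ _] := mix_fubini_bc bk (bcsupp_cbox n M).
(* Fubini gives measurability only against a factor of bounded support; outside a cube containing
   [C] the average is a multiple of [\1_F]. *)
have -> : mix k = (fun x => mix k x * \1_(cbox M) x + itg k * \1_F x * (1 - \1_(cbox M) x)).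
  apply/funext => x; have [xM|xM] := leP `|x| M.
    by rewrite [\1_(cbox M) x]indicE mem_set// mulr1 subrr mulr0 addr0.
  rewrite [\1_(cbox M) x]indicE memNset ?mulr0 ?subr0 ?mulr1 ?add0r.
    by apply: mix_out => //; exact: CM.
  by rewrite /cbox /= => /(lt_le_trans xM); rewrite ltxx.
apply: (bmeasD (bcsupp_bmeas b1)).
have bF : bmeas (\1_F : 'rV[R]_n -> R) by exact: bmeas_indic.
exact: (bmeasM (bmeasM (bmeas_cst n (itg k)) bF) (bmeasB (bmeas_cst n 1) (bcsupp_bmeas (bcsupp_cbox n M)))).
Qed.

Variable r : 'rV[R]_n -> R.
Hypotheses (br : bcsupp r) (r0 : forall v, 0 <= r v) (r1 : itg r = 1).
Hypothesis rd : forall v, d <= `|v| -> r v = 0.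

Let mix01 x : 0 <= mix r x <= 1.
Proof.
have fv01 v : 0 <= fv v x <= 1 by exact: indic01.
apply/andP; split.
  by apply: itg_ge0 => v; rewrite mulr_ge0//; have /andP[] := fv01 v.
rewrite -r1; apply: (le_itg (bcsuppMr br (bfvr x)) br) => v.
by rewrite ler_piMr//; have /andP[] := fv01 v.
Qed.

Let mixF x : F x -> mix r x = 1.
Proof.
move=> Fx; rewrite -r1; congr itg; apply/funext => v.
by rewrite fvE [\1_F x]indicE mem_set// subrr !mul0r addr0 mulr1.
Qed.

(** The average is 1 on [F] and equals [\1_F] off [C], so [superp] applies to each superlevel
    set. *)
Let mix_tvge : tvge (mix r) W p.
Proof.
have bm := bmeas_mix br; have [mm _] := bm.
apply: tvge_superlevels => // [s /andP[s0 s1]|t /andP[t0 t1]]; apply: superp.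
- exact: measurable_gt.
- by move=> x /mixF /= ->.
- move=> x nC /=; rewrite (mix_out nC br) r1 mul1r indicE => sx; apply: contrapT => nF.
  by move: sx; rewrite memNset//= ltNge s0.
- exact: measurable_ge.
- by move=> x /mixF /= ->.
- move=> x nC /=; rewrite (mix_out nC br) r1 mul1r indicE => sx; apply: contrapT => nF.
  by move: sx; rewrite memNset//= leNgt t0.
Qed.

Variable kv : 'I_n -> 'rV[R]_n -> R.
Hypothesis bk : forall j, bcsupp (kv j).
Hypothesis kr : forall v, enorm (\row_j kv j v) <= r v.
Variable O : set 'rV[R]_n.
Hypotheses (oO : open O) (OC : O `<=` C) (OF : forall x, O x -> ~ F x).

Let f x : R := itg (fun v => r v * \1_E (x + v)).
Let q j x : R := itg (fun v => kv j v * \1_E (x + v)).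
Hypothesis Cf : C1 f.
Hypothesis Cq : forall j, C1 (q j).

Let mixO k x : O x -> mix k x = itg (fun v => k v * \1_E (x + v)).
Proof.
move=> Ox; congr itg; apply/funext => v.
have E1 : \1_F x = 0 :> R by rewrite indicE memNset//; exact: OF.
have E2 : \1_C x = 1 :> R by rewrite indicE mem_set//; exact: OC.
by rewrite fvE E1 E2 add0r subr0 !mul1r.
Qed.

Let field_le z phi v : C1 z -> (forall x, 0 <= z x <= 1) -> bsupp z ->
    C1field W (fun x => z x *: \row_j kv j v) -> admissible W phi ->
    C1field W (fun x => (1 - z x) *: phi x) ->
  \sum_j kv j v * itg (fun x => fv v x * 'D_(ev R j) z x) +
    r v * divint (fv v) (fun x => (1 - z x) *: phi x) <= r v * p.
Proof.
move=> Cz z01 sz f1 /admissibleP[fphi nphi] f2.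
have E1 : \sum_j kv j v * itg (fun x => fv v x * 'D_(ev R j) z x) =
    divint (fv v) (fun x => z x *: \row_j kv j v).
  rewrite (divint_coord (bfv v) f1); apply: eq_bigr => j _.
  have bz : bcsupp (fun x => fv v x * 'D_(ev R j) z x).
    exact: (bcsuppMl (C1c_partial_bcsupp j (conj Cz sz)) (bfv v)).
  rewrite -(itgZ _ bz); congr itg; apply/funext => x.
  rewrite (_ : (fun y => _) = (fun y => kv j v * z y)); last first.
    by apply/funext => y; rewrite !mxE mulrC.
  by have [dz _] := Cz; rewrite deriveMl// mulrCA.
rewrite E1 -(divintZ (r v) (bfv v) f2) -(divintD (bfv v) f1 (C1fieldZ (r v) f2)).
have nle x : enorm (z x *: (\row_j kv j v) + r v *: ((1 - z x) *: phi x)) <= r v.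
  have /andP[z0 z1] := z01 x.
  apply: (le_trans (enormD _ _)); rewrite !enormZ (ger0_norm z0) (ger0_norm (r0 v)).
  rewrite ger0_norm ?subr_ge0//.
  have H1 : z x * enorm (\row_j kv j v) <= z x * r v by exact: ler_wpM2l.
  have H2 : r v * ((1 - z x) * enorm (phi x)) <= r v * (1 - z x).
    by rewrite ler_wpM2l// ler_piMr// subr_ge0.
  apply: (le_trans (lerD H1 H2)).
  by rewrite le_eqVlt; apply/orP; left; apply/eqP; ring.
have [vd|vd] := ltP `|v| d.
  apply: (divint_norm_le (bfv v) (unionp vd)) => //.
  by apply: C1fieldD => //; exact: C1fieldZ.
(* For |v| >= d no bound on the competitor is available, but there [r v = 0] forces the whole field
   to vanish. *)
rewrite (rd vd) mul0r (_ : (fun x => _) = fun=> 0) ?divint0//.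
by apply/funext => x; apply: enorm_eq0; apply/eqP; rewrite eq_le enorm_ge0 andbT -(rd vd) nle.
Qed.

(* The fields [z kv(v) + r(v) (1 - z) phi] test the sets [F u (C n (E - v))], and [phi] is almost
   optimal for their average [mix r]. *)
Let grad_le z K : C1 z -> (forall x, 0 <= z x <= 1) -> compact K -> K `<=` O ->
    (forall x, ~ K x -> z x = 0) ->
  \sum_j itg (fun x => q j x * 'D_(ev R j) z x) <=
  itg (fun x => enorm (\row_j 'D_(ev R j) f x) * z x).
Proof.
move=> Cz z01 cK KO z0; apply/ler_addgt0Pr => eta /mix_tvge[phi aphi Hphi].
have /admissibleP[fphi nphi] := aphi.
have sz : bsupp z by exact: (compact_bsupp cK z0).
have Cz1 : C1 (fun x => 1 - z x) by exact: (C1B (C1_cst n 1) Cz).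
have OW : O `<=` W by move=> x /OC /CW.
have fk v : C1field W (fun x => z x *: \row_j kv j v).
  split=> [j|]; last by exists K; split => // [x /KO /OW//|x /z0 ->]; rewrite scale0r.
  rewrite (_ : (fun y => _) = (fun y => z y * kv j v)).
    exact: (C1M Cz (C1_cst n (kv j v))).
  by apply/funext => y; rewrite !mxE.
have f2 : C1field W (fun x => (1 - z x) *: phi x) by exact: C1fieldM.
have f1 : C1field O (fun x => z x *: phi x) by exact: (C1field_cutoff Cz fphi cK KO z0).
have bzj j := C1c_partial_bcsupp j (conj Cz sz).
have bm := bmeas_mix br.
have [_ bI EI] := mix_fubini_bc br (bcsupp_div f2).
have HI j := mix_fubini_bc (bk j) (bzj j).
have S1 : \sum_j itg (fun x => mix (kv j) x * 'D_(ev R j) z x) +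
    divint (mix r) (fun x => (1 - z x) *: phi x) <= p.
  rewrite /divint EI.
  rewrite (eq_bigr (fun j => itg (fun v => kv j v * itg (fun x => fv v x * 'D_(ev R j) z x)))); last first.
    by move=> j _; have [_ _ ->] := HI j.
  rewrite -itg_sum; last by move=> j; have [] := HI j.
  have bS : bcsupp (fun v => \sum_j kv j v * itg (fun x => fv v x * 'D_(ev R j) z x)).
    by apply: bcsupp_sum => j; have [] := HI j.
  rewrite -(itgD bS bI) (_ : p = itg (fun v => p * r v)); last by rewrite (itgZ _ br) r1 mulr1.
  apply: (le_itg (bcsuppD bS bI) (bcsuppZ p br)) => v.
  rewrite [leRHS]mulrC; exact: (field_le Cz z01 sz (fk v) aphi f2).
have S2 := divint_cutoff bm Cz fphi.
have E3 : \sum_j itg (fun x => q j x * 'D_(ev R j) z x) =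
    \sum_j itg (fun x => mix (kv j) x * 'D_(ev R j) z x).
  apply: eq_bigr => j _; congr itg; apply/funext => x.
  have [Kx|nK] := pselect (K x); first by rewrite mixO//; exact: KO.
  by rewrite (derive_supp (ev R j) cK z0 nK) !mulr0.
have [bf0 cf0] : bmeas f /\ continuous f.
  split; last exact: C1_continuous.
  split; first by apply: continuous_measurable_rV; exact: C1_continuous.
  have bE x : bmeas (fun v => \1_E (x + v) : R) by apply: (@bmeas_translatel _ _ (\1_E)); exact: bmeas_indic.
  exists 1 => x; have e01 y := indic01 E y; rewrite ger0_norm.
    rewrite -r1; apply: (le_itg (bcsuppMr br (bE x)) br) => v.
    by rewrite ler_piMr//; have /andP[] := e01 (x + v).
  by apply: itg_ge0 => v; rewrite mulr_ge0//; have /andP[] := e01 (x + v).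
have S3 : divint (mix r) (fun x => z x *: phi x) <=
    itg (fun x => enorm (\row_j 'D_(ev R j) f x) * z x).
  rewrite (@divint_eq _ _ _ _ _ f f1); last by move=> x; exact: mixO.
  rewrite (divint_coord bf0 f1).
  have Cj j := C1field_C1c j f1; have [df cdf] := Cf.
  have bj j : bcsupp (fun x => 'D_(ev R j) f x * (z x *: phi x) 0 j).
    exact: (bcsuppM_cont (cdf j) (C1c_bcsupp (Cj j))).
  rewrite (eq_bigr (fun j => - itg (fun x => 'D_(ev R j) f x * (z x *: phi x) 0 j))); last first.
    by move=> j _; exact: (itg_parts j Cf (Cj j)).
  rewrite sumrN -(itg_sum _ bj) -(itgN (bcsupp_sum _ bj)).
  apply: le_itg.
  - exact: (bcsuppN (bcsupp_sum _ bj)).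
  - by apply: bcsuppM_cont; [exact: continuous_enorm_row|exact: (C1c_bcsupp (conj Cz sz))].
  move=> x.
  rewrite (_ : - _ = \sum_j (\row_j 'D_(ev R j) f x) 0 j * (- (z x *: phi x)) 0 j); last first.
    by rewrite -sumrN; apply: eq_bigr => j _; rewrite !mxE mulrN.
  apply: (le_trans (cauchy_schwarz _ _)); apply: ler_wpM2l; first exact: enorm_ge0.
  have /andP[z00 z11] := z01 x.
  by rewrite enormN enormZ (ger0_norm z00) ler_piMr.
rewrite E3; apply: (defect_arith S1 S3); rewrite -S2; exact: Hphi.
Qed.

(** Localization of [grad_le]: after integration by parts the density is continuous, and a negative
    value at [x0] would be detected by a cutoff concentrated there. *)
Lemma kernel_gradient x0 : O x0 ->
  0 <= enorm (\row_j 'D_(ev R j) f x0) + \sum_j 'D_(ev R j) (q j) x0.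
Proof.
move=> Ox0; pose h x := enorm (\row_j 'D_(ev R j) f x) + \sum_j 'D_(ev R j) (q j) x.
have ch : continuous h.
  move=> x; apply: (@cvgD _ _ _ _ (nbhs_filter x)).
    by apply: continuous_enorm_row; have [] := Cf.
  by move: x; apply: continuous_sum => j; have [_ cq] := Cq j; exact: cq.
rewrite -/(h x0) leNgt; apply/negP => h0.
have [r' r'0 Hr] := (continuous_rVP _ _).1 (ch x0) (- h x0 / 2) ltac:(lra).
pose V := [set x | `|x - x0| < r'] `&` O.
have oV : open V.
  apply: openI => //; rewrite (_ : [set x | _] = ball x0 r'); first exact: ball_open.
  by rewrite -ball_normE predeqE => x /=; rewrite distrC.
have hV x : V x -> h x < 0 
  by move=> [/Hr H _]; move: H h0; move: (h x) (h x0) => a b; rewrite ler_norml => /andP[_ ?] ?; lra.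
have x0V : [set x0] `<=` V by move=> _ ->; split => //=; rewrite subrr normr0.
have [z [K [Cz z01 [s s0 zs] [cK KV] z0]]] := cutoff_exists (@compact_set1 _ x0) oV x0V.
have KO : K `<=` O by move=> x /KV[].
have := grad_le Cz z01 cK KO z0.
have sz : bsupp z by exact: (compact_bsupp cK z0).
have bz := C1c_bcsupp (conj Cz sz); have cz := C1_continuous Cz.
rewrite (eq_bigr (fun j => - itg (fun x => 'D_(ev R j) (q j) x * z x))); last first.
  by move=> j _; exact: (itg_parts j (Cq j) (conj Cz sz)).
have bj j : bcsupp (fun x => 'D_(ev R j) (q j) x * z x).
  by apply: bcsuppM_cont => //; have [_ cq] := Cq j; exact: cq.
have bg : bcsupp (fun x => enorm (\row_j 'D_(ev R j) f x) * z x).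
  by apply: bcsuppM_cont => //; apply: continuous_enorm_row; have [] := Cf.
rewrite sumrN -(itg_sum _ bj) -subr_ge0 opprK -(itgD bg (bcsupp_sum _ bj)).
have -> : (fun x => enorm (\row_j 'D_(ev R j) f x) * z x +
   \sum_j 'D_(ev R j) (q j) x * z x) = (fun x => h x * z x).
  by apply/funext => x; rewrite /h mulrDl mulr_suml.
have bh : bcsupp (fun x => - (h x * z x)).
  by apply: bcsuppN; exact: bcsuppM_cont.
have bh' : bcsupp (fun x => h x * z x) by exact: bcsuppM_cont.
have : 0 < itg (fun x => - (h x * z x)).
  apply: (@itg_gt0 _ _ _ x0 bh).
  - move=> x; have /andP[z1 _] := z01 x; have [Kx|nK] := pselect (K x); last first.
      by rewrite z0// mulr0 oppr0.
    by rewrite -mulNr; apply: mulr_ge0 => //; rewrite oppr_ge0; exact/ltW/hV/KV.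
  - apply: (@cvgN _ _ _ _ (nbhs_filter x0)).
    by apply: (@cvgM _ _ _ (nbhs_filter x0)); [exact: ch|exact: cz].
  - rewrite (zs x0) ?mulr1 ?oppr_gt0//.
    by exists x0 => //; rewrite subrr normr0 ltW.
by rewrite (itgN bh') oppr_gt0 => /lt_le_trans H /H; rewrite ltxx.
Qed.

End KernelAverage.

(** * The common direction of the gradients *)

Section GradientDirection.
Variables (R : realType) (n : nat).
Implicit Types (x y v u a : 'rV[R]_n) (w g : 'rV[R]_n -> R).

Definition dot u v : R := \sum_(i < n) u 0 i * v 0 i.

Definition grad g x : 'rV[R]_n := \row_j 'D_(ev R j) g x.

Lemma dotvv u : dot u u = enorm u ^+ 2.
Proof. by rewrite enorm_sqr; apply: eq_bigr => i _; rewrite expr2. Qed.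

Lemma dotDl u v y : dot (u + v) y = dot u y + dot v y.
Proof. by rewrite /dot -big_split; apply: eq_bigr => i _; rewrite mxE mulrDl. Qed.

Lemma dotC u v : dot u v = dot v u.
Proof. by apply: eq_bigr => i _; rewrite mulrC. Qed.

Lemma dotZl (c : R) u v : dot (c *: u) v = c * dot u v.
Proof. by rewrite /dot mulr_sumr; apply: eq_bigr => i _; rewrite mxE mulrA. Qed.

Lemma dotDr u v y : dot y (u + v) = dot y u + dot y v.
Proof. by rewrite dotC dotDl !(dotC y). Qed.

Lemma dotZr (c : R) u v : dot u (c *: v) = c * dot u v.
Proof. by rewrite dotC dotZl dotC. Qed.

Lemma dotBr u v y : dot y (u - v) = dot y u - dot y v.
Proof. by rewrite dotDr -scaleN1r dotZr mulN1r. Qed.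

Lemma dot0l u : dot 0 u = 0.
Proof. by rewrite /dot big1// => i _; rewrite mxE mul0r. Qed.

Lemma enormB_sqr u v : enorm (u - v) ^+ 2 = enorm u ^+ 2 + enorm v ^+ 2 - 2 * dot u v.
Proof.
rewrite !enorm_sqr /dot mulr_sumr -big_split -sumrB /=.
by apply: eq_bigr => i _; rewrite !mxE; ring.
Qed.

(** The squared norm of [enorm v *: u - enorm u *: v] is 2 |u| |v| (|u| |v| - u.v), and squaring the
    hypothesis gives |u| |v| <= u.v. *)
Lemma enorm_parallel u v : enorm u + enorm v <= enorm (u + v) ->
  enorm v *: u = enorm u *: v.
Proof.
move=> H; have U0 := enorm_ge0 u; have V0 := enorm_ge0 v.
have : (enorm u + enorm v) ^+ 2 <= enorm (u + v) ^+ 2.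
  by rewrite ler_pXn2r ?nnegrE ?addr_ge0 ?enorm_ge0.
rewrite -(dotvv (u + v)) dotDl !dotDr !dotvv (dotC v u) => H2.
have D : enorm u * enorm v <= dot u v by nra.
apply/eqP; rewrite -subr_eq0; apply/eqP; apply: enorm_eq0; apply/eqP.
rewrite -sqrf_eq0 eq_le sqr_ge0 andbT enormB_sqr !enormZ dotZl dotZr !ger0_norm//.
have : 0 <= (enorm u * enorm v) * (dot u v - enorm u * enorm v).
  by rewrite mulr_ge0 ?mulr_ge0// subr_ge0.
by move: (enorm u) (enorm v) (dot u v) => x y d; lra.
Qed.

Definition mker (e : R) v : R := rho e v / rhoN n e.

Lemma mker_ge0 e v : 0 < e -> 0 <= mker e v.
Proof. by move=> e0; rewrite /mker divr_ge0 ?rho_ge0// ltW// rhoN_gt0. Qed.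

Lemma bcsupp_mker e a : 0 < e -> bcsupp (fun v => mker e (v - a)).
Proof.
move=> e0; apply: (@bcsupp_translate _ _ (mker e) (- a)).
by apply: bcsuppMr; [exact: bcsupp_rho|exact: bmeas_cst].
Qed.

Lemma itg_mker e a : 0 < e -> itg (fun v => mker e (v - a)) = 1.
Proof.
move=> e0; rewrite -(itg_rhoN n e0) (@itg_translate _ _ (mker e) (- a))//.
by apply: bcsuppMr; [exact: bcsupp_rho|exact: bmeas_cst].
Qed.

Lemma mker_out e a v d : 0 < e -> e + enorm a <= d -> d <= `|v| -> mker e (v - a) = 0.
Proof.
move=> e0 ea dv; rewrite /mker (rho_out e0) ?mul0r//.
have := enormD (v - a) a; rewrite subrK; have := mxnorm_le_enorm v; lra.
Qed.

(** A kernel centred at [a] produces the mollification at [x + a], so gradients at different points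
    near [x0] can be compared in one inequality at [x0]. *)
Lemma moll_translate e w a x : 0 < e -> bmeas w ->
  itg (fun v => mker e (v - a) * w (x + v)) = moll e w (x + a).
Proof.
move=> e0 bw; rewrite (moll_shift e0 _ bw).
rewrite -(@itg_translate _ _ (fun v => mker e (v - a) * w (x + v)) a).
  by congr itg; apply/funext => v; rewrite addrK /mker addrA (addrAC x).
exact: (bcsuppMr (bcsupp_mker a e0) (bmeas_translatel x bw)).
Qed.

End GradientDirection.

Lemma gradE (R : realType) n (g : 'rV[R]_n -> R) x j : grad g x 0 j = 'D_(ev R j) g x.
Proof. exact: mxE. Qed.

Opaque grad.

Lemma half_sum (R : realType) (c1 c2 X Y : R) : (c1 * X + c2 * Y) / 2 = c1 / 2 * X + c2 / 2 * Y.
Proof. by ring. Qed.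

Lemma derive_half_sum (R : realType) n (c1 c2 : R) (g1 g2 : 'rV[R]_n -> R) (x u : 'rV[R]_n) :
  derivable g1 x u -> derivable g2 x u ->
  'D_u (fun x => c1 / 2 * g1 x + c2 / 2 * g2 x) x = (c1 * 'D_u g1 x + c2 * 'D_u g2 x) / 2.
Proof.
move=> d1 d2.
have e1 : derivable (fun x => c1 / 2 * g1 x) x u.
  exact: (derivableM (@derivable_cst R _ _ (c1 / 2) x u) d1).
have e2 : derivable (fun x => c2 / 2 * g2 x) x u.
  exact: (derivableM (@derivable_cst R _ _ (c2 / 2) x u) d2).
by rewrite deriveD// (deriveMl _ d1) (deriveMl _ d2) half_sum.
Qed.

Section MonotoneMollification.
Variables (R : realType) (n : nat) (E F C W : set 'rV[R]_n) (p d : R).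
Hypotheses (mE : measurable E) (mF : measurable F) (cC : compact C) (oW : open W).
Hypothesis CW : C `<=` W.
Hypothesis unionp : forall v : 'rV[R]_n, `|v| < d ->
  tvle (\1_(F `|` (C `&` [set x | E (x + v)])) : _ -> R) W p.
Hypothesis superp : forall P, measurable P -> F `<=` P -> (forall x, ~ C x -> P x -> F x) ->
  tvge (\1_P : _ -> R) W p.
Variables (O : set 'rV[R]_n) (x0 : 'rV[R]_n).
Hypotheses (oO : open O) (OC : O `<=` C) (OF : forall x, O x -> ~ F x) (Ox0 : O x0).
Implicit Types (x y v u a : 'rV[R]_n) (e : R).

Let bE : bmeas (\1_E : 'rV[R]_n -> R). Proof. exact: bmeas_indic. Qed.

Let G e : 'rV[R]_n -> R := moll e \1_E.

Let CG e a : 0 < e -> C1 (fun x => G e (x + a)).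
Proof. by move=> e0; exact: (C1_translate a (moll_C1 e0 bE)). Qed.

Let half_comb (c1 c2 : R) (k1 k2 w : 'rV[R]_n -> R) : bcsupp k1 -> bcsupp k2 -> bmeas w ->
  itg (fun v => (c1 * k1 v + c2 * k2 v) / 2 * w v) =
  (c1 * itg (fun v => k1 v * w v) + c2 * itg (fun v => k2 v * w v)) / 2.
Proof.
move=> b1 b2 bw; have B1 := bcsuppMr b1 bw; have B2 := bcsuppMr b2 bw.
rewrite -(itgZ c1 B1) -(itgZ c2 B2) -(itgD (bcsuppZ c1 B1) (bcsuppZ c2 B2)).
rewrite mulrC -(itgZ 2^-1 (bcsuppD (bcsuppZ c1 B1) (bcsuppZ c2 B2))).
by congr itg; apply/funext => v; ring.
Qed.

(** [kernel_gradient] with [r] the half sum of two mollifiers centred at [a1] and [a2], and with the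
    vector kernel that weights them by [u1] and [u2]; the common factor 1/2 drops out. *)
Lemma two_gradients e1 e2 a1 a2 u1 u2 g1 g2 : 0 < e1 -> 0 < e2 ->
  e1 + enorm a1 <= d -> e2 + enorm a2 <= d -> enorm u1 <= 1 -> enorm u2 <= 1 ->
  g1 = grad (G e1) (x0 + a1) -> g2 = grad (G e2) (x0 + a2) ->
  0 <= enorm (g1 + g2) + (dot u1 g1 + dot u2 g2).
Proof.
move=> e10 e20 ea1 ea2 nu1 nu2 Eg1 Eg2.
pose k1 v := mker e1 (v - a1); pose k2 v := mker e2 (v - a2).
have b1 : bcsupp k1 by exact: bcsupp_mker.
have b2 : bcsupp k2 by exact: bcsupp_mker.
pose r v := (1 * k1 v + 1 * k2 v) / 2.
pose kv (j : 'I_n) v := (u1 0 j * k1 v + u2 0 j * k2 v) / 2.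
have bcomb c1 c2 : bcsupp (fun v => (c1 * k1 v + c2 * k2 v) / 2).
  exact: (bcsuppMr (bcsuppD (bcsuppZ c1 b1) (bcsuppZ c2 b2)) (bmeas_cst n 2^-1)).
have k10 v : 0 <= k1 v by exact: mker_ge0.
have k20 v : 0 <= k2 v by exact: mker_ge0.
have r0 v : 0 <= r v by rewrite divr_ge0// !mul1r addr_ge0.
have r1 : itg r = 1.
  have := half_comb 1 1 b1 b2 (bmeas_cst n 1).
  rewrite (_ : (fun v => _) = r); last by apply/funext => v; rewrite mulr1.
  move=> ->; rewrite (_ : (fun v => k1 v * 1) = k1); last by apply/funext => v; rewrite mulr1.
  rewrite (_ : (fun v => k2 v * 1) = k2); last by apply/funext => v; rewrite mulr1.
  by rewrite (itg_mker a1 e10) (itg_mker a2 e20); field.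
have rd v : d <= `|v| -> r v = 0.
  move=> dv; rewrite /r /k1 /k2 (mker_out e10 ea1 dv) (mker_out e20 ea2 dv).
  by rewrite !mulr0 addr0 mul0r.
have kr v : enorm (\row_j kv j v) <= r v.
  have -> : \row_j kv j v = 2^-1 *: (k1 v *: u1 + k2 v *: u2).
    by apply/rowP => j; rewrite !mxE /kv; ring.
  rewrite enormZ /r mulrC ger0_norm ?invr_ge0//; apply: ler_wpM2r; first by rewrite invr_ge0.
  apply: (le_trans (enormD _ _)); rewrite !enormZ !mul1r (ger0_norm (k10 v)) (ger0_norm (k20 v)).
  by apply: lerD; rewrite ler_piMr.
have comb c1 c2 : (fun x => itg (fun v => (c1 * k1 v + c2 * k2 v) / 2 * \1_E (x + v))) =
    (fun x => c1 / 2 * G e1 (x + a1) + c2 / 2 * G e2 (x + a2)).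
  apply/funext => x; rewrite (half_comb c1 c2 b1 b2 (bmeas_translatel x bE)).
  by rewrite /k1 /k2 (moll_translate a1 x e10 bE) (moll_translate a2 x e20 bE) half_sum.
have Ccomb c1 c2 : C1 (fun x => c1 / 2 * G e1 (x + a1) + c2 / 2 * G e2 (x + a2)).
  exact: (C1D (C1M (C1_cst n (c1 / 2)) (CG a1 e10)) (C1M (C1_cst n (c2 / 2)) (CG a2 e20))).
have Dcomb c1 c2 j : 'D_(ev R j) (fun x => c1 / 2 * G e1 (x + a1) + c2 / 2 * G e2 (x + a2)) x0 =
    (c1 * g1 0 j + c2 * g2 0 j) / 2.
  rewrite Eg1 Eg2.
  have [d1 _] := CG a1 e10; have [d2 _] := CG a2 e20.
  have T1 := derive_translate (G e1) (ev R j) a1 x0.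
  have T2 := derive_translate (G e2) (ev R j) a2 x0.
  apply: (etrans (derive_half_sum c1 c2 (d1 j x0) (d2 j x0))).
  exact: (congr2 (fun a b : R => (c1 * a + c2 * b) / 2)
    (etrans T1 (esym (gradE (G e1) _ j))) (etrans T2 (esym (gradE (G e2) _ j)))).
have Cf : C1 (fun x => itg (fun v => r v * \1_E (x + v))) by rewrite comb.
have Cq j : C1 (fun x => itg (fun v => kv j v * \1_E (x + v))) by rewrite comb.
have H := kernel_gradient mE mF cC oW CW unionp superp (bcomb 1 1) r0 r1 rd
  (fun j => bcomb (u1 0 j) (u2 0 j)) kr oO OC OF Cf Cq Ox0.
have Dr j := etrans (congr1 (fun f => 'D_(ev R j) f x0) (comb 1 1)) (Dcomb 1 1 j).
have Dk j := etrans (congr1 (fun f => 'D_(ev R j) f x0) (comb (u1 0 j) (u2 0 j)))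
  (Dcomb (u1 0 j) (u2 0 j) j).
have E1 : \row_j 'D_(ev R j) (fun x => itg (fun v => r v * \1_E (x + v))) x0 = 2^-1 *: (g1 + g2).
  by apply/rowP => j; rewrite mxE (Dr j) !mxE; ring.
have E2 : \sum_j 'D_(ev R j) (fun x => itg (fun v => kv j v * \1_E (x + v))) x0 =
    2^-1 * (dot u1 g1 + dot u2 g2).
  rewrite (eq_bigr _ (fun j _ => Dk j)) /dot -big_split /= mulr_sumr.
  by apply: eq_bigr => j _; rewrite mulrC.
have {H} : 0 <= enorm (2^-1 *: (g1 + g2)) + 2^-1 * (dot u1 g1 + dot u2 g2) by rewrite -E1 -E2.
by rewrite enormZ ger0_norm ?invr_ge0// -mulrDr pmulr_rge0 ?invr_gt0.
Qed.

(* Testing with the normalized opposite gradients forces equality in the triangle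
   inequality. *)
Lemma gradients_parallel e1 e2 y1 y2 g1 g2 : 0 < e1 -> 0 < e2 ->
  e1 + enorm (y1 - x0) <= d -> e2 + enorm (y2 - x0) <= d ->
  g1 = grad (G e1) y1 -> g2 = grad (G e2) y2 ->
  enorm g2 *: g1 = enorm g1 *: g2.
Proof.
move=> e10 e20 ey1 ey2 Eg1 Eg2; apply: enorm_parallel.
pose u g : 'rV[R]_n := - (enorm g)^-1 *: g.
have nu g : enorm (u g) <= 1.
  rewrite enormZ normrN normfV ger0_norm ?enorm_ge0//.
  have [->|g0] := eqVneq (enorm g) 0; first by rewrite mulr0.
  by rewrite mulVf.
have du g : dot (u g) g = - enorm g.
  rewrite dotZl dotvv; have [->|g0] := eqVneq (enorm g) 0; first by rewrite expr0n mulr0 oppr0.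
  by field.
have AB y : y = x0 + (y - x0) by rewrite addrC subrK.
have := two_gradients e10 e20 ey1 ey2 (nu g1) (nu g2)
  (etrans Eg1 (congr1 (grad (G e1)) (AB y1))) (etrans Eg2 (congr1 (grad (G e2)) (AB y2))).
by rewrite !du -opprD subr_ge0.
Qed.

(** Any nonzero gradient serves as [nu], since the others are nonnegative multiples of it; the mean
    value theorem along segments gives monotonicity. *)
Lemma monotone_direction : exists nu : 'rV[R]_n, forall e y y', 0 < e ->
  e + enorm (y - x0) <= d -> e + enorm (y' - x0) <= d -> 0 <= dot nu (y' - y) ->
  moll e \1_E y <= moll e \1_E y'.
Proof.
have [nu Hnu] : exists nu : 'rV[R]_n, forall e y v g, 0 < e -> e + enorm (y - x0) <= d ->
    g = grad (G e) y -> 0 <= dot nu v -> 0 <= dot g v.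
  have [[e1 [y1 [g1 [e10 ey1 Eg1 G1]]]]|Hn] := pselect (exists e y g, [/\ 0 < e,
      e + enorm (y - x0) <= d, g = grad (G e) y & enorm g != 0]).
    have G1p : 0 < enorm g1 by rewrite lt0r G1 enorm_ge0.
    exists g1 => e y v g e0 ey Eg dv.
    rewrite -(pmulr_rge0 _ G1p) -dotZl (gradients_parallel e0 e10 ey ey1 Eg Eg1) dotZl.
    by rewrite mulr_ge0// enorm_ge0.
  (* All gradients in range vanish, and the zero vector serves. *)
  exists 0 => e y v g e0 ey Eg _.
  rewrite (_ : g = 0) ?dot0l//; apply: enorm_eq0; apply: contrapT => /eqP g0.
  by apply: Hn; exists e, y, g; split.
exists nu => e y y' e0 ey ey' dnu.
pose u := y' - y.
(* The points in range for the scale [e] form a ball, so they include the whole segment. *)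
have seg (t : R) : 0 <= t <= 1 -> e + enorm (y + t *: u - x0) <= d.
  move=> /andP[t0 t1].
  have -> : y + t *: u - x0 = (1 - t) *: (y - x0) + t *: (y' - x0).
    by rewrite /u; apply/rowP => j; rewrite !mxE; ring.
  apply: (@le_trans _ _ (e + ((1 - t) * enorm (y - x0) + t * enorm (y' - x0)))).
    rewrite lerD2l (le_trans (enormD _ _))// !enormZ (ger0_norm t0) ger0_norm ?subr_ge0//.
  have H1 : (1 - t) * enorm (y - x0) <= (1 - t) * (d - e) by apply: ler_wpM2l; lra.
  have H2 : t * enorm (y' - x0) <= t * (d - e) by apply: ler_wpM2l; lra.
  lra.
have dG x : is_derive x u (G e) (- dmoll e u \1_E x) by exact: moll_is_derive.
have dG' x : - dmoll e u \1_E x = dot (grad (G e) x) u.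
  rewrite (dmoll_coord e0 u x bE) -sumrN dotC; apply: eq_bigr => i _.
  by rewrite gradE (derive_mollE e0 _ _ bE) mulrN.
have df (t : R) : is_derive t 1 (fun s : R => G e (y + s *: u)) (- dmoll e u \1_E (y + t *: u)).
  by apply: is_derive_line; exact: dG.
have cG : {within `[0, 1], continuous (fun s : R => G e (y + s *: u))}.
  by apply: derivable_within_continuous => t _; have [] := df t.
have [c] := @MVT_segment R _ _ 0 1 ler01 (fun t _ => df t) cG.
have yu : y + u = y' by rewrite /u addrC subrK.
rewrite in_itv/= scale0r addr0 scale1r yu subr0 mulr1 => c01 H.
rewrite -subr_ge0 [X in 0 <= X]H dG'.
by apply: (Hnu e _ _ _ e0 _ erefl dnu); exact: seg.
Qed.

End MonotoneMollification.

(** * Half spaces at contact points *)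

Lemma mass_arith (R : realType) (a b zeta IA IB : R) : 0 <= a -> 0 <= b -> 0 < zeta ->
  `|IA - a| <= zeta / (a + b + 1) -> `|IB| <= zeta / (a + b + 1) ->
  IA * b <= IB * a -> a * b <= zeta.
Proof.
move=> a0 b0 z0; set eta := zeta / (a + b + 1) => H1 H2 H3.
have E : eta * (a + b + 1) = zeta by rewrite /eta mulfVK// gt_eqF//; lra.
have eta0 : 0 < eta by rewrite divr_gt0//; lra.
move: H1 H2; rewrite !ler_norml => /andP[A1 A2] /andP[B1 B2].
have : (a - eta) * b <= IA * b by apply: ler_wpM2r => //; lra.
have : IB * a <= eta * a by apply: ler_wpM2r.
nra.
Qed.

Section HalfSpace.
Variables (R : realType) (n : nat).
Implicit Types (x y z v u nu : 'rV[R]_n) (A B E : set 'rV[R]_n) (e d : R).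

Definition mass A : R := itg (\1_A : 'rV[R]_n -> R).

Lemma bcsupp_indic A M : measurable A -> A `<=` cbox M -> bcsupp (\1_A : 'rV[R]_n -> R).
Proof.
move=> mA AM; split; first exact: bmeas_indic.
by exists M => x xM; rewrite indicE memNset// => /AM /= /(lt_le_trans xM); rewrite ltxx.
Qed.

Lemma lam_mass A M : measurable A -> A `<=` cbox M -> lam R n A = (mass A)%:E.
Proof.
by move=> mA AM; rewrite /mass (itg_EFin (bcsupp_indic mA AM)) integral_indic// setIT.
Qed.

Definition monotone_along E x0 d nu : Prop := forall e y y', 0 < e ->
  e + enorm (y - x0) <= d -> e + enorm (y' - x0) <= d -> 0 <= dot nu (y' - y) ->
  moll e \1_E y <= moll e \1_E y'.

Lemma moll_mass E A M eta : measurable E -> measurable A -> A `<=` cbox M -> 0 < eta ->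
  exists2 d, 0 < d & forall e, 0 < e <= d ->
    `|itg (fun x => moll e \1_E x * \1_A x) - itg (fun x => \1_E x * \1_A x)| <= eta.
Proof.
move=> mE mA AM eta0; have bE : bmeas (\1_E : 'rV[R]_n -> R) by exact: bmeas_indic.
have [d d0 Hd] := moll_L1 M bE eta0; exists d => // e /[dup] /Hd He /andP[e0 _].
have bA := bcsupp_indic mA AM; have bm := bmeas_moll e0 bE.
have b1 := bcsuppMl bA bm; have b2 := bcsuppMl bA bE.
rewrite -(itgB b1 b2); apply: le_trans He; apply: (le_trans (le_norm_itg (bcsuppB b1 b2))).
apply: le_itg.
- exact: (bcsupp_norm (bcsuppB b1 b2)).
- exact: (bcsuppMl (bcsupp_cbox n M) (bmeas_norm (bmeasB bm bE))).
move=> x; rewrite -mulrBl normrM; apply: ler_wpM2l => //.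
rewrite [\1_A x]indicE [\1_(cbox M) x]indicE; case: (boolP (x \in A)) => [|_].
  by rewrite inE => /AM xM; rewrite mem_set// normr1.
by rewrite normr0.
Qed.

(** Integrate the monotonicity inequality over pairs of points of [A] and [B] and let the scale tend
    to 0: the mollification tends in mean to 1 on [A] and to 0 on [B]. *)
Lemma mass_compare E x0 d d' nu A B : measurable E -> monotone_along E x0 d nu ->
  measurable A -> measurable B -> d' < d ->
  (forall a, A a -> enorm (a - x0) <= d') -> (forall b, B b -> enorm (b - x0) <= d') ->
  (forall a b, A a -> B b -> 0 <= dot nu (b - a)) ->
  A `<=` E -> (forall b, B b -> ~ E b) -> mass A * mass B <= 0.
Proof.
move=> mE mono mA mB dd Ad Bd AB AE BE.
pose M := d' + `|x0|.
have box (S : set 'rV[R]_n) : (forall a, S a -> enorm (a - x0) <= d') -> S `<=` cbox M.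
  move=> Sd a /Sd H; rewrite /cbox /= /M; have := mxnorm_le_enorm (a - x0).
  have := ler_normD (a - x0) x0; rewrite subrK; lra.
have AM := box _ Ad; have BM := box _ Bd.
have bA := bcsupp_indic mA AM; have bB := bcsupp_indic mB BM.
have mA0 : 0 <= mass A by apply: itg_ge0.
have mB0 : 0 <= mass B by apply: itg_ge0.
apply/ler_addgt0Pr => zeta zeta0; rewrite add0r.
pose eta := zeta / (mass A + mass B + 1).
have S0 : 0 < mass A + mass B + 1 by lra.
have eta0 : 0 < eta by rewrite divr_gt0.
have [d1 d10 H1] := moll_mass mE mA AM eta0; have [d2 d20 H2] := moll_mass mE mB BM eta0.
(* The first bound puts all points of [A] and [B] within reach of the monotonicity; the other two
   make both integrals [eta]-close to their limits. *)
pose e := Num.min (d - d') (Num.min d1 d2).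
have e0 : 0 < e by rewrite !lt_min subr_gt0 dd d10.
have ed : e <= d - d' by rewrite ge_min lexx.
have e1 : 0 < e <= d1 by rewrite e0 !ge_min lexx orbT.
have e2 : 0 < e <= d2 by rewrite e0 !ge_min lexx !orbT.
have {}H1 := H1 e e1; have {}H2 := H2 e e2.
have EA : itg (fun x => \1_E x * \1_A x) = mass A.
  congr itg; apply/funext => x; rewrite !indicE.
  by case: (boolP (x \in A)) => [|_]; [rewrite inE => /AE Ex; rewrite mem_set// mulr1|rewrite mulr0].
have EB : itg (fun x => \1_E x * \1_B x) = 0.
  rewrite -(itg0 R n); congr itg; apply/funext => x; rewrite !indicE.
  by case: (boolP (x \in B)) => [|_]; [rewrite inE => /BE Ex; rewrite memNset// mul0r|rewrite mulr0].
rewrite EA in H1; rewrite EB subr0 in H2.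
have bE : bmeas (\1_E : 'rV[R]_n -> R) by exact: bmeas_indic.
have bm := bmeas_moll e0 bE.
have bmA := bcsuppMl bA bm; have bmB := bcsuppMl bB bm.
set IA := itg (fun x => moll e \1_E x * \1_A x) in H1 *.
set IB := itg (fun x => moll e \1_E x * \1_B x) in H2 *.
have key a : A a -> moll e \1_E a * mass B <= IB.
  move=> Aa; rewrite /mass -(itgZ _ bB); apply: (le_itg (bcsuppZ _ bB) bmB) => b.
  have [Bb|nB] := pselect (B b); last by rewrite indicE memNset// !mulr0.
  rewrite [\1_B b]indicE mem_set// !mulr1.
  by apply: mono => //; [have := Ad a Aa|have := Bd b Bb|exact: AB]; lra.
have key2 : IA * mass B <= IB * mass A.
  rewrite mulrC -(itgZ _ bmA) /mass -(itgZ IB bA).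
  apply: (le_itg (bcsuppZ _ bmA) (bcsuppZ _ bA)) => a.
  have [Aa|nA] := pselect (A a); last by rewrite [\1_A a]indicE memNset// !mulr0.
  by rewrite [\1_A a]indicE mem_set// !mulr1 mulrC; exact: key.
apply: (mass_arith mA0 mB0 zeta0 H1 H2 key2).
Qed.

End HalfSpace.

Section EssentialSets.
Variables (R : realType) (n : nat).
Implicit Types (x y z v u nu : 'rV[R]_n) (A B E : set 'rV[R]_n) (e d r : R).

(** Interior and exterior are visible to Lebesgue measure: what normalization provides, in a form
    stable under complements. *)
Definition ess A : Prop :=
  (forall x r, 0 < r -> lam R n (eball x r `\` A) = 0%E -> interior A x) /\
  (forall x r, 0 < r -> lam R n (eball x r `&` A) = 0%E -> ~ closure A x).

Lemma interiorC_closure A : interior (~` A) = ~` closure A.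
Proof. by rewrite -interiorC. Qed.

Lemma closureC_interior A : closure (~` A) = ~` interior A.
Proof. by rewrite -[LHS]setCK -interiorC_closure setCK. Qed.

Lemma essC A : ess A -> ess (~` A).
Proof.
move=> [H1 H2]; split=> x r r0.
  by rewrite setDE setCK => /(H2 x r r0); rewrite interiorC_closure.
by rewrite -setDE => /(H1 x r r0) iA; rewrite closureC_interior => /(_ iA).
Qed.

Lemma norm_dot u v : `|dot u v| <= enorm u * enorm v.
Proof.
rewrite ler_norml cauchy_schwarz andbT.
have := cauchy_schwarz (- u) v; rewrite enormN.
have -> : \sum_(i < n) (- u) 0 i * v 0 i = - dot u v.
  by rewrite /dot -sumrN; apply: eq_bigr => i _; rewrite mxE mulNr.
by rewrite lerNl.
Qed.

Lemma eball_self x r : 0 < r -> eball x r x.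
Proof. by move=> r0; rewrite /eball /= subrr enorm0. Qed.

(** Of two small balls with the second ahead of the first in direction [nu], either the first is
    almost free of [E] or the second is almost filled by it. Taking one of them at the boundary
    point [y] decides the alternative. *)
Lemma half_space E x0 d nu y : measurable E -> ess E -> monotone_along E x0 d nu ->
  enorm (y - x0) < d -> closure E y -> ~ interior E y ->
  nu != 0 /\ forall z, enorm (z - x0) < d ->
    (0 < dot nu (z - y) -> interior E z) /\ (dot nu (z - y) < 0 -> ~ closure E z).
Proof.
move=> mE [ess1 ess2] mono yd cy iy.
have sep z z' r : 0 < r -> enorm (z - x0) + r < d -> enorm (z' - x0) + r < d ->
    (forall a b, eball z r a -> eball z' r b -> 0 <= dot nu (b - a)) ->
    interior E z' \/ ~ closure E z.
  move=> r0 zd z'd Hdot.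
  pose A := eball z r `&` E; pose B := eball z' r `\` E.
  have mA : measurable A by apply: measurableI => //; exact: measurable_eball.
  have mB : measurable B by apply: measurableD => //; exact: measurable_eball.
  pose d' := Num.max (enorm (z - x0) + r) (enorm (z' - x0) + r).
  have dd : d' < d by rewrite gt_max zd.
  have Ad a : A a -> enorm (a - x0) <= d'.
    move=> [az _]; rewrite le_max; apply/orP; left.
    have := enormD (a - z) (z - x0); rewrite addrA subrK; move: az; rewrite /eball /=; lra.
  have Bd b : B b -> enorm (b - x0) <= d'.
    move=> [bz _]; rewrite le_max; apply/orP; right.
    have := enormD (b - z') (z' - x0); rewrite addrA subrK; move: bz; rewrite /eball /=; lra.
  have := mass_compare mE mono mA mB dd Ad Bd (fun a b Aa Bb => Hdot a b Aa.1 Bb.1)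
    (fun a Aa => Aa.2) (fun b Bb => Bb.2).
  have box (S : set 'rV[R]_n) : (forall a, S a -> enorm (a - x0) <= d') -> S `<=` cbox (d' + `|x0|).
    move=> Sd a /Sd H; rewrite /cbox /=; have := mxnorm_le_enorm (a - x0).
    have := ler_normD (a - x0) x0; rewrite subrK; lra.
  have lA := lam_mass mA (box _ Ad); have lB := lam_mass mB (box _ Bd).
  have mA0 : 0 <= mass A by apply: itg_ge0.
  have mB0 : 0 <= mass B by apply: itg_ge0.
  have [A0|A0] := eqVneq (mass A) 0; first by right; apply: (ess2 z r r0); rewrite -/A lA A0.
  have [B0|B0] := eqVneq (mass B) 0; first by left; apply: (ess1 z' r r0); rewrite -/B lB B0.
  by rewrite leNgt mulr_gt0// lt0r ?A0 ?B0.
(* A common radius that keeps both balls in range and changes [dot nu] by at most [s] over the pair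
   of balls. *)
have room z : enorm (z - x0) < d -> forall s, 0 < s -> exists r, [/\ 0 < r,
    enorm (y - x0) + r < d, enorm (z - x0) + r < d & 2 * enorm nu * r <= s].
  move=> zd s s0; pose r1 := (d - enorm (y - x0)) / 2; pose r2 := (d - enorm (z - x0)) / 2.
  pose r3 := s / (2 * (enorm nu + 1)).
  have N0 := enorm_ge0 nu.
  have r10 : 0 < r1 by rewrite /r1; lra.
  have r20 : 0 < r2 by rewrite /r2; lra.
  have r30 : 0 < r3 by rewrite divr_gt0//; lra.
  exists (Num.min r1 (Num.min r2 r3)).
  have h1 : Num.min r1 (Num.min r2 r3) <= r1 by rewrite ge_min lexx.
  have h2 : Num.min r1 (Num.min r2 r3) <= r2 by rewrite !ge_min lexx orbT.
  have h3 : Num.min r1 (Num.min r2 r3) <= r3 by rewrite !ge_min lexx !orbT.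
  split; [by rewrite !lt_min r10 r20|by rewrite /r1 in h1; lra|by rewrite /r2 in h2; lra|].
  apply: (@le_trans _ _ (2 * (enorm nu + 1) * r3)).
    apply: ler_pM => //; [by rewrite mulr_ge0|by rewrite !le_min !ltW|lra].
  by rewrite /r3 mulrC divfK// gt_eqF//; lra.
have perturb a b z1 z2 r : eball z1 r a -> eball z2 r b ->
    dot nu (z2 - z1) - 2 * enorm nu * r <= dot nu (b - a).
  rewrite /eball /= => az bz; have N0 := enorm_ge0 nu.
  have -> : b - a = (z2 - z1) + ((b - z2) - (a - z1)).
    by apply/rowP => i; rewrite !mxE; ring.
  rewrite [leRHS]dotDr lerD2l dotBr.
  have H1 : `|dot nu (b - z2)| <= enorm nu * r.
    by apply: (le_trans (norm_dot _ _)); rewrite ler_wpM2l// ltW.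
  have H2 : `|dot nu (a - z1)| <= enorm nu * r.
    by apply: (le_trans (norm_dot _ _)); rewrite ler_wpM2l// ltW.
  move: H1 H2; rewrite !ler_norml => /andP[? ?] /andP[? ?]; lra.
split.
  (* With [nu = 0] a ball at [y] would be ahead of itself, and [y] would be interior or exterior. *)
  apply/eqP => nu0; have [r [r0 yr _ _]] := room y yd 1 ltr01.
  have Hs a b : eball y r a -> eball y r b -> 0 <= dot nu (b - a) by rewrite nu0 dot0l.
  by case: (sep y y r r0 yr yr Hs).
move=> z zd; split=> s0.
  have [r [r0 yr zr nr]] := room z zd _ s0.
  have Hs a b : eball y r a -> eball z r b -> 0 <= dot nu (b - a).
    by move=> ay bz; have := perturb a b y z r ay bz; lra.
  by case: (sep y z r r0 yr zr Hs).
have s0' : 0 < - dot nu (z - y) by lra.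
have [r [r0 yr zr nr]] := room z zd _ s0'.
have Hs a b : eball z r a -> eball y r b -> 0 <= dot nu (b - a).
  move=> az b_y; have := perturb a b z y r az b_y.
  have -> : dot nu (y - z) = - dot nu (z - y) by rewrite !dotBr opprB.
  lra.
by case: (sep z y r r0 zr yr Hs).
Qed.

End EssentialSets.

(** * Half spaces near the contact set, and complements *)

Section ContactHalfSpace.
Variables (R : realType) (n : nat).
Implicit Types (x y z v u nu : 'rV[R]_n) (A B C E F K U W : set 'rV[R]_n) (d r p : R).

Definition half_space_at A y nu r : Prop := forall z, enorm (z - y) < r ->
  (0 < dot nu (z - y) -> interior A z) /\ (dot nu (z - y) < 0 -> ~ closure A z).

Lemma interior_ball A x r : 0 < r -> (forall y, `|y - x| < r -> A y) -> interior A x.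
Proof.
move=> r0 H; apply/nbhs_ballP; exists r => //= y.
by rewrite -ball_normE /= distrC; exact: H.
Qed.

(** At each point of [A] the exterior of [E] or the interior of [F] contains a ball; the larger of
    the two radii has a positive minimum on [A], and this minimum bounds the shifts. *)
Lemma shift_inclusion E F A : E `<=` F -> compact A ->
  (forall x, A x -> closure E x -> interior F x) ->
  exists2 d, 0 < d & forall x v, A x -> `|v| < d -> E (x + v) -> F x.
Proof.
move=> EF cA AEF.
pose g x := Num.max (indist (~` closure E) x) (indist (interior F) x).
have oE : open (~` closure E) by apply: closed_openC; exact: closed_closure.
have oF : open (interior F) by exact: open_interior.
have cg : continuous g.
  by move=> x; apply: continuous_max; exact: indist_continuous.
have [[a0 Aa0]|A0] := pselect (A !=set0); last first.
  by exists 1 => // x v Ax; exfalso; apply: A0; exists x.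
have [||c Ac Hc] := @EVT_min_rV R n g A _ cA.
- by exists a0.
- exact: continuous_subspaceT.
rewrite inE in Ac; exists (g c).
  rewrite lt_max; have [cE|nE] := pselect (closure E c).
    by apply/orP; right; apply: indist_gt0 => //; exact: AEF.
  by apply/orP; left; apply: indist_gt0.
move=> x v Ax vc Exv; have := lt_le_trans vc (Hc x (mem_set Ax)).
rewrite lt_max => /orP[vE|vF].
  have : (~` closure E) (x + v).
    by apply: (@indist_ball _ _ _ x); rewrite (addrC x) addrK.
  by case; exact: subset_closure.
apply: interior_subset; apply: (@indist_ball _ _ _ x).
by rewrite subrr normr0; apply: le_lt_trans vF.
Qed.

(** [d] comes from compactness and is fixed before the contact point and the exterior point;
    [boundaries_agree] needs this order, since it looks for exterior points within [d]. *)
Lemma contact_half_space U E F : open U -> ebounded U -> measurable E -> measurable F ->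
  E `<=` F -> ess E -> lfp E -> lfp F -> sub_minimal E U -> super_minimal F U ->
  compact (closure E `\` interior F) -> closure E `\` interior F `<=` U ->
  exists2 d, 0 < d & forall y x0, (closure E `\` interior F) y -> enorm (y - x0) < d ->
    ~ closure F x0 -> exists nu r, [/\ nu != 0, 0 < r & half_space_at E y nu r].
Proof.
move=> oU bU mE mF EF eE fE fF sE sF; set K := closure E `\` interior F => cK KU.
have [R0 R00 RU] := compact_thick_sub cK oU KU.
(* One third for [C], one for the margin of [W] around it, one for the translations. *)
pose r := R0 / 3; have r0 : 0 < r by rewrite /r; lra.
pose C := thick K r; pose W := interior (thick K (r + r)).
have cC : compact C by exact: compact_thick.
have oW : open W by exact: open_interior.
have CW : C `<=` W.
  move=> x Cx; apply: (interior_ball r0) => y yx; apply: (thick_add Cx); exact: ltW.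
have Wthick : W `<=` thick K (r + r) by exact: interior_subset.
have WU x v : W x -> `|v| < r -> U (x + v).
  move=> Wx vr; apply: RU; rewrite (_ : R0 = r + r + r); last by rewrite /r; lra.
  by apply: (thick_add (Wthick _ Wx)); rewrite (addrC x) addrK ltW.
have WU0 : W `<=` U by move=> x Wx; rewrite -(addr0 x); apply: WU => //; rewrite normr0.
(* A compact shell free of contact points. *)
pose A := thick K (r + r) `&` ~` interior C.
have cA : compact A.
  by apply: compact_closedI; [exact: compact_thick|apply: open_closedC; exact: open_interior].
have KC : K `<=` interior C.
  by move=> x Kx; apply: (interior_ball r0) => y yx; exists x => //; exact: ltW.
have AEF x : A x -> closure E x -> interior F x.
  by move=> [_ nC] cE; apply: contrapT => nF; apply: nC; apply: KC.
have [d1 d10 Hd1] := shift_inclusion EF cA AEF.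
pose d := Num.min d1 r; have d0 : 0 < d by rewrite lt_min d10.
have dd1 : d <= d1 by rewrite ge_min lexx.
have dr : d <= r by rewrite ge_min lexx orbT.
have bW : ebounded W by have [M HM] := bU; exists M => x /WU0 /HM.
have [q Fq] := fF W oW bW; have [p [Fp pF]] := tv_exists Fq.
have unionp v : `|v| < d -> tvle (\1_(F `|` (C `&` [set x | E (x + v)])) : _ -> R) W p.
  move=> vd; apply: (union_translate_tvle mE mF oU bU fE sE cC oW CW _ _ Fp).
    by move=> x Wx; apply: WU => //; exact: lt_le_trans dr.
  move=> x Wx nC Exv; apply: (Hd1 x v _ _ Exv); last exact: lt_le_trans dd1.
  by split; [exact: Wthick|move=> /interior_subset].
have superp P : measurable P -> F `<=` P -> (forall x, ~ C x -> P x -> F x) ->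
    tvge (\1_P : _ -> R) W p.
  by move=> mP FP PF; exact: (superset_tvge mF mP oU bU fF sF cC oW CW WU0 FP PF pF).
exists d => // y x0 [cEy niF] yx0 nF.
pose O := interior C `&` ~` closure F.
have oO : open O by apply: openI; [exact: open_interior|apply: closed_openC; exact: closed_closure].
have OC : O `<=` C by move=> x [/interior_subset].
have OF x : O x -> ~ F x by move=> [_ nc] Fx; apply: nc; exact: subset_closure.
have Ox0 : O x0.
  split => //; have xy : `|x0 - y| < r.
    by rewrite distrC (le_lt_trans (mxnorm_le_enorm _))// (lt_le_trans yx0).
  apply: (@interior_ball _ _ (r - `|x0 - y|)) => [|z zx]; first by rewrite subr_gt0.
  exists y => //; have := ler_distD x0 z y; lra.
have [nu mono] := monotone_direction mE mF cC oW CW unionp superp oO OC OF Ox0.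
have niE : ~ interior E y by move=> /(interiorS EF).
have [nu0 Hnu] := half_space mE eE mono yx0 cEy niE.
exists nu, (d - enorm (y - x0)); split => //; first by rewrite subr_gt0.
move=> z zy; apply: Hnu; have := enormD (z - y) (y - x0); rewrite addrA subrK; lra.
Qed.

(** The two indicators add up to 1, and the integral of a divergence vanishes. *)
Lemma divint_indicC A V (phi : 'rV[R]_n -> 'rV[R]_n) : measurable A -> C1field V phi ->
  divint (\1_(~` A) : _ -> R) phi = - divint (\1_A : _ -> R) phi.
Proof.
move=> mA fp; have bA : bmeas (\1_A : 'rV[R]_n -> R) by exact: bmeas_indic.
have bC : bmeas (\1_(~` A) : 'rV[R]_n -> R) by apply: bmeas_indic; exact: measurableC.
apply/eqP; rewrite -addr_eq0 -(divintDl bC bA fp); apply/eqP.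
rewrite -[RHS](divint_cst 1 fp); congr divint; apply/funext => x.
by rewrite !indicE in_setC; case: (_ \in _) => /=; rewrite ?add0r ?addr0.
Qed.

Lemma tvleC A V p : measurable A -> tvle (\1_A : _ -> R) V p -> tvle (\1_(~` A) : _ -> R) V p.
Proof.
move=> mA Ap phi /admissibleP[fp np]; rewrite (divint_indicC mA fp).
have bA : bmeas (\1_A : 'rV[R]_n -> R) by exact: bmeas_indic.
rewrite -mulN1r -(divintZ (-1) bA fp); apply: Ap; apply/admissibleP; split.
  exact: C1fieldZ.
by move=> x; rewrite scaleN1r enormN.
Qed.

Lemma lfpC A : measurable A -> lfp A -> lfp (~` A).
Proof.
move=> mA fA V oV bV; have [p Ap] := fA V oV bV.
by exists p; exact: tvleC.
Qed.

Lemma super_minimalC F U : measurable F -> super_minimal F U -> sub_minimal (~` F) U.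
Proof.
move=> mF sF C G cC CU mG GF FG fG q Gq; apply: tvleC => //.
apply: (sF C (~` G) cC CU).
- exact: measurableC.
- by move=> x Fx Gx; exact: (GF x Gx).
- by move=> x nC nG; apply: contrapT => nF; apply: nG; exact: FG.
- exact: lfpC.
- exact: tvleC.
Qed.

Lemma sub_minimalC E U : measurable E -> sub_minimal E U -> super_minimal (~` E) U.
Proof.
move=> mE sE C G cC CU mG EG GE fG q Gq; apply: tvleC => //.
apply: (sE C (~` G) cC CU).
- exact: measurableC.
- by move=> x nG; apply: contrapT => nE; apply: nG; exact: EG.
- by move=> x nC Ex Gx; exact: (GE x nC Gx).
- exact: lfpC.
- exact: tvleC.
Qed.

End ContactHalfSpace.

(** * Agreement of the boundaries *)

Section BoundaryAgreement.
Variables (R : realType) (n : nat).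
Implicit Types (x y z v u nu mu : 'rV[R]_n) (A B C E F K U W : set 'rV[R]_n) (d r p : R).

Lemma small_scale u r : 0 < r -> exists2 t : R, 0 < t & enorm (t *: u) < r.
Proof.
move=> r0; have U0 := enorm_ge0 u; exists (r / (enorm u + 1)); first by rewrite divr_gt0//; lra.
rewrite enormZ ger0_norm; last by rewrite divr_ge0//; lra.
by rewrite mulrAC ltr_pdivrMr; [rewrite ltr_pM2l//; lra|lra].
Qed.

Lemma dotvv_gt0 nu : nu != 0 -> 0 < dot nu nu.
Proof.
move=> nu0; rewrite dotvv exprn_gt0// lt0r enorm_ge0 andbT.
by apply: contra_neq nu0; exact: enorm_eq0.
Qed.

(** A vector of the hyperplane is a limit of vectors on its positive side, and so is its
    opposite. *)
Lemma dot_orthogonal nu mu u : nu != 0 ->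
  (forall w, 0 < dot nu w -> dot mu w <= 0) -> dot nu u = 0 -> dot mu u = 0.
Proof.
move=> nu0 H.
have P w : dot nu w = 0 -> dot mu w <= 0.
  move=> w0; rewrite leNgt; apply/negP => wp; have N := dotvv_gt0 nu0.
  pose D := `|dot mu nu| + 1; have D0 : 0 < D by rewrite ltr_wpDl.
  (* With this step, adding [s *: nu] changes [dot mu w] by at most half, so it stays positive. *)
  pose s := dot mu w / (2 * D).
  have s0 : 0 < s by rewrite divr_gt0// mulr_gt0.
  have := H (w + s *: nu); rewrite !dotDr !dotZr w0 add0r mulr_gt0// => /(_ isT).
  have : - (s * D) <= s * dot mu nu.
    rewrite -mulrN ler_pM2l//; have := ler_norm (- dot mu nu); rewrite normrN /D; lra.
  have : s * D = dot mu w / 2 by rewrite /s; field; rewrite gt_eqF.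
  by move: (s * dot mu nu) (s * D) (dot mu w) wp => a b c; lra.
move=> u0; apply/eqP; rewrite eq_le P//=.
have := P (- u); rewrite -scaleN1r !dotZr u0 mulr0 => /(_ erefl).
by rewrite mulN1r oppr_le0.
Qed.

(** [half_space_at] is silent on the hyperplane itself; its points lie on the boundary because small
    steps along [nu] and [- nu] reach the interior and the exterior. *)
Lemma half_space_boundary A y nu r z : nu != 0 -> half_space_at A y nu r ->
  enorm (z - y) < r -> ((closure A z /\ ~ interior A z) <-> dot nu (z - y) = 0).
Proof.
move=> nu0 H zr; have N := dotvv_gt0 nu0; split=> [[cA iA]|z0].
  have [Hp Hn] := H z zr; case: (ltgtP (dot nu (z - y)) 0) => //.
    by move=> /Hn /(_ cA).
  by move=> /Hp.
have zr0 : 0 < r - enorm (z - y) by rewrite subr_gt0.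
have near_pt (c : R) e : `|c| = 1 -> 0 < e -> exists t : R, [/\ 0 < t,
    `|(z + (c * t) *: nu) - z| < e & enorm ((z + (c * t) *: nu) - y) < r].
  move=> c1 e0; have er0 : 0 < Num.min e (r - enorm (z - y)) by rewrite lt_min e0.
  have [t t0] := small_scale nu er0; rewrite lt_min => /andP[te tr].
  have ct : enorm ((c * t) *: nu) = enorm (t *: nu) by rewrite !enormZ normrM c1 mul1r.
  exists t; split => //.
    by rewrite (addrC z) addrK (le_lt_trans (mxnorm_le_enorm _))// ct.
  by rewrite addrAC; have := enormD (z - y) ((c * t) *: nu); rewrite ct; lra.
have dot_pt (c : R) t : dot nu ((z + (c * t) *: nu) - y) = c * t * dot nu nu.
  by rewrite addrAC dotDr z0 add0r dotZr.
split.
- move=> B /nbhs_ballP[e /= e0 eB].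
  have [t [t0 te tr]] := near_pt 1 e (normr1 R) e0.
  exists (z + (1 * t) *: nu); split; last by apply: eB; rewrite -ball_normE /= distrC.
  by apply: interior_subset; apply: (H _ tr).1; rewrite dot_pt mul1r mulr_gt0.
- move=> /nbhs_ballP[e /= e0 eA].
  have [t [t0 te tr]] := near_pt (-1) e (normrN1 R) e0.
  apply: ((H _ tr).2 _); first by rewrite dot_pt mulN1r mulNr oppr_lt0 mulr_gt0.
  by apply: subset_closure; apply: eA; rewrite -ball_normE /= distrC.
Qed.

(** As [E] lies in [F], the half space inside [E] and the one inside the complement of [F] are
    disjoint near [y]; hence their hyperplanes coincide. *)
Lemma half_spaces_agree E F y nu mu r s : E `<=` F -> nu != 0 -> mu != 0 -> 0 < r -> 0 < s ->
  half_space_at E y nu r -> half_space_at (~` F) y mu s ->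
  forall u, dot nu u = 0 <-> dot mu u = 0.
Proof.
move=> EF nu0 mu0 r0 s0 HE HF.
have P u : 0 < dot nu u -> 0 < dot mu u -> False.
  move=> du dm; have rs0 : 0 < Num.min r s by rewrite lt_min r0.
  have [t t0] := small_scale u rs0; rewrite lt_min => /andP[tr ts].
  have yu : y + t *: u - y = t *: u by rewrite addrAC subrr add0r.
  have iE : interior E (y + t *: u).
    by apply: (HE _ _).1; rewrite yu// dotZr mulr_gt0.
  have : interior (~` F) (y + t *: u).
    by apply: (HF _ _).1; rewrite yu// dotZr mulr_gt0.
  by move=> /interior_subset; apply; apply: EF; exact: interior_subset.
move=> u; split; apply: dot_orthogonal => // w dw; rewrite leNgt; apply/negP => dw'.
  exact: (P w).
exact: (P w).
Qed.

Lemma boundaries_agree U E F : open U -> ebounded U -> measurable E -> measurable F ->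
  E `<=` F -> ess E -> ess F -> lfp E -> lfp F -> sub_minimal E U -> super_minimal F U ->
  compact (closure E `\` interior F) -> closure E `\` interior F `<=` U ->
  closure E `&` U `<=` closure (interior E) ->
  forall y, (closure E `\` interior F) y -> exists2 r, 0 < r &
    forall z, enorm (z - y) < r ->
      ((closure E `\` interior E) z <-> (closure F `\` interior F) z).
Proof.
move=> oU bU mE mF EF eE eF fE fF sE sF cK KU EiE y Ky; have [cEy niF] := Ky.
(* Replacing [E] and [F] by the complements of [F] and [E] leaves the contact set unchanged. *)
have KC : closure (~` F) `\` interior (~` E) = closure E `\` interior F.
  by rewrite closureC_interior interiorC_closure setDE setCK setIC.
have [d d0 Hd] := contact_half_space oU bU mE mF EF eE fE fF sE sF cK KU.
have [d' d'0 Hd'] := @contact_half_space _ _ U (~` F) (~` E) oU bU (measurableC mF)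
  (measurableC mE) (fun x nF Ex => nF (EF x Ex)) (essC eF) (lfpC mF fF) (lfpC mE fE)
  (super_minimalC mF sF) (sub_minimalC mE sE) (ltac:(by rewrite KC)) (ltac:(by rewrite KC)).
rewrite KC in Hd'.
have [x0 [iEx0 yx0]] : exists x0, interior E x0 /\ enorm (y - x0) < d'.
  have yE : closure (interior E) y by apply: EiE; split => //; exact: KU.
  have [|x0 [iE x0y]] := yE (eball y d'); last by exists x0; split => //; rewrite enormB.
  by rewrite nbhsE; exists (eball y d') => //; split; [exact: open_eball|exact: eball_self].
have ncE : ~ closure (~` E) x0 by rewrite closureC_interior.
have [mu [s [mu0 s0 HF]]] := Hd' y x0 Ky yx0 ncE.
have ds0 : 0 < Num.min d s by rewrite lt_min d0.
(* The half space in the complement of [F] supplies, within [d] of [y], the exterior point of [F]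
   that [Hd] asks for. *)
have [t t0] := small_scale mu ds0; rewrite lt_min => /andP[td ts].
have yt : y + t *: mu - y = t *: mu by rewrite addrAC subrr add0r.
have nFt : ~ closure F (y + t *: mu).
  have : interior (~` F) (y + t *: mu).
    by apply: (HF _ _).1; rewrite yt// dotZr mulr_gt0// dotvv_gt0.
  by rewrite interiorC_closure.
have [nu [r [nu0 r0 HE]]] := Hd y (y + t *: mu) Ky (ltac:(by rewrite enormB yt)) nFt.
have agree := half_spaces_agree EF nu0 mu0 r0 s0 HE HF.
exists (Num.min r s); first by rewrite lt_min r0.
move=> z; rewrite lt_min => /andP[zr zs].
have BE := half_space_boundary nu0 HE zr; have BF := half_space_boundary mu0 HF zs.
rewrite closureC_interior interiorC_closure in BF.
split=> [/BE/agree/BF[niFz ncF]|[cFz niFz]].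
  by split => //; apply: contrapT.
apply/BE/agree/BF; split => //.
Qed.

Lemma boundaries_agree_nbhd U E F : open U ->
  (forall y, (closure E `\` interior F) y -> exists2 r, 0 < r & forall z, enorm (z - y) < r ->
      ((closure E `\` interior E) z <-> (closure F `\` interior F) z)) ->
  closure E `\` interior F `<=` U ->
  exists W, [/\ open W, W `<=` U, closure E `\` interior F `<=` W &
    (closure E `\` interior E) `&` W = (closure F `\` interior F) `&` W].
Proof.
move=> oU H KU.
pose P := [set yr : 'rV[R]_n * R | forall z, eball yr.1 yr.2 z ->
  ((closure E `\` interior E) z <-> (closure F `\` interior F) z)].
exists (U `&` \bigcup_(yr in P) eball yr.1 yr.2); split.
- by apply: openI => //; apply: bigcup_open => yr _; exact: open_eball.
- by move=> x [].
- move=> y Ky; split; first exact: KU.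
  have [r r0 Hr] := H y Ky; exists (y, r) => //; exact: eball_self.
rewrite predeqE => x; split=> -[Bx [Ux [yr Pyr xyr]]].
  by split; [exact/(Pyr x xyr)|split => //; exists yr].
by split; [exact/(Pyr x xyr)|split => //; exists yr].
Qed.

End BoundaryAgreement.

(** * Borel representatives of normalized sets *)

Section Reduction.
Variables (R : realType) (n : nat).
Implicit Types (x y z : 'rV[R]_n) (A B C E F G K U V W : set 'rV[R]_n) (d r p q : R).

(** The given sets are only Lebesgue measurable; the estimates are carried out on a Borel subset of
    full measure, the same kind of kernel as in [perimeter]. *)
Definition borel_kernel B E : Prop := [/\ borel B, B `<=` E &
  exists C, [/\ borel C, E `<=` C & leb (C `\` B) = 0%E]].

(** [borel] and [measurable] are convertible, since the measurable sets of rows are generated by the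
    open ones. *)
Lemma leb_lam A : borel A -> leb A = lam R n A.
Proof.
move=> mA; have mA' : measurable A by [].
rewrite /leb ge0_iintE => [||x]; last by rewrite lee_fin.
  by rewrite integral_indic// setIT.
by apply/measurable_EFinP; exact: measurable_indic.
Qed.

Lemma itg_null (f g : 'rV[R]_n -> R) N : bcsupp f -> bcsupp g -> measurable N ->
  lam R n N = 0%E -> (forall x, ~ N x -> f x = g x) -> itg f = itg g.
Proof.
move=> bf bg mN N0 fg; apply: EFin_inj; rewrite (itg_EFin bf) (itg_EFin bg).
apply: ae_eq_integral => //.
- by apply/measurable_EFinP; have [[]] := bf.
- by apply/measurable_EFinP; have [[]] := bg.
exists N; split => // x /= nfg; apply: contrapT => /fg E; apply: nfg => _.
by rewrite E.
Qed.

Lemma divint_kernel B B' E V (phi : 'rV[R]_n -> 'rV[R]_n) : borel_kernel B E -> borel_kernel B' E ->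
  C1field V phi -> divint (\1_B : _ -> R) phi = divint (\1_B' : _ -> R) phi.
Proof.
move=> [mB BE [C [mC EC C0]]] [mB' B'E [C' [mC' EC' C'0]]] fp.
have mD : measurable (C `\` B) by exact: measurableD.
have mD' : measurable (C' `\` B') by exact: measurableD.
rewrite leb_lam// in C0; rewrite leb_lam// in C'0.
have bB : bmeas (\1_B : 'rV[R]_n -> R) by exact: bmeas_indic.
have bB' : bmeas (\1_B' : 'rV[R]_n -> R) by exact: bmeas_indic.
apply: (@itg_null _ _ ((C `\` B) `|` (C' `\` B'))).
- exact: (bcsupp_mul_div bB fp).
- exact: (bcsupp_mul_div bB' fp).
- exact: measurableU.
- have H := @measureU2 _ _ _ (lam R n) _ _ mD mD'.
  by rewrite [X in (_ <= X + _)%E]C0 [X in (_ <= _ + X)%E]C'0 adde0 in H; apply/eqP; rewrite eq_le measure_ge0 andbT.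
move=> x nN; congr (_ * _); apply: indic_eq; split=> H; apply: contrapT => nH; apply: nN.
  by right; split => //; exact/EC'/BE.
by left; split => //; exact/EC/B'E.
Qed.

(** [perimeter] ranges over all kernels of [E], but the value on a field does not depend on the
    kernel, so one of them suffices. *)
Lemma perimeter_leP B E V q : borel_kernel B E ->
  (perimeter E V <= q%:E)%E <-> tvle (\1_B : _ -> R) V q.
Proof.
move=> kB; have [mB BE [C HC]] := kB.
have bB' B' : borel B' -> bmeas (\1_B' : 'rV[R]_n -> R) by move=> ?; exact: bmeas_indic.
split=> [Eq phi aphi|Bq].
  rewrite -lee_fin; apply: le_trans Eq; apply: ereal_sup_ubound.
  exists phi, B; split => //; first by exists C.
  have /admissibleP[fp _] := aphi.
  by rewrite (iint_bcsupp (bcsupp_mul_div (bB' B mB) fp)).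
apply: ge_ereal_sup => _ [phi [B' [aphi mB' B'E HC' ->]]].
have /admissibleP[fp _] := aphi.
rewrite (iint_bcsupp (bcsupp_mul_div (bB' B' mB') fp)) lee_fin -/(divint _ phi).
rewrite (@divint_kernel B' B E V phi _ kB fp); last by split.
exact: Bq.
Qed.

Lemma locfinper_lfp B E : borel_kernel B E -> locfinper E -> lfp B.
Proof.
move=> kB [_ fE] V oV bV; have Vlt := fE V oV bV.
have [mB BE HC] := kB.
have V0 : (0 <= perimeter E V)%E.
  apply: ereal_sup_ubound; exists (fun=> 0), B; split => //; first exact: admissible0.
  have bB : bmeas (\1_B : 'rV[R]_n -> R) by exact: bmeas_indic.
  have /admissibleP[fp _] := @admissible0 R n V.
  by rewrite (iint_bcsupp (bcsupp_mul_div bB fp)) -/(divint _ _) divint0.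
exists (fine (perimeter E V)); apply/(perimeter_leP _ _ kB).
by rewrite fineK// ge0_fin_numE.
Qed.

Lemma lfp_locfinper B E : borel_kernel B E -> lfp B -> locfinper E.
Proof.
move=> kB fB; have [mB BE [C [mC EC C0]]] := kB; split; first by exists B, C.
move=> V oV bV; have [p Bp] := fB V oV bV.
by apply: le_lt_trans (ltry p); apply/(perimeter_leP _ _ kB).
Qed.

Lemma relcc_compact X C U : compact C -> open U -> X `<=` C -> C `<=` U -> relcc X U.
Proof.
move=> cC oU XC CU; have clC := compact_closed (@norm_hausdorff _ _) cC.
have XC' : closure X `<=` C by rewrite [C](closure_id _).1//; exact: closure_subset.
split; first exact: (subclosed_compact (@closed_closure _ _) cC).
by rewrite (interior_id _).1//; exact: subset_trans CU.
Qed.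

(** [H] exceeds [G] only by points of a null set, the hull [D] of [E] minus [B]; adding this set to
    [G] gives a Borel hull of [H]. *)
Lemma borel_kernel_modify B E G H : borel_kernel B E -> borel G -> G `<=` H ->
  (forall x, H x -> ~ G x -> E x /\ ~ B x) -> borel_kernel G H.
Proof.
move=> [mB BE [D [mD ED D0]]] mG GH HG; split => //.
have mG' : measurable G by []. have mB' : measurable B by []. have mD' : measurable D by [].
have mDB : measurable (D `\` B) by exact: measurableD.
have mGD : measurable (G `|` (D `\` B)) by exact: measurableU.
have mS : measurable ((G `|` (D `\` B)) `\` G) by exact: measurableD.
exists (G `|` (D `\` B)); split => //.
  move=> x Hx; have [Gx|nG] := pselect (G x); first by left.
  by have [Ex nB] := HG x Hx nG; right; split => //; exact: ED.
rewrite leb_lam//; rewrite leb_lam// in D0.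
apply/eqP; rewrite eq_le measure_ge0 andbT -D0; apply: le_measure; rewrite ?inE//.
by move=> x [[]].
Qed.

Lemma sub_amin_minimal B E U : open U -> borel_kernel B E -> sub_amin E U -> sub_minimal B U.
Proof.
move=> oU kB sE C G cC CU mG GB BG fG q Gq; apply/(perimeter_leP _ _ kB).
have [mB BE _] := kB.
(* Off [C] all of [E] is kept, including its points outside the kernel [B], so that the difference
   from [E] stays inside [C]. *)
pose F := (E `\` C) `|` G.
have FE : F `<=` E by move=> x [[]//|/GB/BE].
have kG : borel_kernel G F.
  apply: (borel_kernel_modify kB) => //; first by move=> x; right.
  by move=> x [[Ex nC]|//] nG; split => // Bx; apply: nG; exact: BG.
have sym : symdiff E F `<=` C.
  move=> x [[Ex nF]|[/FE//]]; apply: contrapT => nC; apply: nF.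
  by left.
have := sE F (lfp_locfinper kG fG) (relcc_compact cC oU sym CU).
rewrite (_ : E `&` F = F); last by rewrite setIC; exact/setIidPl.
by move=> /le_trans; apply; apply/(perimeter_leP _ _ kG).
Qed.

Lemma super_amin_minimal B F U : open U -> borel_kernel B F -> super_amin F U -> super_minimal B U.
Proof.
move=> oU kB sF C G cC CU mG BG GB fG q Gq; apply/(perimeter_leP _ _ kB).
have [mB BF _] := kB.
pose H := F `|` G.
have kG : borel_kernel G H.
  apply: (borel_kernel_modify kB) => //; first by move=> x; right.
  by move=> x [Fx|//] nG; split => // Bx; apply: nG; exact: BG.
have sym : symdiff F H `<=` C.
  move=> x [[Fx nH]|[[//|Gx] nF]]; first by exfalso; apply: nH; left.
  by apply: contrapT => nC; apply: nF; apply: BF; exact: GB.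
have := sF H (lfp_locfinper kG fG) (relcc_compact cC oU sym CU).
rewrite (_ : F `|` H = H); last by rewrite /H setUA setUid.
by move=> /le_trans; apply; apply/(perimeter_leP _ _ kG).
Qed.

End Reduction.

(** * Normalized sets and their kernels *)

Section Normalization.
Variables (R : realType) (n : nat).
Implicit Types (x y z : 'rV[R]_n) (A B C E F P : set 'rV[R]_n) (r s : R).

(** A translate of [rho s] vanishes outside the ball and has positive integral. *)
Lemma lam_eball_neq0 z s : 0 < s -> lam R n (eball z s) <> 0%E.
Proof.
move=> s0 L0; have bs := bcsupp_translate (- z) (@bcsupp_rho R n s s0).
have : itg (fun y => rho s (y - z)) = 0.
  rewrite -(itg0 R n); apply: (itg_null bs (bcsupp_cst0 R n) _ L0).
    exact: measurable_eball.
  by move=> x; rewrite /eball /= => /negP; rewrite -leNgt => /(rho_out s0).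
rewrite (itg_translate (- z) (@bcsupp_rho R n s s0)) => N0.
by have := rhoN_gt0 n s0; rewrite /rhoN N0 ltxx.
Qed.

Lemma le_lmeas A B : A `<=` B -> (lmeas A <= lmeas B)%E.
Proof.
move=> AB; apply: le_ereal_sup => _ [C [mC CA] <-]; exists C => //.
by split => //; exact: subset_trans AB.
Qed.

Lemma lmeas_lam A : measurable A -> lmeas A = lam R n A.
Proof.
move=> mA; apply/eqP; rewrite eq_le; apply/andP; split.
  apply: ge_ereal_sup => _ [C [mC CA] <-]; rewrite leb_lam//.
  have mC' : measurable C by [].
  by apply: le_measure => //; rewrite inE.
by apply: ereal_sup_ubound; exists A; [by split|exact: leb_lam].
Qed.

Lemma lam0_sub A B : measurable A -> measurable B -> A `<=` B -> lam R n B = 0%E -> lam R n A = 0%E.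
Proof.
move=> mA mB AB B0; apply/eqP; rewrite eq_le measure_ge0 andbT -B0.
by apply: le_measure => //; rewrite inE.
Qed.

Lemma le_lam_split A B : measurable A -> measurable B -> lam R n (A `\` B) = 0%E ->
  (lam R n A <= lam R n (A `&` B))%E.
Proof.
move=> mA mB AB0; rewrite {1}(_ : A = (A `&` B) `|` (A `\` B)); last by rewrite setUIDK.
apply: (le_trans (@measureU2 _ _ _ (lam R n) _ _ _ _)).
- exact: measurableI.
- exact: measurableD.
by rewrite [X in (_ + X)%E]AB0 adde0.
Qed.

Lemma sub_eball x z r : eball x r z -> forall s, s < r - enorm (z - x) -> eball z s `<=` eball x r.
Proof.
move=> xz s sr y; rewrite /eball /= => yz.
have := enormD (y - z) (z - x); rewrite addrA subrK; lra.
Qed.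

(** Small balls around each point of a full ball are full, so the point belongs to [dens1 E]; it is
    not in [dens0 E] because balls have positive measure. *)
Lemma normalized_full E B x r : normalized E -> borel_kernel B E -> 0 < r ->
  lam R n (eball x r `\` B) = 0%E -> eball x r `<=` E.
Proof.
move=> nE [mB BE _] r0 L0 z zx.
have mB' : measurable B by [].
have d0 : 0 < r - enorm (z - x) by move: zx; rewrite /eball /= subr_gt0.
have full s : 0 < s < r - enorm (z - x) -> lmeas (E `&` eball z s) = lam R n (eball z s).
  move=> /andP[s0 sr]; have me := measurable_eball z s.
  apply/eqP; rewrite eq_le -{1}(lmeas_lam me) le_lmeas/=; last by move=> y [].
  have Lz : lam R n (eball z s `\` B) = 0%E.
    apply: (lam0_sub _ _ _ L0).
    - exact: measurableD.
    - by apply: measurableD => //; exact: measurable_eball.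
    - by move=> y [/(sub_eball zx sr)].
  apply: (le_trans (le_lam_split me mB' Lz)).
  rewrite -lmeas_lam; last exact: measurableI.
  by apply: le_lmeas => y [? /BE].
rewrite nE; split.
  right; exists (r - enorm (z - x)) => // s sr.
  by rewrite full// lmeas_lam//; exact: measurable_eball.
move=> [r1 r10 H]; pose s := Num.min (r1 / 2) ((r - enorm (z - x)) / 2).
have s0 : 0 < s by rewrite lt_min !divr_gt0.
have s1 : s <= r1 / 2 by rewrite ge_min lexx.
have s2 : s <= (r - enorm (z - x)) / 2 by rewrite ge_min lexx orbT.
apply: (@lam_eball_neq0 z s s0); rewrite -full; last by apply/andP; split; lra.
by apply: H; apply/andP; split; lra.
Qed.

(** Small balls around such a point meet [E] in a null set, so the point lies in [dens0 E], which
    normalization removes. *)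
Lemma normalized_empty E B x r : normalized E -> borel_kernel B E -> 0 < r ->
  lam R n (eball x r `&` B) = 0%E -> forall z, eball x r z -> ~ E z.
Proof.
move=> nE [mB BE [C [mC EC C0]]] r0 L0 z zx; rewrite nE => -[_]; apply.
have mB' : measurable B by []. have mC' : measurable C by [].
have mCB : measurable (C `\` B) by exact: measurableD.
rewrite leb_lam// in C0.
have d0 : 0 < r - enorm (z - x) by move: zx; rewrite /eball /= subr_gt0.
exists (r - enorm (z - x)) => // s /andP[s0 sr].
have mez := measurable_eball z s; have mex := measurable_eball x r.
apply/eqP; rewrite eq_le; apply/andP; split; last first.
  apply: ereal_sup_ubound; exists set0; first by split=> [|?//]; exact: sigma_algebra0.
  by rewrite leb_lam ?measure0//; exact: sigma_algebra0.
apply: ge_ereal_sup => _ [D [mD DE] <-]; rewrite leb_lam//.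
have mD' : measurable D by [].
have DB : lam R n (D `\` B) = 0%E.
  apply: (lam0_sub _ _ _ C0); [exact: measurableD|exact: measurableD|].
  by move=> y [/DE[/EC]].
apply: (le_trans (le_lam_split mD' mB' DB)).
rewrite (lam0_sub _ _ _ L0)//; [exact: measurableI|exact: measurableI|].
by move=> y [/DE[_ /(sub_eball zx sr)]].
Qed.

Lemma eball_nbhs A x r : 0 < r -> eball x r `<=` A -> nbhs x A.
Proof.
move=> r0 H; rewrite nbhsE; exists (eball x r) => //.
by split; [exact: open_eball|exact: eball_self].
Qed.

Lemma nbhs_eball A x : nbhs x A -> exists2 r, 0 < r & eball x r `<=` A.
Proof.
move=> /nbhs_ballP[r /= r0 H]; exists r => // y; rewrite /eball /= => yx.
by apply: H; rewrite -ball_normE /= distrC (le_lt_trans (mxnorm_le_enorm _)).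
Qed.

(** A kernel is enlarged by the interior of [E], so that the interiors agree, and by a prescribed
    Borel set [P], which serves to nest two kernels. The closures agree because a ball that meets
    the kernel in a null set contains no point of a normalized set. *)
Lemma ess_kernel E P : lebmeas E -> normalized E -> borel P -> P `<=` E ->
  exists B, [/\ borel_kernel B E, P `<=` B, interior B = interior E, closure B = closure E & ess B].
Proof.
move=> [B0 [C [mB0 mC BE0 EC C0]]] nE mP PE.
pose B := B0 `|` (interior E `|` P).
have BE : B `<=` E by move=> x [/BE0//|[/interior_subset//|/PE]].
have kB0 : borel_kernel B0 E by split => //; exists C.
have kB : borel_kernel B E.
  apply: (borel_kernel_modify kB0) => //.
    have mB0' : measurable B0 by []. have mP' : measurable P by [].
    have : measurable B by apply: measurableU => //; apply: measurableU => //; apply: measurable_open; exact: open_interior.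
    by [].
  by move=> x Ex nB; split => // ?; apply: nB; left.
have iBE : interior B = interior E.
  apply/seteqP; split; first exact: interiorS.
  rewrite -[X in X `<=` _](interior_id _).1; last exact: open_interior.
  by apply: interiorS => x Ex; right; left.
have e2 x r : 0 < r -> lam R n (eball x r `&` B) = 0%E -> ~ closure E x.
  move=> r0 L0 cE; have [z [Ez xz]] := cE _ (eball_nbhs r0 (@subset_refl _ _)).
  exact: (normalized_empty nE kB r0 L0 xz).
have cBE : closure B = closure E.
  apply/seteqP; split; first exact: closure_subset.
  move=> x cE; apply: contrapT => ncB.
  have oB : open (~` closure B) by apply: closed_openC; exact: closed_closure.
  have [r r0 Hr] : exists2 r, 0 < r & eball x r `<=` ~` closure B.
    by apply: nbhs_eball; rewrite nbhsE; exists (~` closure B).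
  apply: (e2 x r r0) => //; rewrite (_ : _ `&` _ = set0) ?measure0//.
  by rewrite predeqE => z; split => // -[/Hr nz Bz]; apply: nz; exact: subset_closure.
exists B; split => //; first by move=> x Px; right; right.
split=> x r r0 L0.
  by rewrite iBE; apply: eball_nbhs r0 (normalized_full nE kB r0 L0).
by rewrite cBE; exact: e2 L0.
Qed.

End Normalization.

Theorem mainTheorem2 (R : realType) (n : nat) (U E F : set 'rV[R]_n) :
  open U -> ebounded U ->
  locfinper E -> locfinper F -> normalized E -> normalized F ->
  sub_amin E U -> super_amin F U -> E `<=` F ->
  relcc (tbd E `&` tbd F) U ->
  closure E `&` U = closure (interior E) `&` U ->
  (tbd E `&` tbd F `&` U = set0) \/
  (exists W : set 'rV[R]_n, [/\ open W, W `<=` U, tbd E `&` tbd F `&` U `<=` W &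
       tbd E `&` W = tbd F `&` W]).
Proof.
(* The second alternative is proved in all cases; without contact points its covering condition on
   [W] is vacuous. *)
move=> oU bU fE fF nE nF sE sF EF relK EiE; right.
have [E0 [kE0 _ iE cE eE]] := ess_kernel fE.1 nE (@sigma_algebra0 _ _ _) (@sub0set _ E).
have [mE0 E0E _] := kE0.
(* Prescribing [E0] as a subset makes the two kernels nested. *)
have [F0 [kF0 EF0 iF cF eF]] := ess_kernel fF.1 nF mE0 (subset_trans E0E EF).
have [mF0 F0F _] := kF0.
(* As [E] lies in [F], the common boundary points are those of the closure of [E] outside the
   interior of [F], a form symmetric under complements. *)
have EK : tbd E `&` tbd F = closure E0 `\` interior F0.
  rewrite cE iF; apply/seteqP; split=> x; first by move=> [[? _] [_ ?]].
  move=> [cEx niF]; split; split => //; last exact: closure_subset cEx.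
  by move=> /(interiorS EF).
have KU : closure E0 `\` interior F0 `<=` U.
  by rewrite -EK => x Kx; apply: interior_subset; apply: relK.2; exact: subset_closure.
have cK : compact (closure E0 `\` interior F0).
  apply: (subclosed_compact _ relK.1); last by rewrite -EK; exact: subset_closure.
  by rewrite setDE; apply: closedI; [exact: closed_closure|apply: open_closedC; exact: open_interior].
have E0iE : closure E0 `&` U `<=` closure (interior E0).
  by rewrite cE iE EiE => x [].
have H := boundaries_agree oU bU mE0 mF0 EF0 eE eF (locfinper_lfp kE0 fE) (locfinper_lfp kF0 fF)
  (sub_amin_minimal oU kE0 sE) (super_amin_minimal oU kF0 sF) cK KU E0iE.
have [W [oW WU KW BW]] := boundaries_agree_nbhd oU H KU.
exists W; split => //; first by rewrite EK => x [/KW].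
by move: BW; rewrite cE iE cF iF.
Qed.
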